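(* There exists a first-order sentence $\psi$ over directed graphs, having infinitely many models and infinitely many countermodels, such that: if either SAT or UNSAT reduces in polynomial time to \textsc{Succinct-}$\psi$, then there is a polynomial-time algorithm that solves SAT correctly on all instances whose size belongs to some robust set of integers.
   Context: Graphs are finite directed graphs (loops allowed); first-order sentences use the binary edge relation $E$ and equality. A succinct graph representation is a pair $(N,C)$ where $C$ is a Boolean circuit with $2n$ inputs and one output and $N\le 2^n$ is an integer given in binary; it represents the graph $\mathrm{SGR}(N,C)$ with vertex set $\{0,\dots,N-1\}$ with an edge from $x$ to $y$ iff $C(x,y)=1$ (circuits are assumed no larger than the adjacency matrix of the encoded graph up to a polynomial factor). For a fixed sentence $\psi$, \textsc{Succinct-}$\psi$ is the problem: given $(N,C)$, decide whether $\mathrm{SGR}(N,C)\models\psi$. UNSAT is the set of unsatisfiable CNF formulas. The size of a SAT instance is its number of variables. A set $M$ of integers is robust if for every $k$ there is $\ell\ge 2$ with $\{\ell,\ell+1,\dots,\ell^k\}\subseteq M$. Reductions are polynomial-time many-one reductions. *)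

(* Defs.v *)
From mathcomp Require Import all_boot ssralg poly.

Set Implicit Arguments.
Unset Strict Implicit.
Unset Printing Implicit Defensive.

(** * Directed graphs and first-order logic *)

Record digraph := Digraph { vertex :> finType; edge : rel vertex }.

Definition isomorphic (G H : digraph) : Prop :=
  exists2 f : G -> H, bijective f & forall x y, edge (f x) (f y) = edge x y.

(* Well-scoped de Bruijn syntax: the free variables of a [formula n] are
   indexed by ['I_n], and variable 0 is bound by the innermost quantifier.
   The other connectives and the universal quantifier are definable. *)
Inductive formula : nat -> Type :=
| FEdge n (i j : 'I_n) : formula n
| FEq n (i j : 'I_n) : formula n
| FNot n (f : formula n) : formula n
| FAnd n (f g : formula n) : formula n
| FEx n (f : formula n.+1) : formula n.

Definition sentence := formula 0.

Fixpoint holds (G : digraph) n (f : formula n) : n.-tuple G -> bool :=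
  match f in formula n return n.-tuple G -> bool with
  | FEdge _ i j => fun e => edge (tnth e i) (tnth e j)
  | FEq _ i j => fun e => tnth e i == tnth e j
  | FNot _ f1 => fun e => ~~ holds f1 e
  | FAnd _ f1 f2 => fun e => holds f1 e && holds f2 e
  | FEx _ f1 => fun e => [exists x : G, holds f1 [tuple of x :: e]]
  end.

Definition models (G : digraph) (psi : sentence) : Prop := holds psi [tuple of [::] : seq G].

(* Infinitely many graphs up to isomorphism: no finite family exhausts them. *)
Definition infinitely_many (P : digraph -> Prop) : Prop :=
  forall n (H : 'I_n -> digraph),
    exists2 G, P G & forall i, ~ isomorphic G (H i).

(** * Boolean circuits and succinct graph representations *)

(* The arguments of a gate are wire numbers.  In a circuit with m inputs,
   wires 0, ..., m-1 are the inputs and wire m + j is the output of the j-th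
   gate of the list. *)
Inductive gate :=
| GConst of bool
| GNot of nat
| GAnd of nat & nat
| GOr of nat & nat.

Record circuit := Circuit {
  inputs : nat;
  gates : seq gate;
  output_wire : nat }.

Definition gate_args (g : gate) : seq nat :=
  match g with
  | GConst _ => [::]
  | GNot i => [:: i]
  | GAnd i j | GOr i j => [:: i; j]
  end.

(* Gates only refer to earlier wires, and the output is an existing wire. *)
Definition circuit_wf (C : circuit) : bool :=
  [forall j : 'I_(size (gates C)),
     all (fun i => i < inputs C + j) (gate_args (nth (GConst false) (gates C) j))]
  && (output_wire C < inputs C + size (gates C)).

Definition gate_eval (w : seq bool) (g : gate) : bool :=
  match g with
  | GConst b => b
  | GNot i => ~~ nth false w i
  | GAnd i j => nth false w i && nth false w j
  | GOr i j => nth false w i || nth false w j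
  end.

Definition circuit_eval (C : circuit) (x : seq bool) : bool :=
  nth false (foldl (fun w g => rcons w (gate_eval w g)) x (gates C))
      (output_wire C).

Definition circuit_size (C : circuit) : nat := inputs C + size (gates C).

(* The n low-order binary digits of x, least significant first. *)
Definition digits (n x : nat) : seq bool := mkseq (fun i => odd (x %/ 2 ^ i)) n.

Definition sgr_valid (N : nat) (C : circuit) : Prop :=
  circuit_wf C /\ exists2 n, inputs C = n.*2 & N <= 2 ^ n.

Definition SGR (N : nat) (C : circuit) : digraph :=
  let n := (inputs C)./2 in
  @Digraph 'I_N (fun x y => circuit_eval C (digits n x ++ digits n y)).

(** * CNF formulas *)

(* The literal (true, v) is the variable v and (false, v) is its negation. *)
Definition literal := (bool * nat)%type.
Definition cnf := seq (seq literal).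

Definition cnf_eval (a : nat -> bool) (F : cnf) : bool :=
  all (has (fun l : literal => a l.2 == l.1)) F.

Definition satisfiable (F : cnf) : Prop := exists a, cnf_eval a F.

(* Number of distinct variables occurring in F. *)
Definition nvars (F : cnf) : nat :=
  size (undup [seq l.2 | l : literal <- flatten F]).

(** * Encodings as bit strings *)

(* All the codes below are prefix-free, so that they can be concatenated. *)
Definition enc_list T (enc : T -> seq bool) (s : seq T) : seq bool :=
  flatten [seq true :: enc x | x <- s] ++ [:: false].

(* [up_log 2 x.+1] is the number of binary digits of x. *)
Definition enc_binary (x : nat) : seq bool :=
  enc_list (fun b => [:: b]) (digits (up_log 2 x.+1) x).

Definition enc_unary (n : nat) : seq bool := rcons (nseq n true) false.

Definition enc_literal (l : literal) : seq bool := l.1 :: enc_binary l.2.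

Definition enc_cnf (F : cnf) : seq bool := enc_list (enc_list enc_literal) F.

Definition enc_gate (g : gate) : seq bool :=
  match g with
  | GConst b => [:: false; false; b]
  | GNot i => [:: false; true] ++ enc_binary i
  | GAnd i j => [:: true; false] ++ enc_binary i ++ enc_binary j
  | GOr i j => [:: true; true] ++ enc_binary i ++ enc_binary j
  end.

(* The number of inputs is written in unary, so that the length of the code is
   at least the size of the circuit. *)
Definition enc_circuit (C : circuit) : seq bool :=
  enc_unary (inputs C) ++ enc_list enc_gate (gates C) ++
  enc_binary (output_wire C).

Definition enc_sgr (N : nat) (C : circuit) : seq bool :=
  enc_binary N ++ enc_circuit C.

(** * Polynomial time: deterministic multi-tape Turing machines *)

Inductive move := MLeft | MStay | MRight.

(* Tape symbols have type [option (bool + extra)]: [None] is the blank,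
   [Some (inl b)] an input/output bit, [Some (inr a)] an auxiliary symbol. *)
Record TM := MkTM {
  extra_tapes : nat;
  extra : finType;
  state : finType;
  start : state;
  halting : pred state;
  delta : state -> {ffun 'I_extra_tapes.+1 -> option (bool + extra)} ->
          state * {ffun 'I_extra_tapes.+1 -> option (bool + extra)}
                * ('I_extra_tapes.+1 -> move) }.

Definition symbol (M : TM) := option (bool + extra M).

(* A two-way infinite tape: the cells to the left of the head, nearest first,
   and the cells from the head rightwards; all cells not listed are blank. *)
Definition tape (A : Type) := (seq (option A) * seq (option A))%type.

Definition tape_read A (t : tape A) : option A := head None t.2.

Definition tape_write A (a : option A) (t : tape A) : tape A :=
  (t.1, a :: behead t.2).

Definition tape_move A (d : move) (t : tape A) : tape A :=
  match d with
  | MLeft => (behead t.1, head None t.1 :: t.2)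
  | MStay => t
  | MRight => (head None t.2 :: t.1, behead t.2)
  end.

Definition config (M : TM) :=
  (state M * {ffun 'I_(extra_tapes M).+1 -> tape (bool + extra M)})%type.

Definition step (M : TM) (c : config M) : config M :=
  if halting c.1 then c else
  let: (q, w, d) := delta c.1 [ffun i => tape_read (c.2 i)] in
  (q, [ffun i => tape_move (d i) (tape_write (w i) (c.2 i))]).

(* The input is on tape 0, starting at the head; the other tapes are blank. *)
Definition init (M : TM) (x : seq bool) : config M :=
  (start M,
   [ffun i => ([::], if i == ord0 then [seq Some (inl b) | b <- x] else [::])]).

Fixpoint leading_bits A (s : seq (option (bool + A))) : seq bool :=
  if s is Some (inl b) :: s' then b :: leading_bits s' else [::].

(* The output is the longest bit string on tape 0 starting at the head. *)
Definition output (M : TM) (c : config M) : seq bool :=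
  leading_bits (c.2 ord0).2.

Definition computes_in_time (M : TM) (f : seq bool -> seq bool)
    (T : nat -> nat) : Prop :=
  forall x, let c := iter (T (size x)) (@step M) (init M x) in
    halting c.1 /\ output c = f x.

Definition polytime (f : seq bool -> seq bool) : Prop :=
  exists (M : TM) (p : {poly nat}), computes_in_time M f (fun n => p.[n]%R).

(** * Decision problems *)

Definition language := seq bool -> Prop.

Definition reduces (A B : language) : Prop :=
  exists2 f, polytime f & forall x, A x <-> B (f x).

Definition SAT : language :=
  fun x => exists2 F, x = enc_cnf F & satisfiable F.

Definition UNSAT : language :=
  fun x => exists2 F, x = enc_cnf F & ~ satisfiable F.

(* The polynomial b bounds the size of the circuit in terms of the size N ^ 2
   of the adjacency matrix. *)
Definition Succinct (b : {poly nat}) (psi : sentence) : language :=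
  fun x => exists N C,
    [/\ x = enc_sgr N C, sgr_valid N C, circuit_size C <= b.[(N ^ 2)%N]%R
      & models (SGR N C) psi].

Definition robust (S : nat -> Prop) : Prop :=
  forall k, exists2 l, 2 <= l & forall m, l <= m <= l ^ k -> S m.

Definition sat_solvable_on (S : nat -> Prop) : Prop :=
  exists2 A : seq bool -> bool, polytime (fun x => [:: A x]) &
    forall F, S (nvars F) -> (A (enc_cnf F) <-> satisfiable F).

(* Main.v *)
(* The sentence psi0 describes finite stages of the cumulative hierarchy in which
   every level is the six-fold power set of the previous one; so the size of its
   models grows by a six-fold exponential from one to the next.  Let f reduce SAT
   or UNSAT to Succinct-psi0, let x code a formula with n variables, and put
   y = f x.  If |x| >= 2^n, then trying all assignments takes polynomial time.
   Otherwise |y| is polynomial in 2^n, and if y is a positive instance, then the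
   size of its graph is at most 2^|y|.  When n lies in the gap above a model size
   N, that graph has at most N vertices, so |y| is polynomial in N, and y is
   decided by a bounded search over numbers below |x|.  For every k, the gap above
   a large N contains {l, ..., l^k}, where l is exponential in a power of N.

   Both searches are done by programs whose registers are heads on a read-only
   copy of x and y, and so hold numbers up to |x| + 1.  The functions computed by
   such programs are closed under composition and bounded iteration, and a Turing
   machine runs such a program in polynomial time. *)

Require Import Defs.
From Stdlib Require Import Classical_Prop.
From mathcomp Require Import all_boot ssralg ssrint poly zify.

Set Implicit Arguments.
Unset Strict Implicit.
Unset Printing Implicit Defensive.

(** * Programs on a ruler *)

(** The algorithm is total and never tests whether n lies in a gap; that is used only in its
    correctness proof. If y is too long for the search, y is declared a negative instance, and in a
    gap this is right. A boolean that flips the verdict on y treats SAT and UNSAT alike.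

    The bound on circuits in terms of the adjacency matrix is what makes |y| polynomial in N;
    otherwise a small graph could hide behind a long code. Polynomial sparseness of the model sizes
    would not do: between N and the next size there must be room for l, exponential in a power of N,
    then for l^k, for 2^n, for a polynomial in 2^n bounding |y|, and for 2^|y|.

    The obstacle is that polynomial time refers to explicit machines, and that the reduction is
    given only as such a machine. Registers bounded by the ruler make every loop polynomial, but
    they forbid large numbers. Hence the variables of a formula, whose numbers may be exponential in
    |x|, are named by positions in x; the gates of a guessed circuit are packed into numbers below
    2^(|y|^2); and arithmetic saturates at the end of the ruler. *)

Definition cellsym := (bool * bool * option bool * option bool)%type.

Definition strings := (seq bool * seq bool)%type.

(** The first string alone fixes the length: cell 0 is the begin mark, cell [ruler w] the end mark,
    and symbols of the second string that would lie beyond the end mark are invisible to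
    programs. *)
Definition ruler (w : strings) : nat := (size w.1).+1.

(* The ruler carries a begin mark, an end mark and, in cell [p.+1], the p-th
   symbols of the two strings. *)
Definition cell (w : strings) (p : nat) : cellsym :=
  (p == 0, p == ruler w, if p is p'.+1 then onth w.1 p' else None,
   if p is p'.+1 then onth w.2 p' else None).

Inductive prog :=
| PSkip
| PLeft of nat
| PRight of nat
| PSeq of prog & prog
| PIf of nat & pred cellsym & prog & prog
| PWhile of nat & pred cellsym & prog.

Definition upd (r : nat -> nat) i v j := if j == i then v else r j.

(** Running time is counted along with the run. No rule moves a head left of cell 0 or right of the
    end mark, so a derivation also certifies that the heads stay on the ruler. *)
Inductive exec (w : strings) : prog -> (nat -> nat) -> nat -> (nat -> nat) -> Prop :=
| exec_skip r : exec w PSkip r 1 r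
| exec_left r i : 0 < r i -> exec w (PLeft i) r 1 (upd r i (r i).-1)
| exec_right r i : r i < ruler w -> exec w (PRight i) r 1 (upd r i (r i).+1)
| exec_seq P Q r r1 r2 t1 t2 :
    exec w P r t1 r1 -> exec w Q r1 t2 r2 -> exec w (PSeq P Q) r (t1 + t2) r2
| exec_if i (f : pred cellsym) P Q r t r1 :
    exec w (if f (cell w (r i)) then P else Q) r t r1 ->
    exec w (PIf i f P Q) r t.+1 r1
| exec_while_end i (f : pred cellsym) P r : ~~ f (cell w (r i)) ->
  exec w (PWhile i f P) r 1 r
| exec_while_step i (f : pred cellsym) P r t1 r1 t2 r2 : f (cell w (r i)) ->
    exec w P r t1 r1 -> exec w (PWhile i f P) r1 t2 r2 ->
    exec w (PWhile i f P) r (t1 + t2).+1 r2.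

Definition pos_test (s : cellsym) := ~~ s.1.1.1.

Lemma pos_testE w p : pos_test (cell w p) = (0 < p).
Proof. by rewrite /pos_test /= lt0n. Qed.

Definition end_test (s : cellsym) := s.1.1.2.

Lemma end_testE w p : end_test (cell w p) = (p == ruler w).
Proof. by []. Qed.

Definition PZero i := PWhile i pos_test (PLeft i).

Lemma exec_zero w i r : exists2 r', exec w (PZero i) r (2 * r i).+1 r' &
  forall j, r' j = if j == i then 0 else r j.
Proof.
move E: (r i) => n; elim: n r E => [|n IH] r E.
  exists r; first by apply: exec_while_end; rewrite pos_testE E.
  by move=> j; case: eqP => // ->.
have [|r' H1 H2] := IH (upd r i (r i).-1); first by rewrite /upd eqxx E.
exists r'.
  rewrite (_ : (2 * n.+1).+1 = (1 + (2 * n).+1).+1); last by lia.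
  apply: exec_while_step H1; first by rewrite pos_testE E.
  by apply: exec_left; rewrite E.
by move=> j; rewrite H2 /upd; case: eqP.
Qed.

Definition PAdd i j := PWhile i pos_test (PSeq (PLeft i) (PRight j)).

Lemma exec_add w i j r : i != j -> r i + r j <= ruler w ->
  exists2 r', exec w (PAdd i j) r (3 * r i).+1 r' &
    forall k, r' k = if k == i then 0 else if k == j then r i + r j else r k.
Proof.
move=> ij; move E: (r i) => n; elim: n r E => [|n IH] r E le.
  exists r; first by apply: exec_while_end; rewrite pos_testE E.
  by move=> k; case: eqP => [->//|_]; case: eqP => [->|].
have [||r' H1 H2] := IH (upd (upd r i (r i).-1) j (r j).+1).
- by rewrite /upd (negPf ij) eqxx E.
- by rewrite /upd eqxx; lia.
exists r'.
  rewrite (_ : (3 * n.+1).+1 = (2 + (3 * n).+1).+1); last by lia.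
  apply: exec_while_step H1; first by rewrite pos_testE E.
  apply: (exec_seq (t1 := 1) (t2 := 1)); first by apply: exec_left; rewrite E.
  have -> : (r j).+1 = (upd r i (r i).-1 j).+1 by rewrite /upd eq_sym (negPf ij).
  by apply: exec_right; rewrite /upd eq_sym (negPf ij); lia.
move=> k; rewrite H2 /upd eqxx; case: eqP => // nki; case: eqP => // _; lia.
Qed.

Definition PAdd2 i j k :=
  PWhile i pos_test (PSeq (PLeft i) (PSeq (PRight j) (PRight k))).

Lemma exec_add2 w i j k r : i != j -> i != k -> j != k ->
  r i + r j <= ruler w -> r i + r k <= ruler w ->
  exists2 r', exec w (PAdd2 i j k) r (4 * r i).+1 r' &
    forall l, r' l = if l == i then 0 else if l == j then r i + r j else
                     if l == k then r i + r k else r l.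
Proof.
move=> ij ik jk; move E: (r i) => n; elim: n r E => [|n IH] r E le1 le2.
  exists r; first by apply: exec_while_end; rewrite pos_testE E.
  by move=> l; case: eqP => [->//|_]; case: eqP => [->|] //; case: eqP => [->|].
pose r1 := upd r i (r i).-1; pose r2 := upd r1 j (r1 j).+1.
pose r3 := upd r2 k (r2 k).+1.
have e1 : r1 j = r j by rewrite /r1 /upd eq_sym (negPf ij).
have e2 : r2 k = r k by rewrite /r2 /r1 /upd eq_sym (negPf jk) eq_sym (negPf ik).
have e3 : r3 i = n by rewrite /r3 /r2 /r1 /upd (negPf ij) (negPf ik) eqxx E.
have e4 : r3 j = (r j).+1 by rewrite /r3 /r2 /upd (negPf jk) eqxx e1.
have e5 : r3 k = (r k).+1 by rewrite /r3 /upd eqxx e2.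
have [||r' H1 H2] := IH r3 e3; try lia.
exists r'.
  rewrite (_ : (4 * n.+1).+1 = (3 + (4 * n).+1).+1); last by lia.
  apply: exec_while_step H1; first by rewrite pos_testE E.
  apply: (exec_seq (t1 := 1) (t2 := 2)); first by apply: exec_left; rewrite E.
  apply: (exec_seq (t1 := 1) (t2 := 1)); apply: exec_right; rewrite -/r1 -/r2 ?e1 ?e2;
    lia.
move=> l; rewrite H2; case: eqP => // /eqP nli; case: eqP => [_|/eqP nlj]; first lia.
case: eqP => [_|/eqP nlk]; first lia.
by rewrite /r3 /r2 /r1 /upd (negPf nlk) (negPf nlj) (negPf nli).
Qed.

(** * Functions computable on a ruler in polynomial time *)

(* The elements of a context are the values of the variables in scope together
   with the two strings; [dom] is the hypothesis on them, and [agree a r] says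
   that the registers r, among those below [lvl], hold the values in a. *)
Record ctx := Ctx {
  car :> Type;
  dom : car -> Prop;
  inp : car -> strings;
  lvl : nat;
  agree : car -> (nat -> nat) -> Prop;
  agreeP : forall a r r', (forall j, j < lvl -> r j = r' j) ->
             agree a r -> agree a r' }.

Definition len (C : ctx) (a : C) := ruler (inp a).

(* For every free register d, some program computes g into d in polynomial time,
   using the registers from d upwards as scratch memory. *)
Variant comput (C : ctx) (g : C -> nat) : Prop := Comput of
  forall d, lvl C <= d -> exists P k, forall (a : C) r,
    dom a -> (forall j, r j <= len a) -> agree a r ->
    exists t r', [/\ exec (inp a) P r t r', t <= (len a).+2 ^ k,
      forall j, r' j <= len a, r' d = g a & forall j, j < d -> r' j = r j].

Lemma agree_lt (C : ctx) (a : C) r r' d : lvl C <= d ->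
  (forall j, j < d -> r' j = r j) -> agree a r -> agree a r'.
Proof. by move=> le H; apply: agreeP => j lt; rewrite H //; lia. Qed.

Section Ext.
Variables (C : ctx) (r0 : nat) (Q : C -> nat -> Prop).

Lemma ext_agreeP (a : C * nat) r r' :
  (forall j, j < maxn r0.+1 (lvl C) -> r j = r' j) ->
  agree a.1 r /\ r r0 = a.2 -> agree a.1 r' /\ r' r0 = a.2.
Proof.
move=> H [ag e]; split; last by rewrite -H //; lia.
by apply: agreeP ag => j lt; apply: H; lia.
Qed.

(** A new variable, kept in register [r0] and subject to [Q]: this is how a loop hands its index and
    its accumulator to its body. *)
Definition ext : ctx :=
  @Ctx (C * nat) (fun a => dom a.1 /\ Q a.1 a.2) (fun a => inp a.1)
    (maxn r0.+1 (lvl C)) (fun a r => agree a.1 r /\ r r0 = a.2) ext_agreeP.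
End Ext.

Definition cmorph (C' C : ctx) (phi : C' -> C) :=
  lvl C <= lvl C' /\ forall a : C', dom a ->
    [/\ dom (phi a), inp (phi a) = inp a & forall r, agree a r -> agree (phi a) r].

(** Weakening: a function of outer variables stays computable inside a loop, because its program may
    be placed at any register above the level of its own context. *)
Lemma comp_pull (C' C : ctx) (phi : C' -> C) (g : C -> nat) : comput g ->
  cmorph phi -> comput (fun a => g (phi a)).
Proof.
move=> [cg] [le H]; constructor=> d led.
have [P [k HP]] := cg d (leq_trans le led).
exists P, k => a r da ler ag; have [da' e H'] := H a da.
have el : len (phi a) = len a by rewrite /len e.
have [|t [r' [h1 h2 h3 h4 h5]]] := HP (phi a) r da' _ (H' _ ag); first by rewrite el.
by exists t, r'; rewrite -el -e.
Qed.

Lemma comp_eq (C : ctx) (g h : C -> nat) : comput h ->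
  (forall a, dom a -> g a = h a) -> comput g.
Proof.
move=> [ch] E; constructor=> d led; have [P [k HP]] := ch d led.
by exists P, k => a r da ler ag; rewrite E //; apply: HP.
Qed.

(** Addition empties its source, so register [j] is poured into [d] and [d.+1] at once and then
    refilled from [d.+1]. *)
Lemma comp_var (C : ctx) j (g : C -> nat) : j < lvl C ->
  (forall a r, agree a r -> r j = g a) -> comput g.
Proof.
move=> ltj Hj; constructor=> d led.
exists (PSeq (PZero d) (PSeq (PZero d.+1) (PSeq (PAdd2 j d d.+1) (PAdd d.+1 j)))), 6.
move=> a r da ler ag.
have jd : j < d by lia.
have [r1 X1 E1] := exec_zero (inp a) d r.
have [r2 X2 E2] := exec_zero (inp a) d.+1 r1.
have F2 : forall i, r2 i = if (i == d) || (i == d.+1) then 0 else r i.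
  by move=> i; rewrite E2 E1; case: eqP; case: eqP.
have j2 : r2 j = r j by rewrite F2; case: ifP => //; lia.
have d2 : r2 d = 0 by rewrite F2 eqxx.
have d2' : r2 d.+1 = 0 by rewrite F2 eqxx orbT.
have lej := ler j; rewrite /len in lej.
have [|||||r3 X3 E3] := @exec_add2 (inp a) j d d.+1 r2; try lia.
have j3 : r3 j = 0 by rewrite E3 eqxx.
have d3 : r3 d = r j by rewrite E3; do ?[case: ifP => ?]; lia.
have d3' : r3 d.+1 = r j by rewrite E3; do ?[case: ifP => ?]; lia.
have [||r4 X4 E4] := @exec_add (inp a) d.+1 j r3; try lia.
have F4 i : r4 i = if i == d then r j else if i == d.+1 then 0 else r i.
  rewrite E4; case: (i =P d.+1) => [->|n1]; first by rewrite ifF //; lia.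
  case: (i =P j) => [->|n2]; first by rewrite ifF; lia.
  case: (i =P d) => [->//|n3]; rewrite E3 ifF; last by apply/eqP.
  rewrite ifF; last by apply/eqP.
  rewrite ifF; last by apply/eqP.
  by rewrite F2 ifF //; lia.
eexists _, r4; split.
- by apply: exec_seq X1 _; apply: exec_seq X2 _; apply: exec_seq X3 X4.
- have h1 : r1 d.+1 <= len a by rewrite E1 ifF //; lia.
  have h2 := ler d.
  rewrite j2 d3'.
  apply: (@leq_trans (16 * (len a).+2)); first by rewrite /len in h1 h2 *; lia.
  rewrite expnS mulnC leq_mul2l /=.
  by apply: leq_trans (leq_pexp2l _ (isT : 4 <= 5)) => //; apply: (@leq_exp2r 2 _ 4).
- by move=> i; rewrite F4; case: ifP => // _; case: ifP.
- by rewrite F4 eqxx; apply: Hj.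
- by move=> i lt; rewrite F4 !ifF //; lia.
Qed.

Lemma comp_zero (C : ctx) : @comput C (fun=> 0).
Proof.
constructor=> d led; exists (PZero d), 2 => a r da ler ag.
have [r' X E] := exec_zero (inp a) d r.
eexists _, r'; split; first exact: X.
- have := ler d; rewrite expnS expn1; nia.
- by move=> j; rewrite E; case: ifP.
- by rewrite E eqxx.
- by move=> j lt; rewrite E ifF //; lia.
Qed.

(** Since the base is at least 2, a sum of two time bounds is again bounded by a power of the same
    base; all bounds keep one shape. *)
Lemma exp_le2 z k1 k2 : z.+2 ^ k1 + z.+2 ^ k2 <= z.+2 ^ (k1 + k2).+1.
Proof.
have h1 : z.+2 ^ k1 <= z.+2 ^ (k1 + k2) by apply: leq_pexp2l; lia.
have h2 : z.+2 ^ k2 <= z.+2 ^ (k1 + k2) by apply: leq_pexp2l; lia.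
rewrite expnS; nia.
Qed.

(** The successor saturates because a register cannot leave the ruler. Exact operations are
    recovered later from proofs that the values fit. *)
Lemma comp_ssucc (C : ctx) (g : C -> nat) : comput g ->
  comput (fun a => minn (len a) (g a).+1).
Proof.
move=> [cg]; constructor=> d led; have [P [k HP]] := cg d led.
exists (PSeq P (PIf d end_test PSkip (PRight d))), (k + 1).+1 => a r da ler ag.
have [t [r' [X T B E U]]] := HP a r da ler ag.
have h : t + 2 <= (len a).+2 ^ (k + 1).+1.
  by have := exp_le2 (len a) k 1; rewrite expn1; lia.
have gz : g a <= len a by rewrite -E.
case: (altP (r' d =P ruler (inp a))) => eq.
  exists (t + 2), r'; split => //.
    by apply: exec_seq X _; apply: exec_if; rewrite end_testE eq eqxx; apply: exec_skip.
  by rewrite E; rewrite E in eq; rewrite /len eq; lia.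
exists (t + 2), (upd r' d (r' d).+1); split => //.
- apply: exec_seq X _; apply: exec_if; rewrite end_testE (negPf eq).
  by apply: exec_right; have := B d; rewrite /len; lia.
- by move=> j; rewrite /upd; case: ifP => // _; have := B d; rewrite /len; lia.
- by rewrite /upd eqxx E; rewrite E in eq; rewrite /len in gz *; lia.
- by move=> j lt; rewrite /upd ifF ?U //; lia.
Qed.

Lemma comp_pred (C : ctx) (g : C -> nat) : comput g -> comput (fun a => (g a).-1).
Proof.
move=> [cg]; constructor=> d led; have [P [k HP]] := cg d led.
exists (PSeq P (PIf d pos_test (PLeft d) PSkip)), (k + 1).+1 => a r da ler ag.
have [t [r' [X T B E U]]] := HP a r da ler ag.
have h : t + 2 <= (len a).+2 ^ (k + 1).+1.
  by have := exp_le2 (len a) k 1; rewrite expn1; lia.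
case: (posnP (r' d)) => eq.
  exists (t + 2), r'; split => //.
    by apply: exec_seq X _; apply: exec_if; rewrite pos_testE eq; apply: exec_skip.
  by rewrite -E eq.
exists (t + 2), (upd r' d (r' d).-1); split => //.
- apply: exec_seq X _; apply: exec_if; rewrite pos_testE eq.
  by apply: exec_left.
- by move=> j; rewrite /upd; case: ifP => // _; have := B d; lia.
- by rewrite /upd eqxx E.
- by move=> j lt; rewrite /upd ifF ?U //; lia.
Qed.

Lemma comp_len (C : ctx) : comput (fun a : C => len a).
Proof.
constructor=> d led.
exists (PWhile d (fun s => ~~ end_test s) (PRight d)), 2 => a r da ler ag.
suff: exists2 r', exec (inp a) (PWhile d (fun s => ~~ end_test s) (PRight d)) r
    (2 * (len a - r d)).+1 r' & forall j, r' j = if j == d then len a else r j.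
  case=> r' X E; eexists _, r'; split; first exact: X.
  - rewrite expnS expn1; nia.
  - by move=> j; rewrite E; case: ifP.
  - by rewrite E eqxx.
  - by move=> j lt; rewrite E ifF //; lia.
move: (ler d); move E : (len a - r d) => n.
elim: n r E {ler ag} => [|n IH] r E le.
  exists r; first by apply: exec_while_end; rewrite negbK end_testE;
    rewrite /len in E le; lia.
  by move=> j; case: eqP => [->|//]; lia.
have [||r' X1 E1] := IH (upd r d (r d).+1); rewrite /upd ?eqxx; try lia.
exists r'.
  rewrite (_ : (2 * n.+1).+1 = (1 + (2 * n).+1).+1); last by lia.
  apply: exec_while_step X1; first by rewrite end_testE; rewrite /len in E le; lia.
  by apply: exec_right; rewrite /len in E le; lia.
by move=> j; rewrite E1 /upd; case: eqP.
Qed.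

(** A branch of a conditional has to be computable only where its condition holds; here such a
    condition joins the hypotheses on the context. *)
Definition refine (C : ctx) (D : C -> Prop) : ctx :=
  @Ctx C (fun a => dom a /\ D a) (@inp C) (lvl C) (@agree C) (@agreeP C).

Lemma comp_if0 (C : ctx) (b g h : C -> nat) : comput b ->
  comput (C := refine (fun a : C => b a <> 0)) g ->
  comput (C := refine (fun a : C => b a = 0)) h ->
  comput (fun a => if b a == 0 then h a else g a).
Proof.
move=> [cb] [cg] [ch]; constructor=> d led; have [P [k HP]] := cb d led.
have [Pg [kg Hg]] := cg d led; have [Ph [kh Hh]] := ch d led.
exists (PSeq P (PIf d pos_test Pg Ph)), (k + (kg + (kh + 1).+1).+1).+1.
move=> a r da ler ag.
have [t [r' [X T B E U]]] := HP a r da ler ag.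
have ag' : agree a r' := agree_lt led U ag.
have h1 := exp_le2 (len a) k (kg + (kh + 1).+1).+1.
have h2 := exp_le2 (len a) kg (kh + 1).+1.
have h3 := exp_le2 (len a) kh 1.
have h4 : 0 < (len a).+2 ^ kg by rewrite expn_gt0.
rewrite expn1 in h3.
case: eqP => eb.
  have [t' [r2 [X' T' B' E' U']]] := Hh a r' (conj da eb) B ag'.
  exists (t + t'.+1), r2; split => //.
  - by apply: exec_seq X _; apply: exec_if; rewrite pos_testE E eb.
  - rewrite -/(len a) in T'; change (@len (refine (fun a : C => b a =
    0)) a) with (len a) in T'; lia.
  - by move=> j lt; rewrite U' ?U.
have [t' [r2 [X' T' B' E' U']]] := Hg a r' (conj da eb) B ag'.
exists (t + t'.+1), r2; split => //.
- by apply: exec_seq X _; apply: exec_if; rewrite pos_testE E lt0n; move/eqP: eb => ->.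
- change (@len (refine (fun a : C => b a <> 0)) a) with (len a) in T'; lia.
- by move=> j lt; rewrite U' ?U.
Qed.

Lemma exp_ge1 z k : 1 <= z.+2 ^ k. Proof. by rewrite expn_gt0. Qed.

(** The number of rounds is a register value, hence at most the length of the ruler, so a polynomial
    body gives a polynomial loop. The body may assume that its accumulator is the exact value of the
    iteration so far and fits on the ruler; from this the applications derive that the next value
    fits too. *)
Lemma comp_iteri (C : ctx) (n : C -> nat) (a0 : C -> nat) (B : C -> nat -> nat -> nat) :
  comput n -> comput a0 ->
  (forall r, lvl C <= r ->
    comput (C := ext r.+1 (C := ext r (fun (a : C) i => i < n a <= len a))
               (fun b acc => acc = iteri b.2 (B b.1) (a0 b.1) /\ acc <= len b.1))
         (fun c => B c.1.1 c.1.2 c.2)) ->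
  comput (fun a => iteri (n a) (B a) (a0 a)).
Proof.
move=> [cn] [ca] cB; constructor=> d led.
have [Pn [kn Hn]] := cn d led.
have [Pa [ka Ha]] := ca d.+2 (leq_trans led (leqW (leqnSn d))).
have [{}cB] := cB d.+1 (leq_trans led (leqnSn d)).
have [|Pb [kb Hb]] := cB d.+3; first by rewrite /=; lia.
(* Register [d] counts the remaining rounds, [d.+1] is the index and [d.+2] the accumulator; the
   body leaves its result in [d.+3]. *)
pose body := PSeq Pb (PSeq (PZero d.+2) (PSeq (PAdd d.+3 d.+2)
               (PSeq (PRight d.+1) (PLeft d)))).
pose K := (kn + (ka + (kb + 8)).+1).+1.
exists (PSeq Pn (PSeq Pa (PSeq (PZero d.+1) (PSeq (PWhile d pos_test body)
   (PSeq (PZero d) (PAdd d.+2 d)))))), K.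
move=> a r da ler ag.
have [t1 [r1 [X1 T1 B1 E1 U1]]] := Hn a r da ler ag.
have [|t2 [r2 [X2 T2 B2 E2 U2]]] := Ha a r1 da B1; first exact: agree_lt led U1 ag.
have [r3 X3 E3] := exec_zero (inp a) d.+1 r2.
have lp m i (rr : nat -> nat) : m + i = n a -> rr d = m -> rr d.+1 = i ->
    rr d.+2 = iteri i (B a) (a0 a) -> (forall j, rr j <= len a) ->
    (forall j, j < d -> rr j = r j) ->
    exists t r', [/\ exec (inp a) (PWhile d pos_test body) rr t r',
      t <= m * ((len a).+2 ^ kb + 8 * (len a).+2) + 1, forall j, r' j <= len a,
      r' d.+2 = iteri (n a) (B a) (a0 a) & forall j, j < d -> r' j = r j].
  elim: m i rr => [|m IH] i rr ei ed ed1 ed2 le ej.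
    exists 1, rr; split => //.
    - by apply: exec_while_end; rewrite pos_testE ed.
    - by rewrite ed2; congr (iteri _ _ _); lia.
  have [||t [q [Xb Tb Bb Eb Ub]]] := Hb (a, i, iteri i (B a) (a0 a)) rr _ le.
  - split; first by split => //=; have := B1 d; rewrite E1; lia.
    by rewrite /= -ed2.
  - by split => //; split => //=; apply: agree_lt led ej ag.
  rewrite /len /= -/(len a) in Xb Tb Bb.
  rewrite /= in Eb.
  have q0 : q d = m.+1 by rewrite Ub ?ed //; lia.
  have q1 : q d.+1 = i by rewrite Ub ?ed1 //; lia.
  have [q2 Y2 F2] := exec_zero (inp a) d.+2 q.
  have [||q3 Y3 F3] := @exec_add (inp a) d.+3 d.+2 q2; first lia.
    by rewrite !F2 eqxx ifF; [rewrite addn0; apply: Bb | lia].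
  have g3 j : q3 j = if j == d.+3 then 0 else if j == d.+2 then q d.+3 else q j.
    rewrite F3; case: eqP => // n1; rewrite !F2 eqxx addn0.
    by case: eqP => // n2; rewrite ifF //; lia.
  pose q4 := upd q3 d.+1 (q3 d.+1).+1; pose q5 := upd q4 d (q4 d).-1.
  have e4 : q4 d = m.+1 by rewrite /q4 /upd ifF ?g3 ?ifF //; lia.
  have q31 : q3 d.+1 = i by rewrite g3 !ifF //; lia.
  have lt1 : i < len a by have := B1 d; rewrite E1; lia.
  have g5 j : q5 j = if j == d then m else if j == d.+1 then i.+1 else q3 j.
    by rewrite /q5 /upd e4; case: eqP => // n1; rewrite /q4 /upd q31.
  have [||||||t' [rr' [X' T' B' E' U']]] := IH i.+1 q5.
  - lia.
  - by rewrite g5 eqxx.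
  - by rewrite g5 eqxx ifF //; lia.
  - by rewrite g5 !ifF ?g3 ?eqxx ?ifF ?Eb ?iteriS //; lia.
  - move=> j; rewrite g5; case: ifP => _; first by have := le d; lia.
    case: ifP => // _; rewrite g3; case: ifP => // _; case: ifP => // _; exact: Bb.
  - by move=> j lt; rewrite g5 !ifF ?g3 ?ifF ?Ub ?ej //; lia.
  exists (t + ((2 * q d.+2).+1 + ((3 * q2 d.+3).+1 + (1 + 1))) + t').+1, rr'; split => //.
    apply: exec_while_step X'; first by rewrite pos_testE ed.
    apply: exec_seq Xb _; apply: exec_seq Y2 _; apply: exec_seq Y3 _.
    apply: exec_seq; first by apply: exec_right; rewrite q31.
    by apply: exec_left; rewrite -/q4 e4.
  have h1 := Bb d.+2.
  have h2 : q2 d.+3 <= len a by rewrite F2 ifF ?Bb //; lia.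
  rewrite mulSn; nia.
have [||||||t4 [r4 [X4 T4 B4 E4 U4]]] := lp (n a) 0 r3.
- lia.
- by rewrite E3 ifF ?U2 ?E1 //; lia.
- by rewrite E3 eqxx.
- by rewrite E3 ifF ?E2 //; lia.
- by move=> j; rewrite E3; case: ifP.
- by move=> j lt; rewrite E3 ifF ?U2 ?U1 //; lia.
have [r5 X5 E5] := exec_zero (inp a) d r4.
have [||r6 X6 E6] := @exec_add (inp a) d.+2 d r5; first lia.
  by rewrite !E5 eqxx ifF; [rewrite addn0; apply: B4|lia].
have F6 j : r6 j = if j == d.+2 then 0 else if j == d then r4 d.+2 else r4 j.
  rewrite E6; case: eqP => // n1; rewrite !E5 eqxx addn0.
  by case: eqP => // n2; rewrite ifF //; lia.
eexists _, r6; split.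
- apply: exec_seq X1 _; apply: exec_seq X2 _; apply: exec_seq X3 _.
  by apply: exec_seq X4 _; apply: exec_seq X5 X6.
- have h1 := exp_le2 (len a) kn (ka + (kb + 8)).+1.
  have h2 := exp_le2 (len a) ka (kb + 8).
  have h3 := exp_ge1 (len a) kb.
  have h4 : 256 <= (len a).+2 ^ 8 by apply: (@leq_exp2r 2 _ 8).
  have h5 : (len a).+2 ^ (kb + 8) =
    (len a).+2 ^ kb * ((len a).+2 ^ 6 * ((len a).+2 * (len a).+2)).
    by rewrite expnD (_ : 8 = 6 + 2) // expnD mulnn.
  have h6 : 64 <= (len a).+2 ^ 6 by apply: (@leq_exp2r 2 _ 6).
  have b1 := B2 d.+1; have b2 := B4 d.
  have b3 : r5 d.+2 <= len a by rewrite E5 ifF ?B4 //; lia.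
  have b4 : n a <= len a by rewrite -E1.
  move: (len a) T1 T2 T4 h1 h2 h3 h5 h6 b1 b2 b3 b4 {h4} => z T1 T2 T4 h1 h2 h3 h5 h6
    b1 b2 b3 b4.
  rewrite /K.
  suff: n a * (z.+2 ^ kb + 8 * z.+2) + 1 + 10 * z + 10 <= z.+2 ^ (kb + 8) by lia.
  rewrite h5; move: (z.+2 ^ kb) (z.+2 ^ 6) h3 h6 => x y hx hy.
  apply: (@leq_trans (x * (64 * (z.+2 * z.+2))));
    last by rewrite !leq_mul2l leq_mul2r hy !orbT.
  apply: (@leq_trans (z * (x + 8 * z.+2) + 1 + 10 * z + 10));
    first by rewrite !leq_add2r leq_mul2r b4 orbT.
  nia.
- move=> j; rewrite F6; case: ifP => // _; case: ifP => // _; exact: B4.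
- by rewrite F6 ifF ?eqxx ?E4 //; lia.
- by move=> j lt; rewrite F6 !ifF ?U4 //; lia.
Qed.

(** A register is a head, so computing the address already moves the head there; one more step right
    is due to the begin mark in cell 0. The register is then reset to hold the answer. *)
Lemma comp_sym (C : ctx) (f : option bool -> option bool -> bool) (g : C -> nat) :
  comput g -> (forall a, dom a -> g a < len a) ->
  comput (fun a => f (onth (inp a).1 (g a)) (onth (inp a).2 (g a)) : nat).
Proof.
move=> [cg] ltg; constructor=> d led; have [P [k HP]] := cg d led.
exists (PSeq P (PSeq (PRight d) (PIf d (fun s => f s.1.2 s.2)
   (PSeq (PZero d) (PRight d)) (PZero d)))), (k + 3).+1 => a r da ler ag.
have [t [r1 [X T B E U]]] := HP a r da ler ag.
have h := exp_le2 (len a) k 3.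
pose r2 := upd r1 d (r1 d).+1.
have lt := ltg a da; rewrite /len in lt.
have X2 : exec (inp a) (PRight d) r1 1 r2 by apply: exec_right; rewrite E.
have [r3 X3 E3] := exec_zero (inp a) d r2.
have e2 : r2 d = (g a).+1 by rewrite /r2 /upd eqxx E.
have h2 : t + 2 * (g a).+1 + 5 <= (len a).+2 ^ (k + 3).+1.
  by move: h T lt; rewrite /len !expnS expn0; nia.
case Ef: (f _ _).
  exists (t + (1 + ((2 * r2 d).+1 + 1).+1)), (upd r3 d (r3 d).+1); split.
  - apply: exec_seq X _; apply: exec_seq X2 _; apply: exec_if.
    rewrite e2 /= Ef -e2; apply: exec_seq X3 _.
    by apply: exec_right; rewrite E3 eqxx.
  - rewrite e2; lia.
  - move=> j; rewrite /upd; case: ifP => _; first by rewrite E3 eqxx.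
    by rewrite E3; case: ifP => // njd; rewrite /r2 /upd njd.
  - by rewrite /upd eqxx E3 eqxx.
  - move=> j ltj; have jd : (j == d) = false by lia.
    by rewrite /upd jd E3 jd /r2 /upd jd U.
exists (t + (1 + ((2 * r2 d).+1).+1)), r3; split.
- apply: exec_seq X _; apply: exec_seq X2 _; apply: exec_if.
  by rewrite e2 /= Ef -e2; apply: X3.
- rewrite e2; lia.
- by move=> j; rewrite E3; case: ifP => // njd; rewrite /r2 /upd njd.
- by rewrite E3 eqxx.
- move=> j ltj; have jd : (j == d) = false by lia.
  by rewrite E3 jd /r2 /upd jd U.
Qed.

(** * Arithmetic on a ruler *)

Notation compb b := (comput (fun a => nat_of_bool (b a))).

Ltac comp_morph :=
  solve [split; [simpl; lia
    | let a := fresh "a" in intros a ?; unfold len in *; simpl in *; split; intuition]].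

Ltac comp_reg :=
  match goal with H : is_true (lvl _ <= ?r) |- _ =>
    first [ apply: (@comp_var _ r); [solve [simpl in *; lia] | solve [simpl; intuition]]
          | apply: (@comp_var _ r.+1); [solve [simpl in *; lia] | solve [simpl;
            intuition]]]
  end.

Ltac comp_hyp :=
  match goal with H : comput _ |- _ =>
    first [exact: H | apply: (comp_pull H); comp_morph] end.

Ltac comp_rule := fail.

Ltac comp_auto :=
  cbv beta; repeat first [comp_hyp | comp_rule | comp_reg].

(** A computable value ends up in a register and therefore fits on the ruler; this bound may be
    added to the hypotheses for free. *)
Lemma comp_know (C : ctx) (h g : C -> nat) : comput h ->
  comput (C := refine (fun a : C => h a <= len a)) g -> comput g.
Proof.
move=> [ch] [cg]; constructor=> d led; have [P [k HP]] := cg d led;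
  exists P, k => a r da ler ag.
have [Ph [kh Hh]] := ch d led; have [t [r' [_ _ B E _]]] := Hh a r da ler ag.
by apply: HP => //; split=> //; rewrite -E.
Qed.

Lemma comp_one (C : ctx) : @comput C (fun=> 1).
Proof.
apply: (comp_eq (comp_ssucc (@comp_zero C))) => a _; rewrite /len /ruler; lia.
Qed.

Lemma comp_succ (C : ctx) (g : C -> nat) : comput g ->
  (forall a, dom a -> g a < len a) -> comput (fun a => (g a).+1).
Proof. by move=> cg H; apply: (comp_eq (comp_ssucc cg)) => a /H; lia. Qed.

Lemma comp_sconst (C : ctx) c : comput (fun a : C => minn (len a) c).
Proof.
elim: c => [|c IH]; first by apply: (comp_eq (comp_zero C)) => a _; lia.
by apply: (comp_eq (comp_ssucc IH)) => a _; lia.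
Qed.

Lemma comp_const (C : ctx) c : (forall a : C, dom a -> c <= len a) ->
  @comput C (fun=> c).
Proof. by move=> H; apply: (comp_eq (comp_sconst C c)) => a /H; lia. Qed.

Lemma comp_refine (C : ctx) (D D' : C -> Prop) (g : C -> nat) :
  comput (C := refine D) g -> (forall a, dom a -> D' a -> D a) ->
  comput (C := refine D') g.
Proof.
move=> cg H; apply: (@comp_pull (refine D') (refine D) (fun a => a) _ cg).
by split=> //= a [da Da]; split=> //; split=> //; apply: H.
Qed.

Lemma comp_if (C : ctx) (b : C -> bool) (g h : C -> nat) : compb b ->
  comput (C := refine (fun a : C => b a)) g ->
  comput (C := refine (fun a : C => ~~ b a)) h ->
  comput (fun a => if b a then g a else h a).
Proof.
move=> cb cg ch.
apply: (comp_eq (comp_if0 cb (g := g) (h := h) _ _)).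
- by apply: (comp_refine cg) => a _; case: (b a).
- by apply: (comp_refine ch) => a _; case: (b a).
- by move=> a _; case: (b a).
Qed.

(** Evaluation is lazy: the second conjunct may rely on the first, for instance on a bound that
    makes its own values fit. *)
Lemma comp_and (C : ctx) (b c : C -> bool) : compb b ->
  compb (fun a : refine (fun a : C => b a) => c a) ->
  compb (fun a => b a && c a).
Proof.
move=> cb cc; apply: (comp_eq (comp_if cb cc (comp_zero _))) => a _.
by case: (b a).
Qed.

Lemma comp_or (C : ctx) (b c : C -> bool) : compb b ->
  compb (fun a : refine (fun a : C => ~~ b a) => c a) ->
  compb (fun a => b a || c a).
Proof.
move=> cb cc; apply: (comp_eq (comp_if cb (comp_one _) cc)) => a _.
by case: (b a).
Qed.

Lemma comp_neg (C : ctx) (b : C -> bool) : compb b -> compb (fun a => ~~ b a).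
Proof.
move=> cb; apply: (comp_eq (comp_if cb (comp_zero _) (comp_one _))) => a _.
by case: (b a).
Qed.

Lemma comp_eq0 (C : ctx) (g : C -> nat) : comput g -> compb (fun a => g a == 0).
Proof.
move=> cg; apply: (comp_eq (comp_if0 cg (comp_zero _) (comp_one _))) => a _.
by case: (g a == 0).
Qed.

Lemma comp_true (C : ctx) : compb (fun _ : C => true).
Proof. exact: comp_one. Qed.

Lemma comp_false (C : ctx) : compb (fun _ : C => false).
Proof. exact: comp_zero. Qed.

Lemma iteri_succ n x : iteri n (fun=> succn) x = x + n.
Proof. by elim: n => [|n IH] /=; lia. Qed.

Lemma comp_add (C : ctx) (g h : C -> nat) : comput g -> comput h ->
  (forall a, dom a -> g a + h a <= len a) -> comput (fun a => g a + h a).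
Proof.
move=> cg ch H.
apply: (comp_eq (comp_iteri (B := fun _ _ acc => acc.+1) ch cg _)).
  move=> r ler; apply: comp_succ; first by comp_auto.
  move=> [[a i] acc] /= [[da lti] [-> _]]; rewrite iteri_succ /len /=.
  by have := H a da; rewrite /len; lia.
by move=> a da; rewrite iteri_succ.
Qed.

Lemma iteri_ssucc z n x : x <= z ->
  iteri n (fun _ v => minn z v.+1) x = minn z (x + n).
Proof. by move=> le; elim: n => [|n IH] /=; lia. Qed.

Lemma comp_sadd (C : ctx) (g h : C -> nat) : comput g -> comput h ->
  comput (fun a => minn (len a) (g a + h a)).
Proof.
move=> cg ch; apply: (comp_know cg).
apply: (comp_eq (comp_iteri (C := refine (fun a : C => g a <= len a))
  (n := h) (a0 := g) (B := fun a _ acc => minn (len a) acc.+1) _ _ _)).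
- by comp_auto.
- by comp_auto.
- move=> r ler; apply: comp_ssucc; comp_auto.
by move=> a [_ le]; rewrite iteri_ssucc.
Qed.

Lemma iteri_pred n x : iteri n (fun=> predn) x = x - n.
Proof. by elim: n => [|n IH] /=; lia. Qed.

Lemma comp_sub (C : ctx) (g h : C -> nat) : comput g -> comput h ->
  comput (fun a => g a - h a).
Proof.
move=> cg ch; apply: (comp_eq (comp_iteri (B := fun _ _ acc => acc.-1) ch cg _)).
  move=> r ler; apply: comp_pred; comp_auto.
by move=> a _; rewrite iteri_pred.
Qed.

Lemma comp_leq (C : ctx) (g h : C -> nat) : comput g -> comput h ->
  compb (fun a => g a <= h a).
Proof. by move=> cg ch; apply: comp_eq0 (comp_sub cg ch). Qed.

Lemma comp_ltn (C : ctx) (g h : C -> nat) : comput g -> comput h ->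
  compb (fun a => g a < h a).
Proof.
by move=> cg ch; apply: (comp_eq (comp_neg (comp_leq ch cg))) => a _; rewrite -ltnNge.
Qed.

Lemma comp_eqn (C : ctx) (g h : C -> nat) : comput g -> comput h ->
  compb (fun a => g a == h a).
Proof.
move=> cg ch; apply: (comp_eq (comp_and (comp_leq cg ch) _)).
- by apply: (comp_leq (C := refine (fun a : C => g a <= h a)) (g := h) (h := g));
  comp_auto.
- by move=> a _; rewrite eqn_leq.
Qed.

Lemma iteri_add n y x : iteri n (fun _ v => v + y) x = x + n * y.
Proof. by elim: n => [|n IH] /=; rewrite ?IH; lia. Qed.

Lemma comp_mul (C : ctx) (g h : C -> nat) : comput g -> comput h ->
  (forall a, dom a -> g a * h a <= len a) -> comput (fun a => g a * h a).
Proof.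
move=> cg ch H.
apply: (comp_eq (comp_iteri (B := fun a _ acc => acc + h a) cg (comp_zero _) _)).
  move=> r ler; apply: comp_add; [by comp_auto | by comp_auto |].
  move=> [[a i] acc] /= [[da lti] [-> _]]; rewrite iteri_add /len /=.
  have := H a da; rewrite /len; nia.
by move=> a da; rewrite iteri_add.
Qed.

Lemma iteri_sadd z n y x : x <= z ->
  iteri n (fun _ v => minn z (v + y)) x = minn z (x + n * y).
Proof. by move=> le; elim: n => [|n IH] /=; rewrite ?IH; lia. Qed.

Lemma comp_smul (C : ctx) (g h : C -> nat) : comput g -> comput h ->
  comput (fun a => minn (len a) (g a * h a)).
Proof.
move=> cg ch.
apply: (comp_eq (comp_iteri (B :=
  fun a _ acc => minn (len a) (acc + h a)) cg (comp_zero _) _)).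
  by move=> r ler; apply: comp_sadd; comp_auto.
by move=> a da; rewrite iteri_sadd.
Qed.

Lemma iteri_sdouble z n : 0 < z ->
  iteri n (fun _ v => minn z (v + v)) 1 = minn z (2 ^ n).
Proof. by move=> le; elim: n => [|n IH] /=; rewrite ?IH ?expn0 ?expnS; lia. Qed.

Lemma comp_spow2 (C : ctx) (g : C -> nat) : comput g ->
  comput (fun a => minn (len a) (2 ^ g a)).
Proof.
move=> cg.
apply: (comp_eq (comp_iteri (B :=
  fun a _ acc => minn (len a) (acc + acc)) cg (comp_one _) _)).
  by move=> r ler; apply: comp_sadd; comp_auto.
by move=> a da; rewrite iteri_sdouble.
Qed.

Lemma comp_pow2 (C : ctx) (g : C -> nat) : comput g ->
  (forall a, dom a -> 2 ^ g a <= len a) -> comput (fun a => 2 ^ g a).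
Proof. by move=> cg H; apply: (comp_eq (comp_spow2 cg)) => a /H; lia. Qed.

Definition bex n (P : nat -> bool) := has P (iota 0 n).
Definition ball n (P : nat -> bool) := all P (iota 0 n).
Definition bcount n (P : nat -> bool) := count P (iota 0 n).

Lemma bexP n (P : pred nat) : reflect (exists2 i, i < n & P i) (bex n P).
Proof.
apply: (iffP hasP) => [[i]|[i lt Pi]]; first by rewrite mem_iota => lt Pi; exists i.
by exists i; rewrite ?mem_iota.
Qed.

Lemma ballP n (P : pred nat) : reflect (forall i, i < n -> P i) (ball n P).
Proof.
apply: (iffP allP) => H i; first by move=> lt; apply: H; rewrite mem_iota.
by rewrite mem_iota; apply: H.
Qed.

Lemma bcountS n (P : pred nat) : bcount n.+1 P = bcount n P + P n.
Proof. by rewrite /bcount -addn1 iotaD count_cat /= addn0. Qed.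

Lemma bcount_le n (P : pred nat) : bcount n P <= n.
Proof. by rewrite /bcount (leq_trans (count_size _ _)) // size_iota. Qed.

Lemma comp_bcount (C : ctx) (n : C -> nat) (B : C -> nat -> bool) : comput n ->
  (forall r, lvl C <= r ->
    compb (fun b : ext r (fun (a : C) i => i < n a <= len a) => B b.1 b.2)) ->
  comput (fun a => bcount (n a) (B a)).
Proof.
move=> cn cB.
have E (a : C) i : iteri i (fun j acc => acc + B a j) 0 = bcount i (B a).
  by elim: i => //= i ->; rewrite bcountS.
apply: (comp_eq (comp_iteri (B := fun a i acc => acc + B a i) cn (comp_zero _) _)).
  move=> r ler; apply: comp_add; first by comp_auto.
    by have := cB r ler => {}cB; comp_auto.
  move=> [[a i] acc] /= [[da lti] [-> _]]; rewrite E /len /=.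
  have := bcount_le i (B a); rewrite /len in lti; lia.
by move=> a da; rewrite E.
Qed.

Lemma comp_bex (C : ctx) (n : C -> nat) (B : C -> nat -> bool) : comput n ->
  (forall r, lvl C <= r ->
    compb (fun b : ext r (fun (a : C) i => i < n a <= len a) => B b.1 b.2)) ->
  compb (fun a => bex (n a) (B a)).
Proof.
move=> cn cB.
apply: (comp_eq (comp_neg (comp_eq0 (comp_bcount cn cB)))) => a _.
by rewrite /bcount /bex has_count lt0n.
Qed.

Lemma comp_ball (C : ctx) (n : C -> nat) (B : C -> nat -> bool) : comput n ->
  (forall r, lvl C <= r ->
    compb (fun b : ext r (fun (a : C) i => i < n a <= len a) => B b.1 b.2)) ->
  compb (fun a => ball (n a) (B a)).
Proof.
move=> cn cB.
apply: (comp_eq (comp_neg (comp_bex (B := fun a i => ~~ B a i) cn _))).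
  by move=> r ler; apply: comp_neg; apply: cB.
by move=> a _; rewrite /ball /bex -all_predC; congr (nat_of_bool _);
  apply: eq_all => i /=; rewrite negbK.
Qed.

Lemma iteri_odd n : iteri n (fun _ v => (v == 0) : nat) 0 = odd n.
Proof. by elim: n => //= n ->; case: (odd n). Qed.

Lemma comp_odd (C : ctx) (g : C -> nat) : comput g -> compb (fun a => odd (g a)).
Proof.
move=> cg.
apply: (comp_eq (comp_iteri (B := fun _ _ acc => (acc == 0) : nat) cg (comp_zero _) _)).
  by move=> r ler; apply: comp_eq0; comp_auto.
by move=> a _; rewrite iteri_odd.
Qed.

Lemma bcount_odd n : bcount n odd = n./2.
Proof.
elim: n => // n IH; rewrite bcountS IH /= uphalf_half; lia.
Qed.

Lemma comp_half (C : ctx) (g : C -> nat) : comput g -> comput (fun a => (g a)./2).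
Proof.
move=> cg; apply: (comp_eq (comp_bcount (B := fun _ i => odd i) cg _)).
  by move=> r ler; apply: comp_odd; comp_auto.
by move=> a _; rewrite bcount_odd.
Qed.

Lemma iteri_half n x : iteri n (fun _ v => v./2) x = x %/ 2 ^ n.
Proof. by elim: n => [|n IH] /=; rewrite ?divn1 // IH expnSr divnMA divn2. Qed.

(** Repeated halving never forms the power of 2, which need not fit on the ruler. *)
Lemma comp_div2 (C : ctx) (g h : C -> nat) : comput g -> comput h ->
  comput (fun a => g a %/ 2 ^ h a).
Proof.
move=> cg ch; apply: (comp_eq (comp_iteri (B := fun _ _ acc => acc./2) ch cg _)).
  by move=> r ler; apply: comp_half; comp_auto.
by move=> a _; rewrite iteri_half.
Qed.

Definition bit x i := odd (x %/ 2 ^ i).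

Lemma comp_bit (C : ctx) (g h : C -> nat) : comput g -> comput h ->
  compb (fun a => bit (g a) (h a)).
Proof. by move=> cg ch; apply: comp_odd; apply: comp_div2. Qed.

Lemma iteri_double n x : iteri n (fun _ v => v + v) x = x * 2 ^ n.
Proof. by elim: n => [|n IH] /=; rewrite ?muln1 // IH expnS; nia. Qed.

Lemma comp_mul2 (C : ctx) (g h : C -> nat) : comput g -> comput h ->
  (forall a, dom a -> g a * 2 ^ h a <= len a) ->
  comput (fun a => g a * 2 ^ h a).
Proof.
move=> cg ch H; apply: (comp_eq (comp_iteri (B := fun _ _ acc => acc + acc) ch cg _)).
  move=> r ler; apply: comp_add; [by comp_auto | by comp_auto |].
  move=> [[a i] acc] /= [[da /andP [lti _]] [-> _]]; rewrite iteri_double /len /=.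
  apply: leq_trans (H a da); rewrite addnn -muln2 -mulnA -expnSr leq_mul2l.
  by rewrite leq_pexp2l // orbT.
by move=> a _; rewrite iteri_double.
Qed.

Lemma comp_mod2 (C : ctx) (g h : C -> nat) : comput g -> comput h ->
  comput (fun a => g a %% 2 ^ h a).
Proof.
move=> cg ch; apply: (comp_know cg).
apply: (comp_eq (comp_sub (C := refine (fun a : C => g a <= len a)) (g := g)
  (h := fun a => (g a %/ 2 ^ h a) * 2 ^ h a) _ _)).
- by comp_auto.
- apply: comp_mul2; [by apply: comp_div2; comp_auto | by comp_auto |].
  by move=> a [_ le]; apply: leq_trans (leq_divM _ _) le.
- by move=> a _; rewrite {2}(divn_eq (g a) (2 ^ h a)) addKn.
Qed.

(** * Structured fragments of Turing machines *)

Section Fragments.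
Variables (I : finType) (sym : Type).

(** A head position with a total content function. Writing is a function update at an absolute
    address, which suits invariants about cells better than two lists that shift with the head. *)
Definition ztape := (int * (int -> sym))%type.

Definition zread (t : ztape) : sym := t.2 t.1.

Definition shift (m : move) (p : int) : int :=
  match m with MLeft => p - 1 | MStay => p | MRight => p + 1 end%R.

Definition zact (a : sym * move) (t : ztape) : ztape :=
  (shift a.2 t.1, fun i => if i == t.1 then a.1 else t.2 i).

Definition zconfig := I -> ztape.

(* [None] leaves the tape untouched. *)
Definition action := I -> option (sym * move).

Definition reads (c : zconfig) : {ffun I -> sym} := [ffun i => zread (c i)].

Definition acts (w : action) (c : zconfig) : zconfig :=
  fun i => if w i is Some a then zact a (c i) else c i.

(** A piece of machine with one entry and one exit, the exit being [None], so that pieces can be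
    plugged into one another. *)
Record frag := Frag {
  fstate : finType;
  fstart : fstate;
  fdelta : fstate -> {ffun I -> sym} -> option fstate * action }.

Inductive frunq (F : frag) : fstate F -> zconfig -> nat -> zconfig -> Prop :=
| frun_end q c w : fdelta q (reads c) = (None, w) -> frunq q c 1 (acts w c)
| frun_step q q' c w t c' : fdelta q (reads c) = (Some q', w) ->
    frunq q' (acts w c) t c' -> frunq q c t.+1 c'.

Definition frun F c t c' := frunq (fstart F) c t c'.

Definition fatom (f : {ffun I -> sym} -> action) : frag :=
  @Frag unit tt (fun _ r => (None, f r)).

Lemma frun_atom f c : frun (fatom f) c 1 (acts (f (reads c)) c).
Proof. exact: frun_end. Qed.

Definition idle : action := fun=> None.

Definition fseq (F G : frag) : frag :=
  @Frag (fstate F + fstate G)%type (inl (fstart F)) (fun q r =>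
    match q with
    | inl q => let: (o, w) := fdelta q r in
               (Some (if o is Some q' then inl q' else inr (fstart G)), w)
    | inr q => let: (o, w) := fdelta q r in (omap inr o, w)
    end).

Lemma frun_seq F G c t c' t' c'' : frun F c t c' -> frun G c' t' c'' ->
  frun (fseq F G) c (t + t') c''.
Proof.
rewrite /frun /= => RF RG.
have {RG} : frunq (F := fseq F G) (inr (fstart G)) c' t' c''.
  elim: RG => [q d w E|q q' d w s d' E _ IH].
    by apply: frun_end; rewrite /= E.
  by apply: frun_step IH; rewrite /= E.
elim: RF => [q d w E|q q' d w s d' E _ IH] RG.
  by apply: frun_step RG; rewrite /= E.
by rewrite addSn; apply: frun_step (IH RG); rewrite /= E.
Qed.

Definition fif (b : pred {ffun I -> sym}) (F G : frag) : frag :=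
  @Frag (option (fstate F + fstate G)) None (fun q r =>
    match q with
    | None => (Some (Some (if b r then inl (fstart F) else inr (fstart G))), idle)
    | Some (inl q) => let: (o, w) := fdelta q r in (omap (Some \o inl) o, w)
    | Some (inr q) => let: (o, w) := fdelta q r in (omap (Some \o inr) o, w)
    end).

Lemma frun_if (b : pred {ffun I ->
  sym}) F G c t c' : frun (if b (reads c) then F else G) c t c' ->
  frun (fif b F G) c t.+1 c'.
Proof.
have L : forall q d s d', frunq (F := F) q d s d' ->
    frunq (F := fif b F G) (Some (inl q)) d s d'.
  move=> q d s d'; elim=> [{}q {}d w E|{}q q' {}d w {}s {}d' E _ IH].
    by apply: frun_end; rewrite /= E.
  by apply: frun_step IH; rewrite /= E.
have R : forall q d s d', frunq (F := G) q d s d' ->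
    frunq (F := fif b F G) (Some (inr q)) d s d'.
  move=> q d s d'; elim=> [{}q {}d w E|{}q q' {}d w {}s {}d' E _ IH].
    by apply: frun_end; rewrite /= E.
  by apply: frun_step IH; rewrite /= E.
rewrite /frun /= => H.
apply: (@frun_step (fif b F G) None
  (Some (if b (reads c) then inl (fstart F) else inr (fstart G))) c idle) => //.
rewrite /acts /=; case: (b _) H => H; [exact: L | exact: R].
Qed.

Definition fwhile (b : pred {ffun I -> sym}) (F : frag) : frag :=
  @Frag (option (fstate F)) None (fun q r =>
    match q with
    | None => (if b r then Some (Some (fstart F)) else None, idle)
    | Some q => let: (o, w) := fdelta q r in (Some o, w)
    end).

Lemma frun_while_end (b : pred {ffun I -> sym}) F c : ~~ b (reads c) ->
  frun (fwhile b F) c 1 c.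
Proof.
move=> nb; apply: (@frun_end (fwhile b F) None c idle).
by rewrite /= (negPf nb).
Qed.

Lemma frun_while_step (b : pred {ffun I -> sym}) F c t c' t' c'' : b (reads c) ->
  frun F c t c' ->
  frun (fwhile b F) c' t' c'' -> frun (fwhile b F) c (t + t').+1 c''.
Proof.
rewrite /frun => yb RF RW.
apply: (@frun_step (fwhile b F) None (Some (fstart F)) c idle); first by rewrite /= yb.
rewrite /acts /=.
elim: RF RW => [q d w E|q q' d w s d' E _ IH] RW.
  by apply: frun_step RW; rewrite /= E.
by rewrite addSn; apply: frun_step (IH RW); rewrite /= E.
Qed.

(** The pattern of every pass over the tapes below: the index of the invariant is the number of
    cells still to be visited, and each costs one test and one action. *)
Lemma frun_sweep (b : pred {ffun I -> sym}) f (Inv : nat -> zconfig -> Prop) :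
  (forall n c, Inv n.+1 c -> b (reads c) /\ Inv n (acts (f (reads c)) c)) ->
  (forall c, Inv 0 c -> ~~ b (reads c)) ->
  forall n c, Inv n c ->
    exists2 c', frun (fwhile b (fatom f)) c (2 * n).+1 c' & Inv 0 c'.
Proof.
move=> H H0; elim=> [|n IH] c Hc.
  by exists c => //; apply: frun_while_end; apply: H0.
have [yb /IH [c' R I0]] := H _ _ Hc; exists c' => //.
rewrite (_ : (2 * n.+1).+1 = (1 + (2 * n).+1).+1); last by lia.
exact: frun_while_step yb (frun_atom _ _) R.
Qed.

End Fragments.

(** * From fragments to Turing machines *)

Definition trel A (t : tape A) (z : ztape (option A)) : Prop :=
  forall n : nat, nth None t.2 n = z.2 (z.1 + n%:Z)%R /\
                  nth None t.1 n = z.2 (z.1 - 1 - n%:Z)%R.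

Lemma trel_read A (t : tape A) z : trel t z -> tape_read t = zread z.
Proof.
by move=> /(_ 0) [H _]; rewrite /tape_read -nth0 H /zread GRing.addr0.
Qed.

Lemma nth_behead_None A (s : seq (option A)) n : nth None (behead s) n = nth None s n.+1.
Proof. by rewrite nth_behead. Qed.

Lemma trel_act A (t : tape A) z a m : trel t z ->
  trel (tape_move m (tape_write a t)) (zact (a, m) z).
Proof.
move=> H; case: t z H => l r [p f] H n; case: m;
  rewrite /tape_write /zact /= ?nth_behead_None.
- split; last first.
    case: (H n.+1) => _ /= ->; rewrite ifF; last by lia.
    by congr f; lia.
  case: n => [|[|n]] /=.
  + by case: (H 0) => _ /= <-; rewrite -nth0 ifF //; lia.
  + by rewrite ifT //; lia.
  + rewrite nth_behead_None; case: (H n.+1) => /= -> _; rewrite ifF; last by lia.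
    by congr f; lia.
- split; last first.
    by case: (H n) => _ /= ->; rewrite ifF //; lia.
  case: n => [|n] /=; first by rewrite ifT //; lia.
  by rewrite nth_behead_None; case: (H n.+1) => /= -> _; rewrite ifF //; lia.
- split.
    case: (H n.+1) => /= -> _; rewrite ifF; last by lia.
    by congr f; lia.
  case: n => [|n] /=; first by rewrite ifT //; lia.
  case: (H n) => _ /= ->; rewrite ifF; last by lia.
  by congr f; lia.
Qed.

(** A machine must write on every tape at every step, so an untouched tape gets back the symbol
    read. This may turn an unlisted blank into a listed one, which [trel] does not notice. *)
Lemma trel_idle A (t : tape A) z : trel t z ->
  trel (tape_move MStay (tape_write (tape_read t) t)) z.
Proof.
move=> H n; case: t H => l r H; have [H1 H2] := H n; split=> //.
rewrite -H1; case: n {H1 H2} => [|n] /=; first by rewrite /tape_read nth0.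
by rewrite nth_behead_None.
Qed.

Section Machine.
Variables (e K : nat) (A : finType).
Let I := ('I_e.+1 + 'I_K)%type.
Variable F : frag I (option (bool + A)).

Definition machine : TM :=
  @MkTM (e + K) A (option (fstate F)) (Some (fstart F)) (fun q => q == None)
    (fun q r =>
      if q is Some q then
        let: (o, w) := fdelta q [ffun i : I => r (unsplit i : 'I_(e + K).+1)] in
        (o, [ffun t : 'I_(e + K).+1 =>
               if w (split (t : 'I_(e.+1 + K))) is Some a then a.1 else r t],
            (fun t : 'I_(e + K).+1 =>
               if w (split (t : 'I_(e.+1 + K))) is Some a then a.2 else MStay))
      else (None, r, fun=> MStay)).

Definition crel (tp : {ffun 'I_(e + K).+1 -> tape (bool + A)})
    (c : zconfig I (option (bool + A))) :=
  forall i : I, trel (tp (unsplit i)) (c i).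

Lemma machine_run q c n c' (tp : {ffun 'I_(e + K).+1 -> tape (bool + A)}) :
  frunq (F := F) q c n c' -> crel tp c ->
  exists2 tp', iter n (@step machine) (Some q, tp) = (None, tp') & crel tp' c'.
Proof.
have S q0 c0 tp0 : crel tp0 c0 -> exists2 tp',
    step ((Some q0, tp0) : config machine) = ((fdelta q0 (reads c0)).1, tp') &
    crel tp' (acts (fdelta q0 (reads c0)).2 c0).
  move=> H; rewrite /step /=.
  have -> : [ffun i : I => [ffun t => tape_read (tp0 t)] (unsplit i : 'I_(e + K).+1)]
      = reads c0.
    by apply/ffunP => i; rewrite !ffunE; apply: trel_read.
  case: (fdelta _ _) => o w; eexists; first by reflexivity.
  move=> i; rewrite !ffunE unsplitK /acts /=.
  case: (w i) => [[a m]|] /=; first exact: trel_act.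
  exact: trel_idle.
move=> R; elim: R tp => {q c n c'} [q c w E|q q' c w n c' E _ IH] tp H.
  by have [tp' /= E' H'] := S q c tp H; rewrite E in E' H'; exists tp'.
have [tp' E' H'] := S q c tp H; rewrite E /= in E' H'.
have [tp'' E'' H''] := IH tp' H'; exists tp'' => //.
by rewrite iterSr E'.
Qed.

End Machine.

(** * Running a program after a given machine *)

Fixpoint maxreg (P : prog) : nat :=
  match P with
  | PSkip => 0
  | PLeft i | PRight i => i
  | PSeq P Q => maxn (maxreg P) (maxreg Q)
  | PIf i _ P Q => maxn i (maxn (maxreg P) (maxreg Q))
  | PWhile i _ P => maxn i (maxreg P)
  end.

Local Notation "n %:Z" := (Posz n) : nat_scope.

Section Pipeline.
Variables (M : TM) (K : nat).

Let sym := option (bool + (extra M + cellsym)).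
Let mtape := 'I_(extra_tapes M).+1.
Let I := (mtape + 'I_K.+1)%type.
Let cfg := zconfig I sym.
Let rds := {ffun I -> sym}.

Definition prj (s : sym) : symbol M :=
  match s with
  | Some (inl b) => Some (inl b)
  | Some (inr (inl a)) => Some (inr a)
  | _ => None
  end.

Definition emb (s : symbol M) : sym :=
  match s with
  | Some (inl b) => Some (inl b)
  | Some (inr a) => Some (inr (inl a))
  | None => None
  end.

Lemma embK s : prj (emb s) = s. Proof. by case: s => [[]|]. Qed.

Definition code (c : cellsym) : sym := Some (inr (inr c)).

Definition fmachine : frag I sym :=
  @Frag I sym (state M) (start M) (fun q (r : rds) =>
    if halting q then (None, @idle I sym) else
    let: (q', w, d) := delta q [ffun i : mtape => prj (r (inl i))] in
    (Some q', fun i => if i is inl j then Some (emb (w j), d j) else None)).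

Definition mrel (tp : {ffun mtape -> tape (bool + extra M)}) (c : cfg) :=
  forall j, trel (tp j) ((c (inl j)).1, fun i => prj ((c (inl j)).2 i)).

Lemma trel_ext A (t : tape A) (z z' : ztape (option A)) :
  trel t z -> z.1 = z'.1 -> z.2 =1 z'.2 -> trel t z'.
Proof. by move=> H e1 e2 n; rewrite -e1 -!e2. Qed.

(** The run may stop before time k, when the machine halts early; the additional step is the exit
    from the fragment. *)
Lemma fmachine_run k q tp (c : cfg) : mrel tp c ->
  halting (iter k (@step M) (q, tp)).1 ->
  exists t c', [/\ t <= k.+1, frunq (F := fmachine) q c t c',
    mrel (iter k (@step M) (q, tp)).2 c' &
    forall j, c' (inr j) = c (inr j)].
Proof.
elim: k q tp c => [|k IH] q tp c H.
  rewrite /= => h; exists 1, (acts (@idle I sym) c); split=> //.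
  by apply: frun_end; rewrite /= h.
rewrite iterSr; case: (boolP (halting q)) => hq.
  have -> : step (q, tp) = (q, tp) by rewrite /step /= hq.
  move=> _; exists 1, (acts (@idle I sym) c); split=> //.
    by apply: frun_end; rewrite /= hq.
  by have -> : iter k (@step M) (q, tp) = (q, tp) by elim: k {IH} => //= k ->;
    rewrite /step /= hq.
set c1 := step (q, tp).
have [q' [w [d [E1 E2]]]] : exists q' w d,
    delta q [ffun i : mtape => prj (reads c (inl i))] = (q', w, d) /\
    c1 = (q', [ffun i => tape_move (d i) (tape_write (w i) (tp i))]).
  rewrite /c1 /step /= (negPf hq).
  have -> : [ffun i : mtape => prj (reads c (inl i))] = [ffun i => tape_read (tp i)].
    by apply/ffunP => i; rewrite !ffunE (trel_read (H i)).
  case: (delta _ _) => [[q' w] d]; exists q', w, d; split=> //.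
rewrite E2 => h.
pose wa : action I sym := fun i => if i is inl j then Some (emb (w j), d j) else None.
have [|t [c' [le R R2 U]]] := IH q' _ (acts wa c) _ h.
  move=> j; rewrite ffunE; apply: trel_ext (trel_act (w j) (d j) (H j)) _ _ => //= i.
  by case: ifP => //; rewrite embK.
exists t.+1, c'; split=> //.
by apply: frun_step R; rewrite /= (negPf hq) E1.
Qed.

Definition cell_of (s : sym) : cellsym :=
  if s is Some (inr (inr c)) then c else (false, false, None, None).

Definition reg_act (i : nat) (m : move) (r : rds) : action I sym :=
  fun t => if t is inr j then if val j == i then Some (r t, m) else None else None.

Definition reg_test (i : nat) (f : pred cellsym) : pred rds :=
  fun r => [exists j : 'I_K.+1, (val j == i) && f (cell_of (r (inr j)))].

Fixpoint fprog (P : prog) : frag I sym :=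
  match P with
  | PSkip => fatom (fun=> @idle I sym)
  | PLeft i => fatom (reg_act i MLeft)
  | PRight i => fatom (reg_act i MRight)
  | PSeq P Q => fseq (fprog P) (fprog Q)
  | PIf i f P Q => fif (reg_test i f) (fprog P) (fprog Q)
  | PWhile i f P => fwhile (reg_test i f) (fprog P)
  end.

(** A tape has a single head, so every register owns a tape with its own copy of the ruler, and its
    value is the position of that head. *)
Definition rrel (w : strings) (r : nat -> nat) (c : cfg) :=
  forall j : 'I_K.+1, (c (inr j)).1 = (r j)%:Z /\
    forall p : nat, p <= ruler w -> (c (inr j)).2 p%:Z = code (cell w p).

Lemma reg_testE w r c i f : rrel w r c -> i <= K -> (forall j, r j <= ruler w) ->
  reg_test i f (reads c) = f (cell w (r i)).
Proof.
move=> R le B; apply/existsP/idP => [[j /andP [/eqP <-]]|H].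
  by rewrite ffunE /zread; have [-> ->] := R j; rewrite ?B.
exists (Ordinal (le : i < K.+1)); rewrite eqxx /= ffunE /zread.
by have [/= -> ->] := R (Ordinal (le : i < K.+1)); rewrite ?B.
Qed.

Lemma reg_act_rel w r (c : cfg) i m v : rrel w r c ->
  (forall j, r j <= ruler w) -> (i <= K -> shift m (r i)%:Z = v%:Z) ->
  rrel w (upd r i v) (acts (reg_act i m (reads c)) c).
Proof.
move=> R B E j; have [E1 E2] := R j; rewrite /acts /reg_act /upd.
have ltj : j <= K by rewrite -ltnS.
case: eqP => [e|_] //=; split; first by rewrite E1 e E // -e.
move=> p le; rewrite E2 // ffunE /zread E1 E2 //; first by case: eqP => // -[->].
Qed.

Lemma fprog_run w P r t r' : exec w P r t r' -> maxreg P <= K ->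
  (forall j, r j <= ruler w) -> forall c, rrel w r c ->
  (forall j, r' j <= ruler w) /\
  exists c', [/\ frun (fprog P) c t c', rrel w r' c' &
    forall i, c' (inl i) = c (inl i)].
Proof.
elim=> {P r t r'}.
- move=> r le B c R; split=> //; exists (acts (@idle I sym) c); split=> //.
  exact: (frun_atom (fun=> @idle I sym)).
- move=> r i pos le B c R; split; first by move=> j; rewrite /upd; case: ifP => // _;
  have := B i; lia.
  exists (acts (reg_act i MLeft (reads c)) c); split=> //.
    exact: (frun_atom (reg_act i MLeft)).
  by apply: reg_act_rel => // _ /=; lia.
- move=> r i pos le B c R; split; first by move=> j; rewrite /upd; case: ifP => // _;
  have := B i; lia.
  exists (acts (reg_act i MRight (reads c)) c); split=> //.
    exact: (frun_atom (reg_act i MRight)).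
  by apply: reg_act_rel => // _ /=; lia.
- move=> P Q r r1 r2 t1 t2 _ IH1 _ IH2 /=; rewrite geq_max => /andP [le1 le2] B c R.
  have [B1 [c1 [X1 R1 U1]]] := IH1 le1 B c R.
  have [B2 [c2 [X2 R2 U2]]] := IH2 le2 B1 c1 R1.
  split=> //; exists c2; split=> //; first exact: frun_seq X1 X2.
  by move=> i; rewrite U2.
- move=> i f P Q r t r1 _ IH /=; rewrite !geq_max => /and3P [le1 le2 le3] B c R.
  have [|B1 [c1 [X1 R1 U1]]] := IH _ B c R; first by case: (f _).
  split=> //; exists c1; split=> //; apply: frun_if; rewrite (reg_testE f R) //.
  by case: (f _) X1.
- move=> i f P r nf /=; rewrite geq_max => /andP [le1 le2] B c R.
  by split=> //; exists c; split=> //; apply: frun_while_end; rewrite (reg_testE f R).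
- move=> i f P r t1 r1 t2 r2 yf _ IH1 _ IH2 /=.
  move=> le; move: (le); rewrite geq_max => /andP [le1 le2] B c R.
  have [B1 [c1 [X1 R1 U1]]] := IH1 le2 B c R.
  have [B2 [c2 [X2 R2 U2]]] := IH2 le B1 c1 R1.
  split=> //; exists c2; split=> //; last by move=> j; rewrite U2.
  by apply: frun_while_step X1 X2; rewrite (reg_testE f R).
Qed.

Definition bit_of (s : sym) : option bool := if s is Some (inl b) then Some b else None.

Definition main_tape : I := inl ord0.
Definition reg0 : I := inr ord0.

Definition at_begin : pred rds := fun r => (cell_of (r reg0)).1.1.1.
Definition at_end : pred rds := fun r => (cell_of (r reg0)).1.1.2.

Definition on_regs (f : I -> option (sym * move)) : action I sym :=
  fun i => if i is inr _ then f i else None.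

Definition on_main_regs (a : option (sym * move)) (f : I -> option (sym * move)) :
    action I sym :=
  fun i => if i is inr _ then f i else if i == main_tape then a else None.

Definition write_begin (r : rds) := on_regs (fun=> Some (code (true, false, None,
  None), MRight)).
Definition write_end (r : rds) := on_regs (fun=> Some (code (false, true, None, None),
  MStay)).
Definition copy_step (r : rds) := on_main_regs (Some (r main_tape, MRight))
  (fun=> Some (code (false, false, bit_of (r main_tape), None), MRight)).
Definition back_step (r : rds) := on_main_regs (Some (r main_tape, MLeft))
  (fun i => Some (r i, MLeft)).
Definition main_right (r : rds) := on_main_regs (Some (r main_tape, MRight)) (fun=> None).
Definition regs_move (m : move) (r : rds) := on_regs (fun i => Some (r i, m)).
Definition overlay_step (m : move) (r : rds) :=
  on_main_regs (if bit_of (r main_tape) is Some _ then Some (r main_tape,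
    MRight) else None)
    (fun i => Some (code ((cell_of (r i)).1, bit_of (r main_tape)), m)).
Definition write_bit (r : rds) := on_main_regs (Some (Some (inl (~~ at_begin r)),
  MRight)) (fun=> None).
Definition write_blank (r : rds) := on_main_regs (Some (None, MLeft)) (fun=> None).

(** The input is copied to the register tapes before the given machine runs, as that machine may
    destroy it. Its output is then overlaid on the second track of these tapes. The final blank cuts
    off what the machine left behind the answer bit. *)
Definition pipeline (P : prog) : frag I sym :=
  fseq (fatom write_begin) (fseq (fwhile (fun r => r main_tape != None) (fatom copy_step))
  (fseq (fatom write_end) (fseq (fwhile (predC at_begin) (fatom back_step))
  (fseq (fatom main_right) (fseq fmachine
  (fseq (fatom (regs_move MRight)) (fseq (fwhile (predC at_end) (fatom (overlay_step
    MRight)))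
  (fseq (fatom (overlay_step MStay)) (fseq (fwhile (predC at_begin) (fatom (regs_move
    MLeft)))
  (fseq (fprog P) (fseq (fatom write_bit) (fatom write_blank)))))))))))).

(** * Running the pipeline pass by pass *)

Section Run.
Variable x : seq bool.
Let n := size x.

Definition xcell (p : int) : sym := if p is Posz k then omap inl (onth x k) else None.

(* Tape 0 still holds the input, with its head at [q]; the other tapes of M are blank. *)
Definition fresh (q : int) (c : cfg) : Prop :=
  [/\ (c main_tape).1 = q, forall p, (c main_tape).2 p = xcell p &
      forall j : mtape, j != ord0 -> c (inl j) = (0%R, fun=> None)].

Definition regs (w : strings) (p : int) (b : nat) (c : cfg) : Prop :=
  forall j : 'I_K.+1, (c (inr j)).1 = p /\
    forall k : nat, k < b -> (c (inr j)).2 k%:Z = code (cell w k).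

Definition zinit : cfg := fun i =>
  if i == main_tape then (0%R, xcell) else (0%R, fun=> None).

Lemma run_begin : exists2 c, frun (fatom write_begin) zinit 1 c &
  fresh 0 c /\ regs (x, [::]) 1 1 c.
Proof.
eexists; first exact: frun_atom.
split; first by split=> // j nj; rewrite /acts /= /zinit ifF //; apply/eqP => -[/eqP];
  rewrite (negPf nj).
move=> j; rewrite /acts /= /zinit; split=> // k lt.
by rewrite ifT; [case: k lt | lia].
Qed.

Lemma run_copy c : fresh 0 c -> regs (x, [::]) 1 1 c ->
  exists2 c', frun (fwhile (fun r : rds => r main_tape != None) (fatom copy_step)) c (2
    * n).+1 c' &
    fresh n c' /\ regs (x, [::]) n.+1 n.+1 c'.
Proof.
move=> Hf Hr.
pose Inv m c := [/\ m <= n, fresh (n - m)%:Z c & regs (x, [::]) (n - m).+1 (n - m).+1 c].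
have S1 m d : Inv m.+1 d -> (fun r : rds => r main_tape != None) (reads d) /\ Inv m
  (acts (copy_step (reads d)) d).
  move=> [le [E1 E2 E3] R].
  have lt : n - m.+1 < size x by rewrite -/n; lia.
  have rd : reads d main_tape = Some (inl (nth false x (n - m.+1))).
    by rewrite ffunE /zread E1 E2 /= onthE (nth_map false).
  split; first by rewrite rd.
  split; first lia.
    split; rewrite /acts /=.
    + rewrite E1; lia.
    + by move=> p; rewrite ffunE /zread; case: eqP => [->|_]; rewrite ?E2.
    + by move=> j nj; rewrite ifF ?E3 //; apply/eqP => -[/eqP]; rewrite (negPf nj).
  move=> j; have [R1 R2] := R j; rewrite /acts /=; split; first by rewrite R1; lia.
  move=> k lk; rewrite R1; case: eqP => [[->]|nk].
    rewrite rd /cell /= onthE (nth_map false) // /ruler /= -/n;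
      congr (code (_, _, _, _)); first lia.
    by case: (n - m.+1).
  by rewrite R2 //; lia.
have S0 d : Inv 0 d -> ~~ (fun r : rds => r main_tape != None) (reads d).
  move=> [_ [E1 E2 _] _].
  rewrite subn0 in E1; rewrite negbK ffunE /zread E1 E2 /= onthE nth_default //.
  by rewrite size_map.
have Sn : Inv n c.
  by split; rewrite ?subnn.
have [c' X [_ F' R']] := @frun_sweep I sym (fun r : rds => r main_tape != None)
  copy_step Inv S1 S0 n c Sn.
by exists c' => //; rewrite subn0 in F' R'.
Qed.

Lemma run_end c : fresh n c -> regs (x, [::]) n.+1 n.+1 c ->
  exists2 c', frun (fatom write_end) c 1 c' &
    fresh n c' /\ regs (x, [::]) n.+1 n.+2 c'.
Proof.
move=> [E1 E2 E3] R; eexists; first exact: frun_atom.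
split=> // j; have [R1 R2] := R j; rewrite /acts /=; split; first by rewrite R1.
move=> k lk; rewrite R1; case: eqP => [[->]|nk].
  by rewrite /cell /= /ruler /= eqxx onthE nth_default ?size_map //; case: (n).
by rewrite R2 //; lia.
Qed.

Lemma run_back c : fresh n c -> regs (x, [::]) n.+1 n.+2 c ->
  exists2 c', frun (fwhile (predC at_begin) (fatom back_step)) c (2 * n.+1).+1 c' &
    fresh (-1)%R c' /\ regs (x, [::]) 0 n.+2 c'.
Proof.
move=> Hf Hr.
pose Inv m c := [/\ m <= n.+1, fresh (m%:Z - 1)%R c & regs (x, [::]) m n.+2 c].
have S1 m d : Inv m.+1 d -> (predC at_begin) (reads d) /\ Inv m (acts (back_step (reads
  d)) d).
  move=> [le [E1 E2 E3] R].
  have [R1 R2] := R ord0.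
  split; first by rewrite /= /at_begin ffunE /zread R1 R2.
  split; first lia.
    split; rewrite /acts /=.
    + rewrite E1; lia.
    + by move=> p; rewrite ffunE /zread; case: eqP => [->|_]; rewrite ?E2.
    + by move=> j nj; rewrite ifF ?E3 //; apply/eqP => -[/eqP]; rewrite (negPf nj).
  move=> j; have [Q1 Q2] := R j; rewrite /acts /=; split; first by rewrite Q1; lia.
  move=> k lk; rewrite ffunE /zread; case: eqP => [e|nk]; rewrite ?Q2 //.
  by rewrite -e Q2.
have S0 d : Inv 0 d -> ~~ (predC at_begin) (reads d).
  move=> [_ _ R].
  by have [R1 R2] := R ord0; rewrite /= /at_begin ffunE /zread R1 R2.
have Sn : Inv n.+1 c.
  split=> //; case: Hf => E1 E2 E3; split=> //; rewrite E1; lia.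
have [c' X [_ F' R']] := @frun_sweep I sym (predC at_begin) back_step Inv S1 S0 n.+1 c Sn.
by exists c'.
Qed.

Lemma run_right c : fresh (-1)%R c -> regs (x, [::]) 0 n.+2 c ->
  exists2 c', frun (fatom main_right) c 1 c' &
    fresh 0 c' /\ regs (x, [::]) 0 n.+2 c'.
Proof.
move=> [E1 E2 E3] R; eexists; first exact: frun_atom.
split=> //; split; rewrite /acts /=.
- by rewrite E1.
- by move=> p; rewrite ffunE /zread; case: eqP => [->|_]; rewrite ?E2.
- by move=> j nj; rewrite ifF ?E3 //; apply/eqP => -[/eqP]; rewrite (negPf nj).
Qed.

Lemma fresh_mrel c : fresh 0 c -> mrel (init M x).2 c.
Proof.
move=> [E1 E2 E3] j k; rewrite /= ffunE; case: (altP (j =P ord0)) => [->|nj] /=.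
  rewrite E1 !E2 GRing.add0r /= nth_nil; split; last first.
    by have -> : (0 - 1 - k%:Z)%R = Negz k by lia.
  rewrite onthE; case: (ltnP k (size x)) => h.
    by rewrite !(nth_map false).
  by rewrite !nth_default ?size_map.
by rewrite E3 // !nth_nil.
Qed.

Variables (y : seq bool).

Definition holds_output (q : int) (f : int -> sym) : Prop :=
  (forall k : nat, k < size y -> bit_of (f (q + k%:Z)%R) = Some (nth false y k)) /\
  bit_of (f (q + (size y)%:Z)%R) = None.

Lemma mrel_output q tp c : mrel tp c -> output ((q, tp) : config M) = y ->
  holds_output (c main_tape).1 (c main_tape).2.
Proof.
move=> H; rewrite /output /=; move: (H ord0); rewrite -/main_tape.
case: (c main_tape) => p f /= Hf Ey; rewrite /holds_output -Ey {Ey}; split.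
  move=> k; have [/= + _] := Hf k.
  move: (tp ord0).2 k => s; rewrite /bit_of.
  have : forall k, k < size (leading_bits s) ->
    nth None s k = Some (inl (nth false (leading_bits s) k)).
    by elim: s => // [[[b|]|]] s IH //= [|k] //=; apply: IH.
  move=> + k => /(_ k) E E' /E; rewrite E'.
  by case: (f _) => // [[b [->]|[]]].
have [/= + _] := Hf (size (leading_bits (tp ord0).2)).
have : forall b, nth None (tp ord0).2 (size (leading_bits (tp ord0).2)) <> Some (inl b).
  by elim: (tp ord0).2 => // [[[b|]|]] s IH //=.
move=> E E'; rewrite E' in E.
by case: (f _) E => // [[b /(_ b)|[]]].
Qed.

Definition half_regs (p : nat) (c : cfg) : Prop :=
  forall j : 'I_K.+1, [/\ (c (inr j)).1 = p%:Z,
    forall k : nat, k < p -> (c (inr j)).2 k%:Z = code (cell (x, y) k) &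
    forall k : nat, p <= k < n.+2 -> (c (inr j)).2 k%:Z = code (cell (x, [::]) k)].

(** The main head advances with the registers up to the end of y and waits there on a symbol that is
    not a bit, so that all later cells receive [None]. *)
Definition reading (q : int) (f : int -> sym) (p : nat) (c : cfg) : Prop :=
  (c main_tape).1 = (q + (minn p.-1 (size y))%:Z)%R /\ forall i, (c main_tape).2 i = f i.

Lemma run_first c q f : holds_output q f -> (c main_tape).1 = q ->
  (forall i, (c main_tape).2 i = f i) ->
  regs (x, [::]) 0 n.+2 c ->
  exists2 c', frun (fatom (regs_move MRight)) c 1 c' &
    half_regs 1 c' /\ reading q f 1 c'.
Proof.
move=> HY E1 E2 R; eexists; first exact: frun_atom.
split; last by split; rewrite /acts /= ?E1; [lia | move=> i; rewrite E2].
move=> j; have [R1 R2] := R j; rewrite /acts /=; split; first by rewrite R1.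
  by move=> k lt; rewrite ffunE /zread R1 R2 //; case: k lt.
by move=> k lt; rewrite R1 R2; [rewrite ifF //|]; lia.
Qed.

Lemma reading_bit q f p c : holds_output q f -> reading q f p.+1 c ->
  bit_of (reads c main_tape) = onth y p.
Proof.
move=> [H1 H2] [E1 E2]; rewrite ffunE /zread E1 E2 onthE.
case: (ltnP p (size y)) => h.
  by rewrite H1 // (nth_map false).
by rewrite H2 nth_default // size_map.
Qed.

Lemma overlay_half q f p c m : holds_output q f -> reading q f p.+1 c ->
  half_regs p.+1 c ->
  p < n.+1 -> let c' := acts (overlay_step m (reads c)) c in
  (forall j : 'I_K.+1, [/\ (c' (inr j)).1 = shift m p.+1%:Z,
    forall k : nat, k < p.+2 -> (c' (inr j)).2 k%:Z = code (cell (x, y) k) &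
    forall k : nat, p.+2 <= k < n.+2 -> (c' (inr j)).2 k%:Z = code (cell (x, [::]) k)]) /\
  reading q f p.+2 c'.
Proof.
move=> HY HR HH lt c'; have rb := reading_bit HY HR; split.
  move=> j; have [R1 R2 R3] := HH j; rewrite /c' /acts /=; split; first by rewrite R1.
    move=> k lk; rewrite ffunE /zread R1 /=; case: eqP => [[->]|nk].
      by rewrite R3 ?rb /=; first by []; lia.
    by apply: R2; lia.
  by move=> k lk; rewrite ifF ?R3 // ?R1; lia.
have [E1 E2] := HR; rewrite /c' /reading /acts /= rb onthE.
case: (ltnP p (size y)) => h.
  rewrite (nth_map false) //=; split; first by rewrite E1; lia.
  by move=> i; rewrite ffunE /zread; case: eqP => [->|].
by rewrite nth_default ?size_map //; split=> //; rewrite E1; lia.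
Qed.

Lemma half_end p c : half_regs p c -> p <= n.+1 -> at_end (reads c) = (p == n.+1).
Proof. by move=> H le; have [R1 R2 R3] := H ord0;
  rewrite /at_end ffunE /zread R1 R3 //; lia. Qed.

Lemma run_overlay c q f : holds_output q f -> half_regs 1 c -> reading q f 1 c ->
  exists2 c', frun (fwhile (predC at_end) (fatom (overlay_step MRight))) c (2 * n).+1 c' &
    half_regs n.+1 c' /\ reading q f n.+1 c'.
Proof.
move=> HY HH HR.
pose Inv m c := [/\ m <= n, half_regs (n - m).+1 c & reading q f (n - m).+1 c].
have S1 m d : Inv m.+1 d -> (predC at_end) (reads d) /\ Inv m (acts ((overlay_step
  MRight) (reads d)) d).
  move=> [le H R].
  split; first by rewrite /= (half_end H); lia.
  have [|A B] := overlay_half MRight HY R H; first lia.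
  have e : (n - m) = (n - m.+1).+1 by lia.
  split; first lia.
    move=> j; have [A1 A2 A3] := A j; rewrite e; split=> //.
    rewrite A1 /=; lia.
  by rewrite e.
have S0 d : Inv 0 d -> ~~ (predC at_end) (reads d).
  move=> [_ H _].
  by rewrite /= (half_end H); lia.
have Sn : Inv n c.
  by split; rewrite ?subnn.
have [c' X [_ F' R']] := @frun_sweep I sym (predC at_end) (overlay_step MRight) Inv S1
  S0 n c Sn.
by exists c' => //; rewrite subn0 in F' R'.
Qed.

Lemma run_last c q f : holds_output q f -> half_regs n.+1 c -> reading q f n.+1 c ->
  exists2 c', frun (fatom (overlay_step MStay)) c 1 c' & regs (x, y) n.+1 n.+2 c'.
Proof.
move=> HY HH HR; eexists; first exact: frun_atom.
have [|A _] := overlay_half MStay HY HR HH; first lia.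
by move=> j; have [A1 A2 A3] := A j; split.
Qed.

Lemma run_rewind c : regs (x, y) n.+1 n.+2 c ->
  exists2 c', frun (fwhile (predC at_begin) (fatom (regs_move MLeft))) c (2 * n.+1).+1
    c' &
    rrel (x, y) (fun=> 0) c'.
Proof.
move=> Hr.
pose Inv m c := m <= n.+1 /\ regs (x, y) m n.+2 c.
have S1 m d : Inv m.+1 d -> (predC at_begin) (reads d) /\ Inv m (acts ((regs_move
  MLeft) (reads d)) d).
  move=> [le R].
  have [R1 R2] := R ord0.
  split; first by rewrite /= /at_begin ffunE /zread R1 R2.
  split; first lia.
  move=> j; have [Q1 Q2] := R j; rewrite /acts /=; split; first by rewrite Q1; lia.
  move=> k lk; rewrite ffunE /zread; case: eqP => [e|nk]; rewrite ?Q2 //.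
  by rewrite -e Q2.
have S0 d : Inv 0 d -> ~~ (predC at_begin) (reads d).
  move=> [_ R].
  by have [R1 R2] := R ord0; rewrite /= /at_begin ffunE /zread R1 R2.
have Sn : Inv n.+1 c.
  by [].
have [c' X [_ R']] := @frun_sweep I sym (predC at_begin) (regs_move MLeft) Inv S1 S0
  n.+1 c Sn.
by exists c' => // j; have [Q1 Q2] := R' j; split.
Qed.

Lemma run_write c r : rrel (x, y) r c -> r 0 <= n.+1 ->
  exists2 c', frun (fseq (fatom write_bit) (fatom write_blank)) c 2 c' &
    (c' main_tape).2 (c' main_tape).1 = Some (inl (r 0 != 0)) /\
    (c' main_tape).2 ((c' main_tape).1 + 1)%R = None.
Proof.
move=> R le; eexists; first by apply: (frun_seq (t := 1) (t' := 1)); exact: frun_atom.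
rewrite /acts /=; case: (c main_tape) => p f /=; split.
  rewrite ifF ?ifT; first last; try lia.
  have [R1 R2] := R ord0; rewrite /at_begin ffunE /zread R1 R2 //=.
by rewrite ifT //; lia.
Qed.

Lemma pipeline_run P r t k : maxreg P <= K -> exec (x, y) P (fun=> 0) t r ->
  halting (iter k (@step M) (init M x)).1 ->
  output (iter k (@step M) (init M x)) = y ->
  exists2 T, T <= k + t + 8 * n + 40 & exists2 c,
    frun (pipeline P) zinit T c &
    (c main_tape).2 (c main_tape).1 = Some (inl (r 0 != 0)) /\
    (c main_tape).2 ((c main_tape).1 + 1)%R = None.
Proof.
move=> leK X Hh Ho.
have [c1 X1 [F1 R1]] := run_begin.
have [c2 X2 [F2 R2]] := run_copy F1 R1.
have [c3 X3 [F3 R3]] := run_end F2 R2.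
have [c4 X4 [F4 R4]] := run_back F3 R3.
have [c5 X5 [F5 R5]] := run_right F4 R4.
have [t6 [c6 [l6 X6 M6 U6]]] := fmachine_run (fresh_mrel F5) Hh.
have HY : holds_output (c6 main_tape).1 (c6 main_tape).2.
  apply: (mrel_output (q := (iter k (@step M) (init M x)).1) M6).
  by rewrite -Ho /init; case: (iter _ _ _).
have R6 : regs (x, [::]) 0 n.+2 c6 by move=> j; rewrite U6; apply: R5.
have [c7 X7 [H7 R7]] := run_first HY erefl (fun=> erefl) R6.
have [c8 X8 [H8 R8]] := run_overlay HY H7 R7.
have [c9 X9 R9] := run_last HY H8 R8.
have [c10 X10 R10] := run_rewind R9.
have [B11 [c11 [X11 R11 _]]] := fprog_run X leK (fun=> leq0n _) R10.
have [c12 X12 E12] := run_write R11 (B11 0).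
eexists; last first.
  exists c12 => //.
  apply: frun_seq X1 _; apply: frun_seq X2 _; apply: frun_seq X3 _.
  apply: frun_seq X4 _; apply: frun_seq X5 _; apply: frun_seq X6 _.
  apply: frun_seq X7 _; apply: frun_seq X8 _; apply: frun_seq X9 _.
  apply: frun_seq X10 _; apply: frun_seq X11 X12.
lia.
Qed.

End Run.
End Pipeline.

(** * From programs to polynomial time *)

Section PolyNat.
Local Open Scope ring_scope.

Lemma hornerDn (p q : {poly nat}) n : (p + q).[n] = (p.[n] + q.[n])%N.
Proof. exact: hornerD. Qed.

Lemma hornerMn (p q : {poly nat}) n : (p * q).[n] = (p.[n] * q.[n])%N.
Proof. exact: hornerM. Qed.

Lemma hornerCn (c n : nat) : (c%:P).[n] = c.
Proof. exact: hornerC. Qed.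

Lemma hornerVn (n : nat) : ('X : {poly nat}).[n] = n.
Proof. exact: hornerX. Qed.

Lemma hornerEn (p : {poly nat}) k n : (p ^+ k).[n] = (p.[n] ^ k)%N.
Proof. by elim: k => [|k IH]; rewrite ?expr0 ?hornerC // GRing.exprS hornerMn IH expnS.
  Qed.

Definition hornerN := (hornerDn, hornerMn, hornerCn, hornerVn, hornerEn).
End PolyNat.

Definition base_ctx : ctx :=
  @Ctx strings (fun=> True) id 0 (fun _ _ => True) (fun _ _ _ _ _ => I).

Lemma zinit_crel (M : TM) K F (x : seq bool) :
  crel (init (@machine (extra_tapes M) K.+1 (extra M + cellsym)%type F) x).2 (@zinit M
    K x).
Proof.
move=> i; rewrite ffunE /zinit.
have -> : (unsplit i == ord0 :> 'I_(extra_tapes M + K.+1).+1) = (i == main_tape M K).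
  apply/eqP/eqP => [E|->]; last exact/val_inj.
  by rewrite -(unsplitK i) E /=; apply: (can_inj (@unsplitK _ _)); rewrite splitK;
    apply/val_inj.
case: eqP => _ k /=; rewrite !nth_nil //; split;
  last by have -> : (0 - 1 - k%:Z)%R = Negz k by lia.
rewrite onthE; case: (ltnP k (size x)) => h.
  by rewrite !(nth_map false).
by rewrite !nth_default ?size_map.
Qed.

Lemma iter_halted (M : TM) k (c : config M) : halting c.1 -> iter k (@step M) c = c.
Proof. by move=> h; elim: k => //= k ->; rewrite /step h. Qed.

(** This bridges the two models of computation: whatever a ruler program decides about x and f x is
    decided by a machine in polynomial time. *)
Lemma polytime_post f (alg : seq bool -> seq bool -> bool) : polytime f ->
  compb (fun w : base_ctx => alg w.1 w.2) -> polytime (fun x => [:: alg x (f x)]).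
Proof.
move=> [M [p HM]] [/(_ 0 (leqnn _)) [P [k HP]]].
pose K := maxreg P.
exists (@machine (extra_tapes M) K.+1 _ (pipeline M K P)).
(* The given machine takes time p; the program takes [(len a).+2 ^ k] with [len a] equal to |x| + 1;
   the linear part pays for the passes over the tapes. *)
exists (p + ('X + (3%N)%:P) ^+ k + (8%N)%:P * 'X + (40%N)%:P)%R.
move=> x; set y := f x.
have [||t [r [X le B E _]]] := HP (x, y) (fun=> 0) I; try by [].
have [h o] := HM x.
have [T leT [c R [E1 E2]]] := pipeline_run (leqnn K) X h o.
have [tp E3 R3] := machine_run R (zinit_crel (pipeline M K P) x).
set q := (_.[_])%R.
have leq : T <= q.
  apply: (leq_trans leT); rewrite /q !hornerN.
  rewrite /len /ruler /= in le.
  by rewrite (addn3 (size x)); lia.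
rewrite -(subnKC leq) addnC iterD.
have -> : iter T (@step (machine (pipeline M K P))) (init (machine (pipeline M K P)) x)
  = (None, tp).
  exact: E3.
rewrite iter_halted //; split=> //.
rewrite /output /=; have H := R3 (main_tape M K).
have e0 : unsplit (main_tape M K) = ord0 by apply/val_inj.
rewrite /= in E.
move: H; rewrite e0 => H; have [H0 _] := H 0; have [H1 _] := H 1.
rewrite GRing.addr0 E1 in H0; rewrite E2 in H1.
case: (tp ord0).2 H0 H1 => [|s0 [|s1 s]] //= -> => [_|->] /=; rewrite E;
  by case: (alg x y).
Qed.

(** * Binary digits *)

Lemma bit0 i : bit 0 i = false. Proof. by rewrite /bit div0n. Qed.

Lemma bit_small x i : x < 2 ^ i -> bit x i = false.
Proof. by move=> lt; rewrite /bit divn_small. Qed.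

Lemma bit_cat M u v i : u < 2 ^ M ->
  bit (u + 2 ^ M * v) i = if i < M then bit u i else bit v (i - M).
Proof.
move=> lt; rewrite /bit; case: ltnP => h.
  have -> : 2 ^ M = 2 ^ (M - i).-1 * 2 * 2 ^ i.
    by rewrite -expnSr prednK -?expnD ?subnK //; lia.
  rewrite mulnAC addnC divnMDl ?expn_gt0 // oddD.
  by rewrite -mulnA mulnCA mul2n odd_double.
have -> : 2 ^ i = 2 ^ M * 2 ^ (i - M) by rewrite -expnD subnKC.
rewrite divnMA (mulnC _ v) addnC divnMDl ?expn_gt0 //.
by rewrite (divn_small lt) addn0.
Qed.

Lemma bits_exist M (P : nat -> bool) :
  exists2 u, u < 2 ^ M & forall i, bit u i = (i < M) && P i.
Proof.
elim: M => [|M [u lt H]]; first by exists 0 => // i; rewrite bit0.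
exists (u + 2 ^ M * P M).
  by rewrite expnS; case: (P M); lia.
move=> i; rewrite bit_cat // H; case: ltngtP => h.
- by rewrite ltnS (ltnW h).
- rewrite [in RHS]ltnS leqNgt h /= bit_small //.
  have := ltn_expl (i - M) (isT : 1 < 2); case: (P M) => /=; lia.
- by rewrite h ltnSn subnn /bit divn1 /=; case: (P M).
Qed.

Lemma bit_inj x y : (forall i, bit x i = bit y i) -> x = y.
Proof.
have [n] := ubnP (x + y); elim: n => // n IH in x y * => lt H.
have e : odd x = odd y by have := H 0; rewrite /bit !divn1.
have [/eqP|pos] := posnP (x + y); first by rewrite addn_eq0 => /andP [/eqP -> /eqP ->].
rewrite -(odd_double_half x) -(odd_double_half y) e (IH x./2 y./2) //; first by lia.
by move=> i; have := H i.+1; rewrite /bit expnS !divnMA !divn2.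
Qed.

(** When a number is read as the set of positions of its one bits, the numbers below 2^M are the
    subsets of the first M numbers. Power sets of initial segments are thus initial segments. *)
Lemma ltn_bits x M : reflect (forall i, bit x i -> i < M) (x < 2 ^ M).
Proof.
apply: (iffP idP) => [lt i|H].
  by rewrite ltnNge; apply: contraTN => le;
    rewrite bit_small // (leq_trans lt) // leq_exp2l.
have [u lt E] := bits_exist M (bit x).
rewrite (_ : x = u) //; apply: bit_inj => i; rewrite E.
by case: (boolP (bit x i)) => [/H ->|]; rewrite ?andbF.
Qed.

Lemma bit_pred2 M i : bit (2 ^ M).-1 i = (i < M).
Proof.
have [u lt E] := bits_exist M xpredT.
rewrite (_ : (2 ^ M).-1 = u); first by rewrite E andbT.
elim: M u lt E => [|M IH] u lt E; first by move: lt; case: u {E}.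
have [v ltv Ev] := bits_exist M xpredT.
have {}IH := IH v ltv Ev.
have -> : u = v + 2 ^ M * 1.
  apply: bit_inj => j; rewrite bit_cat // E Ev !andbT; case: (ltngtP j M) => h.
  - by rewrite ltnS ltnW.
  - rewrite ltnS leqNgt h bit_small //.
    by have := ltn_expl (j - M) (isT : 1 < 2); lia.
  - by rewrite h ltnSn subnn.
by rewrite -IH expnS; have := expn_gt0 2 M; lia.
Qed.

Lemma bit_ltn x i : bit x i -> i < x.
Proof.
move=> b; have := ltn_expl x (isT : 1 < 2).
by move/ltn_bits => /(_ i b).
Qed.

Lemma onth_drop (x : seq bool) p i : onth (drop p x) i = onth x (p + i).
Proof. by rewrite !onthE map_drop nth_drop. Qed.

(** * A sentence with a sparse spectrum *)

Definition tower k N := iter k (expn 2) N.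

(* Six exponentials suffice in [gap_robust]. *)
Definition height := 6.

Fixpoint level i := if i is i'.+1 then tower height (level i') else 0.

Lemma tower_ltn k N : N + k <= tower k N.
Proof.
elim: k => [|k IH] /=; first by rewrite addn0.
rewrite addnS; exact: leq_ltn_trans IH (ltn_expl _ _).
Qed.

Lemma level_ltn i : level i < level i.+1.
Proof. by apply: leq_trans (tower_ltn height (level i)); rewrite -addn1 leq_add2l. Qed.

Lemma leq_level i j : i <= j -> level i <= level j.
Proof.
by apply: (homo_leq (r := leq) (@leqnn)) => [a b c|k];
  [apply: leq_trans | apply/ltnW/level_ltn].
Qed.

Lemma leq_idx_level i : i <= level i.
Proof. by elim: i => // i /leq_ltn_trans; apply; apply: level_ltn. Qed.

Lemma tower_mono k M N : M <= N -> tower k M <= tower k N.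
Proof. by move=> le; elim: k => //= k IH; rewrite leq_exp2l. Qed.

Lemma tower_le k l M : k <= l -> tower k M <= tower l M.
Proof.
move=> le; rewrite -(subnK le) /tower iterD; have := tower_ltn (l - k) (tower k M).
by rewrite /tower; lia.
Qed.

Section Formulas.
Variable n : nat.
Implicit Types i j : 'I_n.

Definition FImp (f g : formula n) := FNot (FAnd f (FNot g)).
Definition FOr (f g : formula n) := FNot (FAnd (FNot f) (FNot g)).
Definition FAll (f : formula n.+1) : formula n := FNot (FEx (FNot f)).
(** Membership uses only edges between distinct vertices; this frees the loops to serve as a unary
    predicate within the single binary relation. *)
Definition FMem i j := FAnd (FEdge i j) (FNot (FEq i j)).
Definition FIff f g := FAnd (FImp f g) (FImp g f).
End Formulas.

Definition sh n (i : 'I_n) : 'I_n.+1 := lift ord0 i.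

(** Expresses that x lies in the k-fold power set of w, without requiring that this power set be
    itself a vertex. *)
Fixpoint FLower k n (w x : 'I_n) : formula n :=
  if k is k'.+1 then FAll (FImp (FMem ord0 (sh x)) (FLower k' (sh w) ord0))
  else FMem x w.

Definition FExt : sentence :=
  FAll (FAll (FImp (FAll (FIff (FMem ord0 (sh ord0)) (FMem ord0 (sh (sh ord0)))))
                   (FEq ord0 (sh ord0)))).

Definition FEmpty : sentence := FEx (FAll (FNot (FMem ord0 (sh ord0)))).

(* For all w, a, x with w a level and a in the k-th power set of w, the set
   obtained from x by adding a exists. *)
Definition FAdjoin k : sentence :=
  FAll (FAll (FAll (FImp
    (FAnd (FEdge (sh (sh ord0)) (sh (sh ord0))) (FLower k (sh (sh ord0)) (sh ord0)))
    (FEx (FAll (FIff (FMem ord0 (sh ord0))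
       (FOr (FMem ord0 (sh (sh ord0))) (FEq ord0 (sh (sh (sh ord0))))))))))).

Definition FStep : sentence :=
  FAll (FImp (FEdge ord0 ord0)
    (FOr (FAll (FNot (FMem ord0 (sh ord0))))
      (FEx (FAnd (FEdge ord0 ord0)
         (FAll (FIff (FMem ord0 (sh (sh ord0))) (FLower height (sh ord0) ord0))))))).

Definition FTop : sentence :=
  FEx (FAnd (FEdge ord0 ord0) (FAll (FLower height (sh ord0) ord0))).

Definition FAdjoins : sentence :=
  foldr (fun k f => FAnd (FAdjoin k) f) FExt (iota 0 height).

Definition psi0 : sentence := FAnd FAdjoins (FAnd FEmpty (FAnd FStep FTop)).

(** * Sizes of the models *)

Section Semantics.
Variable G : digraph.

(* Loops mark the levels of the hierarchy. *)
Definition elt (x y : G) := edge x y && (x != y).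

Fixpoint lower k (w x : G) : bool :=
  if k is k'.+1 then [forall y, elt y x ==> lower k' w y] else elt x w.

Section Connectives.
Variables (n : nat) (e : n.-tuple G).

Lemma holdsImp f g : holds (FImp f g) e = (holds f e ==> holds g e).
Proof. by rewrite /= negb_and negbK implybE. Qed.

Lemma holdsOr f g : holds (FOr f g) e = holds f e || holds g e.
Proof. by rewrite /= negb_and !negbK. Qed.

Lemma holdsIff f g : holds (FIff f g) e = (holds f e == holds g e).
Proof. by rewrite /=; case: (holds f e); case: (holds g e). Qed.

Lemma holdsAll f : holds (FAll f) e = [forall x : G, holds f [tuple of x :: e]].
Proof. by rewrite /= negb_exists; apply: eq_forallb => x; rewrite negbK. Qed.

Lemma holdsEx f : holds (FEx f) e = [exists x : G, holds f [tuple of x :: e]].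
Proof. by []. Qed.

Lemma holdsAnd f g : holds (FAnd f g) e = holds f e && holds g e.
Proof. by []. Qed.

Lemma holdsNot f : holds (FNot f) e = ~~ holds f e.
Proof. by []. Qed.

Lemma holdsMem i j : holds (FMem i j) e = elt (tnth e i) (tnth e j).
Proof. by []. Qed.

Lemma holdsEdge i j : holds (FEdge i j) e = edge (tnth e i) (tnth e j).
Proof. by []. Qed.

Lemma holdsEq i j : holds (FEq i j) e = (tnth e i == tnth e j).
Proof. by []. Qed.

Lemma tnth_sh x i : tnth [tuple of x :: e] (sh i) = tnth e i.
Proof. exact: tnthS. Qed.

Lemma tnth_new x : tnth [tuple of x :: e] ord0 = x.
Proof. exact: tnth0. Qed.
End Connectives.

Lemma holdsLower k n (e : n.-tuple G) w x :
  holds (FLower k w x) e = lower k (tnth e w) (tnth e x).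
Proof.
elim: k n e w x => [|k IH] n e w x //.
rewrite /FLower -/FLower holdsAll; apply: eq_forallb => y.
by rewrite holdsImp holdsMem IH !tnth_sh !tnth_new.
Qed.

Definition holdsE := (holdsImp, holdsOr, holdsIff, holdsAll, holdsEx, holdsAnd,
  holdsNot, holdsMem, holdsEdge, holdsEq, holdsLower, tnth_sh, tnth_new).

Record hierarchy : Prop := Hierarchy {
  h_ext : forall x y, (forall z, elt z x = elt z y) -> x = y;
  h_empty : exists x, forall z, ~~ elt z x;
  h_adj : forall k w a x, k < height -> edge w w -> lower k w a ->
    exists x', forall t, elt t x' = elt t x || (t == a);
  h_step : forall v, edge v v -> (forall x, ~~ elt x v) \/
    exists2 w, edge w w & forall x, elt x v = lower height w x;
  h_top : exists2 w, edge w w & forall x, lower height w x }.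

Notation nil0 := [tuple of [::] : seq G].

Lemma holdsExt : holds FExt nil0 =
  [forall x, forall y, [forall z, elt z y == elt z x] ==> (y == x)].
Proof.
rewrite holdsAll; apply: eq_forallb => x; rewrite holdsAll; apply: eq_forallb => y.
rewrite holdsImp holdsAll !holdsE; congr (_ ==> _).
by apply: eq_forallb => z; rewrite !holdsE.
Qed.

Lemma holdsEmpty : holds FEmpty nil0 = [exists x, forall z, ~~ elt z x].
Proof.
rewrite holdsEx; apply: eq_existsb => x; rewrite holdsAll; apply: eq_forallb => y.
by rewrite !holdsE.
Qed.

Lemma holdsAdjoin k : holds (FAdjoin k) nil0 =
  [forall w, forall a, forall x, edge w w && lower k w a ==>
     [exists x', forall t, elt t x' == elt t x || (t == a)]].
Proof.
rewrite holdsAll; apply: eq_forallb => w; rewrite holdsAll; apply: eq_forallb => a.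
rewrite holdsAll; apply: eq_forallb => x; rewrite holdsImp holdsEx !holdsE.
congr (_ ==> _); apply: eq_existsb => x'; rewrite holdsAll; apply: eq_forallb => t.
by rewrite !holdsE.
Qed.

Lemma holdsStep : holds FStep nil0 =
  [forall v, edge v v ==> [forall x, ~~ elt x v] ||
     [exists w, edge w w && [forall x, elt x v == lower height w x]]].
Proof.
rewrite holdsAll; apply: eq_forallb => v;
  rewrite holdsImp holdsOr holdsEx holdsAll !holdsE.
congr (_ ==> _ || _).
apply: eq_existsb => w; rewrite holdsAnd holdsAll !holdsE; congr (_ && _).
by apply: eq_forallb => x; rewrite !holdsE.
Qed.

Lemma holdsTop : holds FTop nil0 =
  [exists w, edge w w && [forall x, lower height w x]].
Proof.
rewrite holdsEx; apply: eq_existsb => w; rewrite holdsAnd holdsAll !holdsE.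
by congr (_ && _); apply: eq_forallb => x; rewrite !holdsE.
Qed.

Lemma holdsAdjoins : holds FAdjoins nil0 =
  holds FExt nil0 && all (fun k => holds (FAdjoin k) nil0) (iota 0 height).
Proof.
rewrite /FAdjoins; elim: (iota 0 height) => [|k s IH]; first by rewrite /= andbT.
by rewrite [foldr _ _ _]/= holdsAnd IH andbCA.
Qed.

Lemma psi0P : models G psi0 <-> hierarchy.
Proof.
rewrite /models /psi0 holdsAnd holdsAdjoins !holdsAnd holdsExt holdsEmpty holdsStep
  holdsTop.
have -> : all (fun k => holds (FAdjoin k) nil0) (iota 0 height) =
    all (fun k => [forall w, forall a, forall x, edge w w && lower k w a ==>
     [exists x', forall t, elt t x' == elt t x || (t == a)]]) (iota 0 height).
  by apply: eq_all => k; rewrite holdsAdjoin.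
split.
  case/and4P=> /andP [H1 /allP H2] H3 H4 H5; split.
  - move=> x y E; apply/eqP.
    have /implyP := forallP (forallP H1 y) x; apply.
    by apply/forallP => z; rewrite E.
  - by have /existsP [x /forallP H] := H3; exists x.
  - move=> k w a x lt ew lw; have : k \in iota 0 height by rewrite mem_iota.
    move=> /H2 /forallP /(_ w) /forallP /(_ a) /forallP /(_ x) /implyP.
    rewrite ew lw => /(_ isT) /existsP [x' /forallP H]; exists x' => t; exact/eqP.
  - move=> v ev; have /implyP /(_ ev) /orP [/forallP|/existsP [w /andP [ew /forallP
    H]]] := forallP H4 v.
      by left.
    by right; exists w => // x; apply/eqP.
  - by have /existsP [w /andP [ew /forallP H]] := H5; exists w.
case=> H1 [x0 H2] H3 H4 [w0 ew0 H5]; apply/and4P; split.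
- apply/andP; split.
    apply/forallP => x; apply/forallP => y; apply/implyP => /forallP H.
    by apply/eqP/H1 => z; apply/eqP.
  apply/allP => k; rewrite mem_iota => /= lt.
  apply/forallP => w; apply/forallP => a; apply/forallP => x;
    apply/implyP => /andP [ew lw].
  have [x' H] := H3 k w a x lt ew lw.
  by apply/existsP; exists x'; apply/forallP => t; apply/eqP.
- by apply/existsP; exists x0; apply/forallP.
- apply/forallP => v; apply/implyP => /H4 [H|[w ew H]]; apply/orP; [left|right].
    exact/forallP.
  by apply/existsP; exists w; rewrite ew; apply/forallP => x; apply/eqP.
- by apply/existsP; exists w0; rewrite ew0; apply/forallP.
Qed.

Section Sizes.
Hypothesis H : hierarchy.

Definition members (x : G) : {set G} := [set z | elt z x].

Definition stage k (w : G) : {set G} := [set x | lower k w x].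

Lemma members_inj : injective members.
Proof.
move=> x y E; apply: (h_ext H) => z.
by have /setP /(_ z) := E; rewrite !inE.
Qed.

(** Sending a vertex to its set of elements is injective by extensionality and maps each stage onto
    the subsets of the preceding one. First-order logic cannot quantify over subsets, but in a
    finite structure every subset arises from the empty set by adjoining one element at a time. *)
Lemma card_stage k w : k <= height -> edge w w ->
  #|stage k w| = tower k #|members w|.
Proof.
move=> le ew; elim: k le => [|k IH] lt //.
rewrite /tower iterS -/(tower k _) -IH ?(ltnW lt) // -card_powerset.
rewrite -(card_imset _ members_inj); congr #|pred_of_set _|; apply/setP => B.
have sE x : (x \in stage k.+1 w) = (members x \subset stage k w).
  rewrite inE /=; apply/forallP/subsetP => [S y|S y].
    by rewrite !inE; apply/implyP.
  by apply/implyP => yx; have := S y; rewrite !inE; apply.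
rewrite inE; apply/imsetP/idP => [[x]|]; first by rewrite sE => S ->.
move=> S; suff [x E] : exists x, members x = B by exists x; rewrite ?sE ?E.
have [n] := ubnP #|B|; elim: n => // n IHn in B S *; rewrite ltnS => leB.
have [->|[a aB]] := set_0Vmem B.
  have [x Hx] := h_empty H; exists x; apply/setP => z.
  by rewrite !inE; apply/negbTE.
have [||x E] := IHn (B :\ a); first exact: subset_trans (subsetDl _ _) S.
  by rewrite (cardsD1 a) aB in leB.
have la : lower k w a by have /subsetP /(_ a aB) := S; rewrite inE.
have [x' Hx] := h_adj H x lt ew la; exists x'; apply/setP => t.
rewrite inE Hx -[elt t x]/(elt t x);
  have : (t \in members x) = (t \in B :\ a) by rewrite E.
rewrite !inE => ->; case: eqP => [->|_]; last by rewrite orbF.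
by rewrite orbT aB.
Qed.

(** A nonempty level has strictly more elements than the level it is built from, since
    [tower height] exceeds its argument; the descent thus ends at an empty level. *)
Lemma card_level v : edge v v -> exists i, #|members v| = level i.
Proof.
have [n] := ubnP #|members v|; elim: n => // n IH in v *; rewrite ltnS => le ev.
have [E|[w ew E]] := h_step H ev.
  exists 0; apply/eqP; rewrite cards_eq0; apply/eqP/setP => x.
  by rewrite !inE; apply/negbTE.
have eq : #|members v| = tower height #|members w|.
  rewrite -card_stage //; congr #|pred_of_set _|; apply/setP => x.
  by rewrite !inE E.
have [|//|i Ei] := IH w.
  apply: leq_trans le; rewrite eq; apply: leq_trans (tower_ltn _ _).
  by rewrite -addn1 leq_add2l.
by exists i.+1; rewrite eq Ei.
Qed.

Lemma card_hierarchy : exists i, #|G| = level i.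
Proof.
have [w ew E] := h_top H; have [i Ei] := card_level ew.
exists i.+1; have -> : level i.+1 = tower height #|members w| by rewrite Ei.
rewrite -card_stage // -cardsT; congr #|pred_of_set _|.
by apply/setP => x; rewrite !inE E.
Qed.

End Sizes.
End Semantics.

(** * A model of every admissible height *)

Section Model.
Variable m : nat.

Let N := level m.+1.

Definition is_level (x : nat) := [exists j : 'I_m.+1, x == (2 ^ level j).-1].

(** Ackermann's coding of hereditarily finite sets: x is an element of y when bit x of y is set. The
    number [(2 ^ level j).-1] codes the set of all numbers below [level j], and these codes get a
    loop. *)
Definition bit_graph : digraph :=
  @Digraph 'I_N (fun x y => bit y x || ((x == y) && is_level x)).

Lemma bit_graph_mem (x y : bit_graph) : elt x y = bit (y : 'I_N) (x : 'I_N).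
Proof.
rewrite /elt /=; case: (altP (x =P y)) => [->|] //=; rewrite ?orbF ?andbT // andbF.
by apply/esym/negbTE/negP => /bit_ltn; rewrite ltnn.
Qed.

Lemma bit_graph_level (x : bit_graph) : edge x x = is_level (x : 'I_N).
Proof.
rewrite /= eqxx /=; case: (boolP (bit _ _)) => // /bit_ltn.
by rewrite ltnn.
Qed.

(** Here w codes the initial segment of length M, and by [ltn_bits] each power set replaces the
    length of an initial segment by its exponential. *)
Lemma bit_graph_lower k (w x : bit_graph) M : (w : nat) = (2 ^ M).-1 ->
  lower k w x = ((x : nat) < tower k M).
Proof.
move=> ew; elim: k x => [|k IH] x /=; first by rewrite bit_graph_mem ew bit_pred2.
apply/forallP/ltn_bits => [H i b|H y]; last first.
  by rewrite bit_graph_mem IH; apply/implyP/H.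
have lt : i < N by apply: ltn_trans (bit_ltn b) (ltn_ord x).
by have := H (Ordinal lt); rewrite bit_graph_mem IH /= b.
Qed.

Lemma is_levelP x : reflect (exists2 j, j <= m & x = (2 ^ level j).-1) (is_level x).
Proof.
apply: (iffP existsP) => [[j /eqP ->]|[j le ->]]; first by exists j; rewrite // -ltnS.
by exists (Ordinal (le : j < m.+1)).
Qed.

Lemma level_code_lt j : j <= m -> (2 ^ level j).-1 < N.
Proof.
move=> le; rewrite prednK ?expn_gt0 // -[2 ^ _]/(tower 1 (level j)).
apply: leq_trans (tower_mono 1 (leq_level le)) _.
exact: tower_le.
Qed.

Lemma bit_graph_hierarchy : hierarchy bit_graph.
Proof.
have N0 : 0 < N by apply: leq_ltn_trans (level_ltn m).
have wm : (2 ^ level m).-1 < N by apply: level_code_lt.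
have NE : N = 2 ^ (tower height.-1 (level m)) by [].
split.
- move=> x y E; apply/val_inj/bit_inj => i; case: (ltnP i N) => h.
    by have := E (Ordinal h); rewrite !bit_graph_mem.
  rewrite !bit_small //; apply: leq_ltn_trans (ltn_expl i _) => //.
    by apply: leq_trans h; apply/ltnW/(ltn_ord y).
  by apply: leq_trans h; apply/ltnW/(ltn_ord x).
- by exists (Ordinal N0) => z; rewrite bit_graph_mem bit0.
- move=> k w a x ltk; rewrite bit_graph_level => /is_levelP [j lej ew] la.
  rewrite (bit_graph_lower _ _ ew) in la.
  have [u ltu Eu] := bits_exist (tower height.-1 (level m)) (fun t => bit (x : 'I_N) t
    || (t == a)).
  have ltN : u < N by rewrite NE.
  exists (Ordinal ltN) => t; rewrite !bit_graph_mem /= Eu.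
  rewrite -val_eqE /=; case: (boolP (_ || _));
    rewrite ?andbF // andbT => /orP [b|/eqP ->].
    have ltx : (x : 'I_N) < 2 ^ tower height.-1 (level m) := ltn_ord x.
    by move/ltn_bits: ltx; apply.
  (* The restriction of adjunction to k < [height] matters here: a is below the five-fold tower, so
     setting bit a gives a number still below [N]. *)
  apply: leq_trans la _; apply: leq_trans (tower_mono k (leq_level lej)) _.
  by apply: (@tower_le k height.-1 (level m)); rewrite -ltnS.
- move=> v; rewrite bit_graph_level => /is_levelP [[|j] lej ev].
    by left => x; rewrite bit_graph_mem ev bit0.
  right; have lt := level_code_lt (ltnW lej); exists (Ordinal lt).
    by rewrite bit_graph_level; apply/is_levelP; exists j => //; apply: ltnW.
  by move=> x; rewrite bit_graph_mem ev bit_pred2 (@bit_graph_lower _ _ _ (level j)).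
- exists (Ordinal wm); first by rewrite bit_graph_level; apply/is_levelP; exists m.
  by move=> x; rewrite (@bit_graph_lower _ _ _ (level m)) //; apply: ltn_ord.
Qed.

End Model.

Lemma infinitely_many_unbounded (P : digraph -> Prop) :
  (forall n, exists2 G : digraph, P G & n < #|G|) -> infinitely_many P.
Proof.
move=> H n F; have [G PG lt] := H (\max_(i < n) #|F i|); exists G => // i [f bf _].
have := leq_bigmax (F := fun i : 'I_n => #|F i|) i.
by rewrite -(bij_eq_card bf) leqNgt lt.
Qed.

Lemma psi0_models : infinitely_many (fun G => models G psi0).
Proof.
apply: infinitely_many_unbounded => n; exists (bit_graph n).
  exact/psi0P/bit_graph_hierarchy.
by rewrite card_ord; apply: leq_idx_level.
Qed.

Lemma psi0_countermodels : infinitely_many (fun G => ~ models G psi0).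
Proof.
apply: infinitely_many_unbounded => n.
exists (@Digraph 'I_n.+1 (fun _ _ => false)); last by rewrite card_ord.
by move=> /psi0P [_ _ _ _ []].
Qed.

(** * Brute-force satisfiability *)

Definition is1 (x : seq bool) i := onth x i == Some true.
Definition is0 (x : seq bool) i := onth x i == Some false.

Lemma is1E x i : is1 x i = nth false x i.
Proof.
rewrite /is1 onthE; case: (ltnP i (size x)) => h; last by rewrite !nth_default ?size_map.
by rewrite (nth_map false) //; case: (nth _ _ _).
Qed.

Lemma is0E x i : is0 x i = (i < size x) && ~~ nth false x i.
Proof.
rewrite /is0 onthE; case: (ltnP i (size x)) => h; last by rewrite nth_default ?size_map.
by rewrite (nth_map false) //; case: (nth _ _ _).
Qed.

(* Automaton reading an encoded CNF; the states are 0: clause flag expected,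
   1: literal flag, 2: sign, 3: digit flag, 4: digit, 5: end. *)
Definition tr (s : nat) (b : bool) : nat :=
  if s == 0 then (if b then 1 else 5) else
  if s == 1 then (if b then 2 else 0) else
  if s == 2 then 3 else
  if s == 3 then (if b then 4 else 1) else
  if s == 4 then 3 else 5.

Section SatBruteForce.
Variable x : seq bool.
Let Z := (size x).+1.

Definition st p := iteri p (fun i s => tr s (is1 x i)) 0.
Definition lit p := st p == 2.

(** The sign of a literal is at p and the code of its variable starts at p + 1: digit j sits at p +
    2 + 2j, behind a true flag at p + 1 + 2j, and a false flag ends the code. Variables are compared
    in place, digit by digit, as their numbers may not fit in a register. *)
Definition same p q := bex Z (fun k =>
  [&& is0 x (p.+1 + k + k), is0 x (q.+1 + k + k) &
    ball k (fun j => [&& is1 x (p.+1 + j + j), is1 x (q.+1 + j + j) &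
                      is1 x (p.+2 + j + j) == is1 x (q.+2 + j + j)])]).

Definition first p := lit p && ball p (fun q => ~~ (lit q && same q p)).

(** The variable of the literal at p occurs at position q or earlier. *)
Definition seen p q := bex q.+1 (fun r => lit r && same r p).

(* The number of distinct variables occurring before the variable of the
   literal at position p. *)
Definition rank p := bcount (size x) (fun q => first q && ~~ seen p q).

Definition nv := bcount (size x) first.

(* The truth value of the literal at position p when the bits of a are the
   values of the variables in their order of first occurrence. *)
Definition lit_value a p := is1 x p == bit a (rank p).

(** The truth value of the current clause so far: cleared in state 0, set when a true literal is
    passed. It is consulted by [okf] where the literal flag is false, at the end of a clause. *)
Definition cl a p := iteri p (fun i c =>
  if st i == 0 then 0 else if (st i == 2) && lit_value a i then 1 else c) 0.

Definition okf a := ball (size x) (fun i => (st i == 1) && is0 x i ==> (cl a i != 0)).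

(** Assignments are numbers up to |x|. A success is therefore always genuine, while failure is
    conclusive only if all assignments are so covered. *)
Definition satbf := bex Z okf.

End SatBruteForce.

(** * Scanning an encoded formula *)

Section Run.
Variable V : nat -> bool.

(** State of the automaton, value of the current clause, value of the completed clauses, positions
    of the literals met. As a fold over the text, the scan can be computed along the structure of
    the encoding; [scan_prefix] identifies it with the positional definitions. *)
Definition scan_state := (nat * bool * bool * seq nat)%type.

Definition scan1 (p : nat) (t : scan_state) (b : bool) : scan_state :=
  let: (s, c, ok, L) := t in
  (tr s b, if s == 0 then false else if (s == 2) && V p then true else c,
   ok && ((s == 1) && ~~ b ==> c), if s == 2 then rcons L p else L).

Fixpoint scan (p : nat) (t : scan_state) (s : seq bool) : scan_state :=
  if s is b :: s' then scan p.+1 (scan1 p t b) s' else t.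

Lemma scan_cat p t s1 s2 :
  scan p t (s1 ++ s2) = scan (p + size s1) (scan p t s1) s2.
Proof. by elim: s1 p t => [|b s1 IH] p t /=; rewrite ?addn0 // IH addnS. Qed.

Lemma scan_binary p c ok L v : scan p (3, c, ok, L) (enc_binary v) = (1, c, ok, L).
Proof.
rewrite /enc_binary /enc_list; elim: (digits _ _) p => [|d s IH] p /=.
  by rewrite andbT.
by rewrite !andbT; apply: IH.
Qed.

Lemma scan_literal p c ok L l :
  scan p (2, c, ok, L) (enc_literal l) = (1, V p || c, ok, rcons L p).
Proof. by rewrite /enc_literal /= andbT scan_binary; case: (V p). Qed.

(** The literals of a clause whose code starts at o, each paired with the position of its sign; the
    flag of the first one occupies o itself. *)
Fixpoint posc o (c : seq literal) : seq (nat * literal) :=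
  if c is l :: c' then (o.+1, l) :: posc (o + (size (enc_literal l)).+1) c' else [::].

Fixpoint posF o (F : cnf) : seq (seq (nat * literal)) :=
  if F is c :: F' then posc o.+1 c :: posF (o + (size (enc_list enc_literal c)).+1) F'
  else [::].

Lemma scan_clause o c0 ok L c : let P := [seq pl.1 | pl <- posc o c] in
  scan o (1, c0, ok, L) (enc_list enc_literal c) =
  (0, c0 || has V P, ok && (c0 || has V P), L ++ P).
Proof.
rewrite /enc_list; elim: c o c0 L => [|l c IH] o c0 L.
  by rewrite /= orbF cats0.
rewrite (_ : _ ++ _ = [:: true] ++ enc_literal l ++
  flatten [seq true :: enc_literal y | y <- c] ++ [:: false]); last by rewrite /= -catA.
rewrite scan_cat (_ : scan o _ [:: true] = (2, c0, ok, L)); last by rewrite /= andbT.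
rewrite scan_cat addn1 scan_literal addSnnS IH [posc _ _]/= map_cons /=.
by rewrite cat_rcons (orbC (V _)) !orbA.
Qed.

Lemma scan_cnf o c0 ok L F :
  let P := [seq [seq pl.1 | pl <- c] | c <- posF o F] in
  scan o (0, c0, ok, L) (enc_cnf F) = (5, false, ok && all (has V) P, L ++ flatten P).
Proof.
rewrite /enc_cnf {1}/enc_list; elim: F o c0 ok L => [|c F IH] o c0 ok L.
  by rewrite /= !andbT cats0.
rewrite (_ : _ ++ _ = [:: true] ++ enc_list enc_literal c ++
  flatten [seq true :: enc_list enc_literal y | y <- F] ++ [:: false]);
    last by rewrite /= -!catA.
rewrite scan_cat (_ : scan o _ [:: true] = (1, false, ok, L)); last by rewrite /= andbT.
by rewrite scan_cat addn1 scan_clause addSnnS IH /= !andbA catA.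
Qed.

End Run.

Lemma map_posF o F : [seq [seq pl.2 | pl <- c] | c <- posF o F] = F.
Proof.
elim: F o => //= c F IH o; rewrite IH; congr (_ :: _).
by elim: c o.+1 {IH} => //= l c IH o'; rewrite IH.
Qed.

Lemma posc_drop u c w p l : (p, l) \in posc (size u) c ->
  exists w', drop p (u ++ enc_list enc_literal c ++ w) = enc_literal l ++ w'.
Proof.
rewrite /enc_list; elim: c u => // l0 c IH u;
  rewrite [posc _ _]/= inE => /orP [/eqP [-> ->]|].
  exists (flatten [seq true :: enc_literal x | x <- c] ++ [:: false] ++ w).
  rewrite (_ : u ++ _ = rcons u true ++ (enc_literal l0 ++
    flatten [seq true :: enc_literal x | x <- c] ++ [:: false] ++ w)).
    by rewrite -(size_rcons u true) drop_size_cat.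
  by rewrite cat_rcons /= -!catA.
move=> H; have [|w' E] := IH (u ++ true :: enc_literal l0); first by rewrite size_cat.
by exists w'; rewrite -E -!catA.
Qed.

Lemma posF_drop u F p l : (p, l) \in flatten (posF (size u) F) ->
  exists w', drop p (u ++ enc_cnf F) = enc_literal l ++ w'.
Proof.
rewrite /enc_cnf {1}/enc_list; elim: F u => // c F IH u;
  rewrite [posF _ _]/= [flatten _]/= mem_cat.
case/orP => [|H].
  rewrite -(size_rcons u true) => /posc_drop H.
  have [w' E] := H (flatten [seq true :: enc_list enc_literal x | x <- F] ++ [:: false]).
  exists w'; rewrite -E cat_rcons [flatten (_ :: _)]/=.
  by move: (enc_list enc_literal c) (flatten _) => A B; rewrite /= -!catA.
have [|w' E] := IH (u ++ true :: enc_list enc_literal c); first by rewrite size_cat.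
exists w'; rewrite -E [flatten (_ :: _)]/=.
by move: (enc_list enc_literal c) (flatten _) => A B; rewrite /= -!catA.
Qed.

Lemma scan_prefix x a p : p <= size x ->
  scan (lit_value x a) 0 (0, false, true, [::]) (take p x) =
  (st x p, cl x a p != 0,
   ball p (fun i => (st x i == 1) && is0 x i ==> (cl x a i != 0)),
   [seq q <- iota 0 p | lit x q]).
Proof.
elim: p => [|p IH] lt; first by rewrite take0.
rewrite (take_nth false lt) -cats1 scan_cat IH ?(ltnW lt) // size_takel ?(ltnW lt) //.
have e : iota 0 p.+1 = iota 0 p ++ [:: p] by rewrite -addn1 iotaD.
rewrite /ball e all_cat filter_cat /= add0n is1E is0E lt andbT; congr (_, _, _, _).
- by case: ifP => // _; case: ifP.
- by rewrite /lit; case: ifP => _; rewrite ?cats1 ?cats0.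
Qed.

(** * Correctness of the brute-force search *)

Section Spec.
Variable F : cnf.
Let x := enc_cnf F.
Let PF := posF 0 F.
Let PL := flatten PF.

Lemma scan_enc a :
  [/\ [seq q <- iota 0 (size x) | lit x q] = [seq pl.1 | pl <- PL] &
      okf x a = all (has (fun pl => lit_value x a pl.1)) PF].
Proof.
have := scan_prefix a (leqnn (size x)); rewrite take_size scan_cnf => -[_ _ E1 E2].
rewrite -E2 map_flatten; split=> //.
rewrite /okf -E1 all_map; apply: eq_all => c; by rewrite /= has_map.
Qed.

Lemma lit_mem q : q < size x -> lit x q -> exists l, (q, l) \in PL.
Proof.
move=> lt lq; have [E _] := scan_enc 0.
have : q \in [seq q <- iota 0 (size x) | lit x q] by rewrite mem_filter lq mem_iota.
by rewrite E => /mapP [[p l] H ->]; exists l.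
Qed.

Lemma mem_lit q l : (q, l) \in PL -> lit x q /\ q < size x.
Proof.
move=> H; have [E _] := scan_enc 0.
have : q \in [seq pl.1 | pl <- PL] by apply/mapP; exists (q, l).
by rewrite -E mem_filter mem_iota => /andP [].
Qed.

Lemma mem_drop q l : (q, l) \in PL ->
  exists w, drop q x = l.1 :: enc_binary l.2 ++ w.
Proof. by move=> /(@posF_drop [::]) [w E]; exists w. Qed.

Lemma mem_sign q l : (q, l) \in PL -> is1 x q = l.1.
Proof.
move=> /mem_drop [w E]; rewrite /is1 -(addn0 q) -onth_drop E /=.
by case: l.1.
Qed.

Lemma enc_binary_onth v w k j : k = up_log 2 v.+1 ->
  [/\ j < k -> onth (enc_binary v ++ w) (j + j) = Some true,
      j < k -> onth (enc_binary v ++ w) (j + j).+1 = Some (bit v j) &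
      onth (enc_binary v ++ w) (k + k) = Some false].
Proof.
rewrite /enc_binary /enc_list => <-.
have : forall i, i < k -> nth false (digits k v) i = bit v i.
  by move=> i lt; rewrite nth_mkseq.
have : size (digits k v) = k by rewrite size_mkseq.
move: (digits k v) (bit v) => ds; elim: ds k j => [|d ds IH] k j f /= <- H.
  by split.
have [||A B C] := IH (size ds) j.-1 (fun i => f i.+1); first by [].
  by move=> i lt; rewrite -H.
case: j A B C => [|j] A B C; split.
- by [].
- by rewrite -H.
- by rewrite addnS addSn.
- by rewrite ltnS addnS => /A.
- by rewrite ltnS addnS => /B.
- by rewrite addnS addSn.
Qed.

(** The code of a variable delimits itself: its first false flag fixes the number of digits, so
    agreement up to a common false flag gives equal digits, and the digits beyond are zero on both
    sides. *)
Lemma same_var q l q' l' : (q, l) \in PL -> (q', l') \in PL ->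
  same x q q' = (l.2 == l'.2).
Proof.
move=> H H'; have [w E] := mem_drop H; have [w' E'] := mem_drop H'.
have O i : onth x (q.+1 + i) = onth (enc_binary l.2 ++ w) i.
  by rewrite addSnnS -onth_drop E.
have O' i : onth x (q'.+1 + i) = onth (enc_binary l'.2 ++ w') i.
  by rewrite addSnnS -onth_drop E'.
have O1 j : onth x (q.+1 + j + j) =
  onth (enc_binary l.2 ++ w) (j + j) by rewrite -addnA O.
have O1' j : onth x (q'.+1 + j + j) =
  onth (enc_binary l'.2 ++ w') (j + j) by rewrite -addnA O'.
have O2 j : onth x (q.+2 + j + j) = onth (enc_binary l.2 ++ w) (j + j).+1.
  by rewrite (_ : q.+2 + j + j = q.+1 + (j + j).+1) ?O //; lia.
have O2' j : onth x (q'.+2 + j + j) = onth (enc_binary l'.2 ++ w') (j + j).+1.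
  by rewrite (_ : q'.+2 + j + j = q'.+1 + (j + j).+1) ?O' //; lia.
set k := up_log 2 l.2.+1; set k' := up_log 2 l'.2.+1.
have B j := enc_binary_onth w j (erefl k).
have B' j := enc_binary_onth w' j (erefl k').
apply/bexP/eqP => [[n _ /and3P [z z' /ballP H1]]|e].
  have K (u v : seq bool) m : (forall j, j < m -> onth u (j + j) = Some true) ->
      onth u (m + m) = Some false -> onth u (n + n) = Some false ->
      (forall j, j < n -> onth u (j + j) = Some true) -> m = n.
    move=> h1 h2 h3 h4; case: (ltngtP m n) => // lt.
      by rewrite (h4 _ lt) in h2.
    by rewrite (h1 _ lt) in h3.
  have e1 : k = n.
    apply: (K (enc_binary l.2 ++ w) [::]) => [j lt|||j lt].
    - by have [h _ _] := B j; apply: h.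
    - by have [_ _ ->] := B 0.
    - by rewrite -O1; apply/eqP.
    - by have /and3P [h _ _] := H1 j lt; rewrite -O1; apply/eqP.
  have e2 : k' = n.
    apply: (K (enc_binary l'.2 ++ w') [::]) => [j lt|||j lt].
    - by have [h _ _] := B' j; apply: h.
    - by have [_ _ ->] := B' 0.
    - by rewrite -O1'; apply/eqP.
    - by have /and3P [_ h _] := H1 j lt; rewrite -O1'; apply/eqP.
  apply: bit_inj => i; case: (ltnP i n) => lt.
    have /and3P [_ _] := H1 i lt; rewrite /is1 O2 O2'.
    have [_ h2 _] := B i; have [_ h2' _] := B' i; rewrite h2 ?e1 // h2' ?e2 //.
    by case: (bit _ _); case: (bit _ _).
  rewrite !bit_small //; [rewrite -e2 in lt|rewrite -e1 in lt];
    by apply: leq_trans (leq_pexp2l _ lt); rewrite // up_logP.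
have kk : k = k' by rewrite /k /k' e.
have lek : k + k < size x.
  have [_ _ h] := B 0; rewrite -O onthE in h; rewrite ltnNge; apply/negP => le.
  by rewrite nth_default // size_map in h; apply: leq_trans le (leq_addl _ _).
exists k; first lia.
have [_ _ h] := B 0; have [_ _ h'] := B' 0; rewrite -kk in h'.
rewrite /is0 O1 O1' h h' eqxx; apply/ballP => j lt.
have [h1 h2 _] := B j; have [h1' h2' _] := B' j; rewrite -kk in h1' h2'.
rewrite /is1 O1 O1' O2 O2' h1 // h1' // h2 // h2' // e.
by rewrite !eqxx.
Qed.

Lemma bcount_ltn n (A B : pred nat) : (forall i, i < n -> A i -> B i) ->
  (exists i, [&& i < n, B i & ~~ A i]) -> bcount n A < bcount n B.
Proof.
move=> AB [i /and3P [lt Bi nAi]].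
have -> : bcount n B = bcount n A + bcount n (fun j => B j && ~~ A j).
  rewrite /bcount -size_filter -(count_predC A) !count_filter; congr (_ + _).
    apply: eq_in_count => j; rewrite mem_iota => /= ltj.
    by case: (boolP (A j)) => //= /AB ->.
  by apply: eq_count => j /=; rewrite andbC.
rewrite -addn1 leq_add2l -has_count; apply/hasP; exists i; rewrite ?mem_iota //.
by rewrite Bi.
Qed.

Lemma seenP p l q : (p, l) \in PL -> q < size x ->
  reflect (exists2 r, r <= q & exists2 l', (r, l') \in PL & l'.2 = l.2) (seen x p q).
Proof.
move=> H lt; apply: (iffP (bexP _ _)) => [[r ler /andP [lr sr]]|[r ler [l' H' e]]].
  have [l' H'] := lit_mem (leq_trans ler lt) lr.
  by exists r => //; exists l' => //; apply/eqP; rewrite -(same_var H' H).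
by exists r => //; rewrite (mem_lit H').1 (same_var H' H) e eqxx.
Qed.

Lemma firstP p l : (p, l) \in PL ->
  exists2 f, first x f && (f <= p) &
    exists2 l', (f, l') \in PL & l'.2 = l.2.
Proof.
move=> H; pose A r := lit x r && same x r p.
have exA : exists r, A r by exists p; rewrite /A (mem_lit H).1 (same_var H H) eqxx.
case: (ex_minnP exA) => f /andP [lf sf] minf.
have lefp : f <= p by apply: minf; rewrite /A (mem_lit H).1 (same_var H H) eqxx.
have [l' H'] := lit_mem (leq_ltn_trans lefp (mem_lit H).2) lf.
have e : l'.2 = l.2 by apply/eqP; rewrite -(same_var H' H).
exists f; last by exists l'.
rewrite lefp andbT /first lf; apply/ballP => q ltq; apply/negP => /andP [lq sq].
have [l'' H''] := lit_mem (ltn_trans ltq (mem_lit H').2) lq.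
have : f <= q; last by rewrite leqNgt ltq.
apply: minf; rewrite /A lq (same_var H'' H) -e -(same_var H'' H').
exact: sq.
Qed.

Lemma first_seen p l p' l' f : (p, l) \in PL -> (p', l') \in PL -> l.2 <> l'.2 ->
  first x f -> (exists2 lf, (f, lf) \in PL & lf.2 = l.2) ->
  seen x p' f -> forall q, q < size x -> seen x p q -> seen x p' q.
Proof.
move=> H H' ne ff [lf Hf e] sf q ltq /(seenP H ltq) [r ler [lr Hr er]].
have [g leg [lg Hg eg]] := seenP H' (mem_lit Hf).2 sf.
apply/(seenP H' ltq); exists g; last by exists lg.
apply: leq_trans leg _; apply: leq_trans ler; rewrite leqNgt; apply/negP => ltr.
case/andP: ff => _ /ballP /(_ r ltr); rewrite (mem_lit Hr).1 (same_var Hr Hf) er e.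
by rewrite eqxx.
Qed.

Lemma rank_lt p l : (p, l) \in PL -> rank x p < nv x.
Proof.
move=> H; have [f /andP [ff _] [l' H' e]] := firstP H; apply: bcount_ltn.
  by move=> i _ /andP [].
exists f; rewrite (mem_lit H').2 ff /=; apply/negP => /negP; apply.
by apply/(seenP H (mem_lit H').2); exists f => //; exists l'.
Qed.

(** The variable of p starts before that of p'. Hence every first occurrence counted for p is
    counted for p', while f is counted for p' alone. *)
Lemma rank_lt_or p l p' l' : (p, l) \in PL -> (p', l') \in PL -> l.2 <> l'.2 ->
  forall f lf, first x f -> (f, lf) \in PL -> lf.2 = l.2 -> ~~ seen x p' f ->
  rank x p < rank x p'.
Proof.
move=> H H' ne f lf ff Hf e nsf; apply: bcount_ltn.
  move=> i lti /andP [fi nsi]; rewrite fi; apply/negP => si.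
  have [g /andP [fg _] [lg Hg eg]] := firstP H'.
  have sg : seen x p g.
    case/(seenP H' lti): si => r ler [lr Hr er].
    have ltfg : f < g.
      rewrite ltnNge; apply/negP => leg; case/negP: nsf.
      by apply/(seenP H' (mem_lit Hf).2); exists g => //; exists lg.
    by apply/(seenP H (mem_lit Hg).2); exists f; [apply: ltnW | exists lf].
  case/negP: nsi; apply: (first_seen H' H _ fg _ sg lti si); first by move/esym.
  by exists lg.
exists f; rewrite (mem_lit Hf).2 ff nsf /=; apply/negP => /negP; apply.
by apply/(seenP H (mem_lit Hf).2); exists f => //; exists lf.
Qed.

(** If two different variables had equal rank, then by [rank_lt_or] each would occur no later than
    the first occurrence of the other; the two first occurrences would coincide, and so would the
    variables. *)
Lemma rank_inj p l p' l' : (p, l) \in PL -> (p', l') \in PL ->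
  rank x p = rank x p' -> l.2 = l'.2.
Proof.
move=> H H' e; apply/eqP/negPn/negP => /eqP ne.
have [f /andP [ff _] [lf Hf ef]] := firstP H.
have [f' /andP [ff' _] [lf' Hf' ef']] := firstP H'.
have [s|ns] := boolP (seen x p' f); last first.
  by have := rank_lt_or H H' ne ff Hf ef ns; rewrite e ltnn.
have [s'|ns'] := boolP (seen x p f'); last first.
  by have := rank_lt_or H' H (nesym ne) ff' Hf' ef' ns'; rewrite e ltnn.
have [r ler [lr Hr er]] := seenP H' (mem_lit Hf).2 s.
have [r' ler' [lr' Hr' er']] := seenP H (mem_lit Hf').2 s'.
have M g lg h lh : first x g -> (g, lg) \in PL -> (h, lh) \in PL -> lh.2 = lg.2 -> g <= h.
  move=> /andP [_ /ballP B] Hg Hh eh; rewrite leqNgt; apply/negP => lt.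
  by have := B h lt; rewrite (mem_lit Hh).1 (same_var Hh Hg) eh eqxx.
have l1 : f' <= r by apply: (M _ _ _ _ ff' Hf' Hr); rewrite er ef'.
have l2 : f <= r' by apply: (M _ _ _ _ ff Hf Hr'); rewrite er' ef.
have eff : f = f' by lia.
have : same x f f' by rewrite eff (same_var Hf' Hf') eqxx.
by rewrite (same_var Hf Hf') ef ef' => /eqP.
Qed.

Lemma rank_var p l p' l' : (p, l) \in PL -> (p', l') \in PL -> l.2 = l'.2 ->
  rank x p = rank x p'.
Proof.
move=> H H' e; apply: eq_in_count => q; rewrite mem_iota => /= ltq; congr (_ && ~~ _).
by apply/(seenP H ltq)/(seenP H' ltq) => -[r ler [lr Hr er]]; exists r => //; exists lr;
  rewrite // er e.
Qed.

Lemma all_PF (P : nat -> bool) (alpha : nat -> bool) :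
  (forall p l, (p, l) \in PL -> P p = (alpha l.2 == l.1)) ->
  all (has (fun pl => P pl.1)) PF = cnf_eval alpha F.
Proof.
move=> E; rewrite /cnf_eval -{1}(map_posF 0 F) all_map.
apply: eq_in_all => c cPF; rewrite /= has_map; apply: eq_in_has => -[p l] plc /=.
by apply: E; apply/flattenP; exists c.
Qed.

Lemma satbf_sound : satbf x -> satisfiable F.
Proof.
case/bexP => a _; have [_ ->] := scan_enc a.
pose alpha v := has (fun pl => (pl.2.2 == v) && bit a (rank x pl.1)) PL.
rewrite (all_PF (alpha := alpha)); first by exists alpha.
move=> p l H; rewrite /lit_value (mem_sign H) eq_sym; congr (_ == _).
apply/idP/hasP => [b|[[p' l'] H' /andP [/eqP /= e]]].
  by exists (p, l); rewrite //= eqxx.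
by rewrite (rank_var H' H e).
Qed.

(** Ranks are below [nv x] and distinct for distinct variables, so an assignment becomes a number
    below [2 ^ nv x] whose bits are indexed by rank. *)
Lemma satbf_complete : 2 ^ nv x <= (size x).+1 -> satisfiable F -> satbf x.
Proof.
move=> le [alpha sat].
have [a lta Ea] := bits_exist (nv x)
  (fun i => has (fun pl => (rank x pl.1 == i) && alpha pl.2.2) PL).
apply/bexP; exists a; first exact: leq_trans lta le.
have [_ ->] := scan_enc a; rewrite (all_PF (alpha := alpha)) //.
move=> p l H; rewrite /lit_value (mem_sign H) eq_sym Ea (rank_lt H) /=; congr (_ == _).
apply/hasP/idP => [[[p' l'] H' /andP [/eqP /= e]]|al].
  by rewrite (rank_inj H' H e).
by exists (p, l); rewrite //= eqxx.
Qed.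

(** Sending each first occurrence to its variable is injective, because the later of two occurrences
    of a variable is not first. *)
Lemma nv_nvars : nv x <= nvars F.
Proof.
pose w p := (nth (0, (true, 0)) PL (index p [seq pl.1 | pl <- PL])).2.2.
have W p l : (p, l) \in PL -> exists2 l', (p, l') \in PL & w p = l'.2.
  move=> H; have pin : p \in [seq pl.1 | pl <- PL] by apply/mapP; exists (p, l).
  set i := index p [seq pl.1 | pl <- PL]; have lti : i < size PL.
    by rewrite -(size_map fst) index_mem.
  exists (nth (0, (true, 0)) PL i).2; last by [].
  rewrite (_ : (p, _) = nth (0, (true, 0)) PL i) ?mem_nth //.
  rewrite [RHS]surjective_pairing; congr (_, _).
  by rewrite -(nth_map _ 0) // nth_index.
rewrite /nv /bcount -size_filter -(size_map w); apply: uniq_leq_size.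
  rewrite map_inj_in_uniq ?filter_uniq ?iota_uniq //.
  have aux p q : first x p -> first x q -> p < size x -> q < size x -> w p = w q ->
    p < q -> False.
    move=> fp fq lp lq e lt; have /andP [litp _] := fp; have /andP [litq /ballP B] := fq.
    have [lp0 Hp0] := lit_mem lp litp; have [lq0 Hq0] := lit_mem lq litq.
    have [l Hp ep] := W _ _ Hp0; have [l' Hq eq] := W _ _ Hq0.
    by have := B p lt; rewrite litp (same_var Hp Hq) -ep -eq e eqxx.
  move=> p q; rewrite !mem_filter !mem_iota => /andP [fp lp] /andP [fq lq] e.
  by case: (ltngtP p q) => // lt; [case: (aux p q)|case: (aux q p)].
move=> v /mapP [p]; rewrite mem_filter mem_iota => /andP [/andP [lp _] ltp] ->.
have [l0 H0] := lit_mem ltp lp; have [l H ->] := W _ _ H0.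
rewrite mem_undup; apply/mapP; exists l => //.
rewrite -(map_posF 0 F) -map_flatten; apply/mapP; exists (p, l) => //.
Qed.

Lemma nvars_size : nvars F <= size x.
Proof.
rewrite /nvars; apply: leq_trans (size_undup _) _; rewrite size_map.
rewrite -(map_posF 0 F) -map_flatten size_map -(size_map fst).
have [<- _] := scan_enc 0; rewrite size_filter.
by apply: leq_trans (count_size _ _) _; rewrite size_iota.
Qed.

End Spec.

(** For values that may exceed the ruler. Truncation is compatible with sums, products and powers of
    2, hence with polynomials, and the truncated value suffices for comparison with anything that
    fits. *)
Definition satc (C : ctx) (g : C -> nat) := comput (fun a => minn (len a) (g a)).

Lemma satc_of (C : ctx) (g : C -> nat) : comput g -> satc g.
Proof.
move=> cg; apply: (comp_know cg).
have cg' : comput (C := refine (fun a : C => g a <= len a)) g by comp_auto.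
by apply: (comp_eq cg') => a [_ le]; apply/minn_idPr.
Qed.

Lemma satc_succ (C : ctx) (g : C -> nat) : satc g -> satc (fun a => (g a).+1).
Proof. by move=> cg; apply: (comp_eq (comp_ssucc cg)) => a _; lia. Qed.

Lemma satc_add (C : ctx) (g h : C -> nat) : satc g -> satc h ->
  satc (fun a => g a + h a).
Proof. by move=> cg ch; apply: (comp_eq (comp_sadd cg ch)) => a _; lia. Qed.

Lemma comp_x (C : ctx) (f : option bool -> bool) (g : C -> nat) : ~~ f None ->
  satc g -> compb (fun a => f (onth (inp a).1 (g a))).
Proof.
move=> f0 cg.
apply: (comp_eq (comp_and (b := fun a : C => minn (len a) (g a) < len a)
    (c := fun a => f (onth (inp a).1 (minn (len a) (g a)))) _ _)).
- by apply: comp_ltn => //; apply: comp_len.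
- set C' := refine _; apply: (@comp_sym C' (fun s _ => f s));
  first by rewrite /satc in cg; comp_auto.
  by move=> a [].
- move=> a _; case: ltnP => h; first by congr (nat_of_bool (f (onth _ _))); lia.
  rewrite onthE nth_default ?(negPf f0) // size_map.
  by rewrite /len /ruler in h; lia.
Qed.

Lemma comp_is1 (C : ctx) (g : C -> nat) : satc g -> compb (fun a => is1 (inp a).1 (g a)).
Proof. exact: (@comp_x C (fun s => s == Some true)). Qed.

Lemma comp_is0 (C : ctx) (g : C -> nat) : satc g -> compb (fun a => is0 (inp a).1 (g a)).
Proof. exact: (@comp_x C (fun s => s == Some false)). Qed.

(** States of the automaton and other small constants are register values and need room on the
    ruler. *)
Definition big (C : ctx) := forall a : C, dom a -> 6 <= len a.

Lemma big_ext (C : ctx) r Q : big C -> big (@ext C r Q).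
Proof. by move=> bC a [/bC]. Qed.

Lemma big_refine (C : ctx) D : big C -> big (@refine C D).
Proof. by move=> bC a [/bC]. Qed.

Lemma comp_bconst (C : ctx) c : big C -> c <= 6 -> @comput C (fun=> c).
Proof. by move=> bC le; apply: comp_const => a /bC; lia. Qed.

Lemma comp_eqb (C : ctx) (b c : C -> bool) : compb b -> compb c ->
  compb (fun a => b a == c a).
Proof.
move=> cb cc; apply: (comp_eq (comp_eqn cb cc)) => a _.
by case: (b a); case: (c a).
Qed.

Lemma comp_imp (C : ctx) (b c : C -> bool) : compb b ->
  compb (fun a : refine (fun a : C => b a) => c a) ->
  compb (fun a => b a ==> c a).
Proof.
move=> cb cc; apply: (comp_eq (comp_if cb cc (comp_true _))) => a _.
by case: (b a).
Qed.

Ltac big_auto := repeat first [assumption | apply: big_ext | apply: big_refine].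

Ltac comp_rule ::=
  first [ apply: comp_zero | apply: comp_one | apply: comp_true | apply: comp_false
        | apply: comp_and | apply: comp_or | apply: comp_neg | apply: comp_ltn
        | apply: comp_leq | apply: comp_eqn | apply: comp_eqb | apply: comp_odd |
          apply: comp_half
        | apply: comp_div2 | apply: comp_bit | apply: comp_mod2 | apply: comp_sub
        | apply: comp_is1 | apply: comp_is0 | apply: satc_succ | apply: satc_add
        | apply: satc_of | apply: comp_bcount; [|move=> ? ?] | apply: comp_bex;
          [|move=> ? ?]
        | apply: comp_ball; [|move=> ? ?] ].

Lemma comp_eqc (C : ctx) (g : C -> nat) c : big C -> c <= 6 -> comput g ->
  compb (fun a => g a == c).
Proof. by move=> bC le cg; apply: comp_eqn => //; apply: comp_bconst. Qed.

Lemma comp_tr (C : ctx) (g : C -> nat) (b : C -> bool) : big C -> comput g -> compb b ->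
  comput (fun a => tr (g a) (b a)).
Proof.
move=> bC cg cb; rewrite /tr.
have T (C' : ctx) (h : C' -> nat) c : big C' -> c <= 6 -> comput h ->
  compb (fun a => h a == c) by move=> bC' le ch; apply: comp_eqc.
do 5![apply: comp_if; [by apply: T; [big_auto| |comp_auto] |
  first [by apply: comp_bconst; [big_auto|]
        | by apply: comp_if; [comp_auto | apply: comp_bconst; [big_auto|] ..]] |]].
by apply: comp_bconst; [big_auto|].
Qed.

Lemma comp_st (C : ctx) (p : C -> nat) : big C -> comput p ->
  comput (fun a => st (inp a).1 (p a)).
Proof.
move=> bC cp; apply: (@comp_iteri C p (fun=> 0) (fun a i s => tr s (is1 (inp a).1 i)))
  => //.
  exact: comp_zero.
move=> r ler; apply: comp_tr; [by big_auto | by comp_auto|].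
by apply: comp_is1; comp_auto.
Qed.

Lemma comp_lit (C : ctx) (p : C -> nat) : big C -> comput p ->
  compb (fun a => lit (inp a).1 (p a)).
Proof. by move=> bC cp; apply: comp_eqc => //; apply: comp_st. Qed.

Lemma comp_same (C : ctx) (p q : C -> nat) : comput p -> comput q ->
  compb (fun a => same (inp a).1 (p a) (q a)).
Proof.
move=> cp cq; apply: comp_bex; first exact: comp_len.
move=> r ler.
by repeat first [comp_hyp | comp_rule | comp_reg].
Qed.

Lemma comp_first (C : ctx) (p : C -> nat) : big C -> comput p ->
  compb (fun a => first (inp a).1 (p a)).
Proof.
move=> bC cp; apply: comp_and; first exact: comp_lit.
apply: comp_ball => [|r ler]; first by comp_auto.
apply: comp_neg; apply: comp_and; first by apply: comp_lit; [big_auto|comp_auto].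
by apply: comp_same; comp_auto.
Qed.

Lemma comp_size (C : ctx) : comput (fun a : C => size (inp a).1).
Proof. exact: (comp_pred (comp_len C)). Qed.

Lemma comp_seen (C : ctx) (p q : C -> nat) : big C -> comput p -> comput q ->
  (forall a, dom a -> q a < len a) -> compb (fun a => seen (inp a).1 (p a) (q a)).
Proof.
move=> bC cp cq H; apply: comp_bex; first exact: comp_succ.
move=> r ler; apply: comp_and; first by apply: comp_lit; [big_auto|comp_auto].
by apply: comp_same; comp_auto.
Qed.

Lemma comp_rank (C : ctx) (p : C -> nat) : big C -> comput p ->
  comput (fun a => rank (inp a).1 (p a)).
Proof.
move=> bC cp; apply: comp_bcount; first exact: comp_size.
move=> r ler; apply: comp_and; first by apply: comp_first; [big_auto|comp_auto].
apply: comp_neg; apply: comp_seen; [by big_auto|by comp_auto|by comp_auto|].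
by move=> [a i] [[_ /= /andP [lt _]] _]; rewrite /len /ruler /=; lia.
Qed.

Lemma comp_nv (C : ctx) : big C -> comput (fun a : C => nv (inp a).1).
Proof.
move=> bC; apply: comp_bcount; first exact: comp_size.
by move=> r ler; apply: comp_first; [big_auto|comp_auto].
Qed.

Lemma comp_lit_value (C : ctx) (v p : C -> nat) : big C -> comput v -> comput p ->
  compb (fun a => lit_value (inp a).1 (v a) (p a)).
Proof.
move=> bC cv cp; apply: comp_eqb; first by comp_auto.
by apply: comp_bit => //; apply: comp_rank.
Qed.

Lemma comp_cl (C : ctx) (v p : C -> nat) : big C -> comput v -> comput p ->
  comput (fun a => cl (inp a).1 (v a) (p a)).
Proof.
move=> bC cv cp.
apply: (@comp_iteri C p (fun=> 0) (fun a i c => if st (inp a).1 i == 0 then 0 else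
  if (st (inp a).1 i == 2) && lit_value (inp a).1 (v a) i then 1 else c)) => //.
  exact: comp_zero.
move=> r ler; apply: comp_if; [|exact: comp_zero|apply: comp_if;
  [|exact: comp_one|by comp_auto]].
  by apply: comp_eqc; [big_auto| |apply: comp_st; [big_auto|comp_auto]].
apply: comp_and; first by apply: comp_eqc; [big_auto| |apply: comp_st;
  [big_auto|comp_auto]].
by apply: comp_lit_value; [big_auto|comp_auto|comp_auto].
Qed.

Lemma comp_okf (C : ctx) (v : C -> nat) : big C -> comput v ->
  compb (fun a => okf (inp a).1 (v a)).
Proof.
move=> bC cv; apply: comp_ball => [|r ler]; first exact: comp_size.
apply: comp_imp; last first.
  by apply: comp_neg; apply: comp_eq0; apply: comp_cl; [big_auto|comp_auto|comp_auto].
apply: comp_and; last by comp_auto.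
by apply: comp_eqc; [big_auto| |apply: comp_st; [big_auto|comp_auto]].
Qed.

Lemma comp_satbf (C : ctx) : big C -> compb (fun a : C => satbf (inp a).1).
Proof.
move=> bC; apply: comp_bex => [|r ler]; first exact: comp_len.
by apply: comp_okf; [big_auto|comp_auto].
Qed.

(** * Deciding small succinct instances *)

Section Match.
Variable y : seq bool.
Let s := size y.

(* Positions in y; the value [s.+1] signals a mismatch. *)
Definition match1 p b := if onth y p == Some b then p.+1 else s.+1.

Definition matches p str := foldl match1 p str.

Lemma onth_size p : s <= p -> onth y p = None.
Proof. by move=> le; rewrite onthE nth_default ?size_map. Qed.

Lemma matches_fail str : matches s.+1 str = s.+1.
Proof.
by rewrite /matches; elim: str => //= b str IH; rewrite {2}/match1 onth_size.
Qed.

(** Nothing is ever decoded: the search guesses a number and a circuit and compares their code with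
    y, for which a current position is all the memory needed. A mismatch leads past the end and is
    never recovered from. *)
Lemma matchesP p str : p <= s -> (matches p str == s) = (str == drop p y).
Proof.
elim: str p => [|b str IH] p le.
  rewrite /matches /=; case: (drop p y) (size_drop p y) => [|c t] /= szd.
    by rewrite eqn_leq le -subn_eq0 -szd.
  by apply/negbTE/eqP => e; rewrite e subnn in szd.
rewrite /matches /= -/(matches _ _) {1}/match1; case: (onth y p =P Some b) => [E|nE].
  have lt : p < s by rewrite ltnNge; apply/negP => h; rewrite onth_size in E.
  rewrite IH // [in RHS](drop_nth false lt) eqseq_cons.
  by move: E; rewrite onthE (nth_map false) // => -[->]; rewrite eqxx.
rewrite matches_fail gtn_eqF //; apply/esym/eqP => E; case: nE.
by have := onth_drop y p 0; rewrite -E addn0.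
Qed.

Lemma matches_cat p s1 s2 : matches p (s1 ++ s2) = matches (matches p s1) s2.
Proof. exact: foldl_cat. Qed.

(** The number of binary digits of v, written as a bounded count so that a program can compute
    it. *)
Definition nbits v := bcount v (fun i => v %/ 2 ^ i != 0).

Lemma bcount_ltn_id n k : k <= n -> bcount n (fun i => i < k) = k.
Proof.
elim: n k => [|n IH] k; first by rewrite leqn0 => /eqP ->.
rewrite bcountS leq_eqVlt => /orP [/eqP ->|le].
  by rewrite ltnSn /bcount (eq_in_count (a2 :=
    xpredT)) ?count_predT ?size_iota ?addn1 // => i;
    rewrite mem_iota => /= h; rewrite ltnS ltnW.
by rewrite IH // ltnNge -ltnS le addn0.
Qed.

Lemma nbitsE v : nbits v = up_log 2 v.+1.
Proof.
have lt i : (v %/ 2 ^ i != 0) = (i < up_log 2 v.+1).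
  rewrite -lt0n divn_gt0 ?expn_gt0 //; apply/idP/idP; apply: contraTT.
    rewrite -leqNgt -ltnNge => le; exact: leq_trans (up_logP v.+1 (isT : 1 < 2))
      (leq_pexp2l _ le).
  by rewrite -leqNgt -ltnNge => le; apply: up_log_min.
rewrite /nbits /bcount (eq_count lt) -/(bcount v _) bcount_ltn_id //.
by apply: up_log_min => //; apply: ltn_expl.
Qed.

Definition match_binary p v :=
  match1 (iteri (nbits v) (fun i q => match1 (match1 q true) (bit v i)) p) false.

Lemma iteri_mkseq T U (f : T -> U -> T) (g : nat -> U) n x :
  iteri n (fun i acc => f acc (g i)) x = foldl f x (mkseq g n).
Proof. by elim: n => // n IH; rewrite iteriS IH mkseqS -cats1 foldl_cat. Qed.

Lemma matches_flatten T (enc : T -> seq bool) (l : seq T) p :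
  matches p (flatten [seq true :: enc u | u <- l]) =
  foldl (fun q u => matches (match1 q true) (enc u)) p l.
Proof. by elim: l p => //= u l IH p; rewrite -IH /matches -foldl_cat. Qed.

Lemma match_binaryE p v : match_binary p v = matches p (enc_binary v).
Proof.
rewrite /enc_binary /enc_list matches_cat matches_flatten /match_binary.
by rewrite (iteri_mkseq (fun q b => match1 (match1 q true) b)) nbitsE.
Qed.

Definition match_unary p m := match1 (iteri m (fun _ q => match1 q true) p) false.

Lemma match_unaryE p m : match_unary p m = matches p (enc_unary m).
Proof.
rewrite /enc_unary -cats1 matches_cat /match_unary; congr match1.
by elim: m => //= m ->; rewrite -[RHS]/(matches p (nseq m.+1 true)) -addn1 nseqD
  matches_cat.
Qed.

Definition gate_of k a b :=
  if k == 0 then GConst (a != 0) else if k == 1 then GNot a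
  else if k == 2 then GAnd a b else GOr a b.

Definition match_gate p k a b :=
  if k == 0 then match1 (match1 (match1 p false) false) (a != 0)
  else if k == 1 then match_binary (match1 (match1 p false) true) a
  else if k == 2 then match_binary (match_binary (match1 (match1 p true) false) a) b
  else match_binary (match_binary (match1 (match1 p true) true) a) b.

Lemma match_gateE p k a b : match_gate p k a b = matches p (enc_gate (gate_of k a b)).
Proof.
by case: k => [|[|[|k]]] //; rewrite /match_gate /= !match_binaryE -?matches_cat.
Qed.

(** Digit j of c in base 2^s, where s is |y|: one register holds a whole list of numbers. Three such
    lists, for the kinds and the two arguments of the gates, describe a circuit. *)
Definition field c j := c %/ 2 ^ (s * j) %% 2 ^ s.

Definition gate_at kk aa bb j := gate_of (field kk j) (field aa j) (field bb j).

Definition match_gates p G kk aa bb :=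
  match1 (iteri G (fun j q => match_gate (match1 q true) (field kk j) (field aa j)
    (field bb j)) p)
    false.

Lemma match_gatesE p G kk aa bb :
  match_gates p G kk aa bb = matches p (enc_list enc_gate (mkseq (gate_at kk aa bb) G)).
Proof.
rewrite /enc_list matches_cat matches_flatten /match_gates /=; congr match1.
rewrite -(iteri_mkseq (fun q g => matches (match1 q true) (enc_gate g))).
by elim: G => //= G ->; rewrite match_gateE.
Qed.

Definition circuit_of m G out kk aa bb := Circuit m (mkseq (gate_at kk aa bb) G) out.

Definition match_sgr N m G out kk aa bb :=
  match_binary (match_gates (match_unary (match_binary 0 N) m) G kk aa bb) out == s.

Lemma match_sgrE N m G out kk aa bb :
  match_sgr N m G out kk aa bb = (y == enc_sgr N (circuit_of m G out kk aa bb)).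
Proof.
rewrite /match_sgr match_gatesE match_unaryE !match_binaryE -!matches_cat matchesP //.
by rewrite drop0 eq_sym /enc_sgr /enc_circuit /= -!catA.
Qed.

Definition args_below k a b B :=
  if k == 0 then true else if k == 1 then a < B else (a < B) && (b < B).

Lemma args_belowE k a b B :
  args_below k a b B = all (fun i => i < B) (gate_args (gate_of k a b)).
Proof. by case: k => [|[|[|k]]] //=; rewrite ?andbT. Qed.

Definition wf_code m G out kk aa bb :=
  ball G (fun j => args_below (field kk j) (field aa j) (field bb j) (m + j)) && (out <
    m + G).

Lemma wf_codeE m G out kk aa bb :
  wf_code m G out kk aa bb = circuit_wf (circuit_of m G out kk aa bb).
Proof.
rewrite /wf_code /circuit_wf /= size_mkseq; congr (_ && _).
apply/ballP/forallP => [H j|H j lt].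
  by rewrite nth_mkseq // -args_belowE; apply: H.
by have := H (Ordinal lt); rewrite /= nth_mkseq // -args_belowE.
Qed.

Definition gate_value w k a b : bool :=
  if k == 0 then a != 0 else if k == 1 then ~~ bit w a
  else if k == 2 then bit w a && bit w b else bit w a || bit w b.

(** All wire values in one number: bit i is wire i. The binary digits of u and v are the inputs, and
    each gate sets the next bit. *)
Definition wires m u v kk aa bb j :=
  iteri j (fun i w => w + gate_value w (field kk i) (field aa i) (field bb i) * 2 ^ (m
    + i))
    (u + v * 2 ^ m./2).

Definition edge_code m G out kk aa bb u v := bit (wires m u v kk aa bb G) out.

Lemma wires_bound m u v kk aa bb j :
  wires m u v kk aa bb j <= u + v * 2 ^ m./2 + 2 ^ (m + j).
Proof.
rewrite /wires; elim: j => [|j IH]; first exact: leq_addr.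
rewrite iteriS; apply: leq_trans (leq_add IH (leqnn _)) _.
by case: (gate_value _ _ _ _); rewrite addnS expnS; lia.
Qed.

Lemma edge_codeE m G out kk aa bb u v : ~~ odd m -> u < 2 ^ m./2 -> v < 2 ^ m./2 ->
  edge_code m G out kk aa bb u v =
  circuit_eval (circuit_of m G out kk aa bb) (digits m./2 u ++ digits m./2 v).
Proof.
move=> em ltu ltv; rewrite /edge_code /circuit_eval /=.
set x := _ ++ _; set f := (fun w g => _).
suff [H _] : (forall i, nth false (foldl f x (mkseq (gate_at kk aa bb) G)) i =
      bit (wires m u v kk aa bb G) i) /\
    (size (foldl f x (mkseq (gate_at kk aa bb) G)) =
      m + G /\ wires m u v kk aa bb G < 2 ^ (m + G)).
  by rewrite H.
have mE : m./2 + m./2 = m by rewrite addnn -[RHS]odd_double_half (negPf em).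
elim: G => [|G [IH [szE wlt]]].
  rewrite /x /wires /= addn0 size_cat !size_mkseq mE; split; last first.
    split=> //; rewrite -[in ltnRHS]mE expnD; nia.
  move=> i; rewrite mulnC bit_cat // nth_cat size_mkseq; case: ltnP => h.
    by rewrite nth_mkseq.
  case: (ltnP (i - m./2) m./2) => h'; first by rewrite nth_mkseq.
  rewrite nth_default ?size_mkseq // bit_small //.
  by apply: leq_trans ltv _; rewrite leq_exp2l.
set l := foldl _ _ _ in IH szE; set w := wires _ _ _ _ _ _ _ in IH wlt.
have -> : foldl f x (mkseq (gate_at kk aa bb) G.+1) =
  rcons l (gate_eval l (gate_at kk aa bb G)).
  by rewrite mkseqS -cats1 foldl_cat.
have -> : wires m u v kk aa bb G.+1 =
  w + gate_value w (field kk G) (field aa G) (field bb G) * 2 ^ (m + G) by [].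
have gE : gate_eval l (gate_at kk aa bb G) =
  gate_value w (field kk G) (field aa G) (field bb G).
  by rewrite /gate_at; case: (field kk G) => [|[|[|k]]] //=; rewrite ?IH.
rewrite size_rcons szE addnS; split; last first.
  split=> //; rewrite expnS; case: (gate_value _ _ _ _); lia.
move=> i; rewrite nth_rcons szE gE mulnC bit_cat //; case: ltngtP => h.
- by rewrite IH.
- rewrite bit_small //; case: (gate_value _ _ _ _) => /=.
    by have := ltn_expl (i - (m + G)) (isT : 1 < 2); lia.
  by rewrite expn_gt0.
- by rewrite h subnn /bit divn1; case: (gate_value _ _ _ _).
Qed.

End Match.

Lemma fields_exist y n (f : nat -> nat) : (forall j, j < n -> f j < 2 ^ size y) ->
  exists2 c, c < 2 ^ (size y * n) & forall j, j < n -> field y c j = f j.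
Proof.
elim: n f => [|n IH] f H; first by exists 0; rewrite // expn_gt0.
have [|c ltc E] := IH (fun j => f j.+1); first by move=> j lt; apply: H.
have pos : 0 < 2 ^ size y by rewrite expn_gt0.
exists (f 0 + 2 ^ size y * c).
  by rewrite mulnS expnD; have := H 0 isT; nia.
case=> [|j] lt; rewrite /field.
  by rewrite muln0 divn1 addnC mulnC modnMDl modn_small // H.
rewrite mulnS expnD divnMA addnC mulnC divnMDl // (divn_small (H 0 isT)) addn0.
exact: E.
Qed.

(** * Exhaustive search for the encoded graph *)

Fixpoint holds_nat N (E : nat -> nat -> bool) n (f : formula n) : seq nat -> bool :=
  match f with
  | FEdge _ i j => fun e => E (nth 0 e i) (nth 0 e j)
  | FEq _ i j => fun e => nth 0 e i == nth 0 e j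
  | FNot _ f1 => fun e => ~~ holds_nat N E f1 e
  | FAnd _ f1 f2 => fun e => holds_nat N E f1 e && holds_nat N E f2 e
  | FEx _ f1 => fun e => bex N (fun x => holds_nat N E f1 (x :: e))
  end.

Lemma holds_natE N C n (f : formula n) (e : n.-tuple (SGR N C)) (E : nat -> nat -> bool) :
  (forall u v, u < N -> v < N ->
     E u v = circuit_eval C (digits (inputs C)./2 u ++ digits (inputs C)./2 v)) ->
  holds f e = holds_nat N E f [seq nat_of_ord (x : 'I_N) | x <- e].
Proof.
move=> HE.
have nthE m (t : m.-tuple (SGR N C)) (i : 'I_m) :
    nth 0 [seq nat_of_ord (x : 'I_N) | x <- t] i = tnth t i :> nat.
  by rewrite (nth_map (tnth_default t i)) ?size_tuple // -tnth_nth.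
elim: f e => {n} [n i j|n i j|n f IH|n f IHf g IHg|n f IH] e /=.
- by rewrite !nthE HE.
- by rewrite !nthE.
- by rewrite IH.
- by rewrite IHf IHg.
- apply/existsP/bexP => [[x]|[x lt]].
    by rewrite IH => H; exists (x : 'I_N).
  by move=> H; exists (Ordinal lt); rewrite IH.
Qed.

Section Decide.
Variables (b : {poly nat}) (psi : sentence).

Definition code_ok y N m G out kk aa bb :=
  [&& match_sgr y N m G out kk aa bb, wf_code y m G out kk aa bb,
      ~~ odd m, N <= 2 ^ m./2, m + G <= b.[(N ^ 2)%N]%R &
      holds_nat N (edge_code y m G out kk aa bb) psi [::]].

(** Inputs are coded in unary and every gate takes at least one bit, so m, G and the output wire are
    below s. Kinds and arguments of gates are below 2^s, and fewer than s of them are packed, which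
    gives the bound 2^(s s) for each list. *)
Definition decide y := let s := size y in
  bex (2 ^ s) (fun N => bex s (fun m => bex s (fun G => bex s (fun out =>
  bex (2 ^ (s * s)) (fun kk => bex (2 ^ (s * s)) (fun aa => bex (2 ^ (s * s)) (fun bb =>
    code_ok y N m G out kk aa bb))))))).

Lemma code_okP y N m G out kk aa bb : code_ok y N m G out kk aa bb <->
  let C := circuit_of y m G out kk aa bb in
  [/\ y = enc_sgr N C, sgr_valid N C,
    circuit_size C <= b.[(N ^ 2)%N]%R & models (SGR N C) psi].
Proof.
rewrite /code_ok match_sgrE wf_codeE; set C := circuit_of _ _ _ _ _ _ _.
have sz : circuit_size C = m + G by rewrite /circuit_size /= size_mkseq.
have M : ~~ odd m -> N <= 2 ^ m./2 ->
    models (SGR N C) psi <-> holds_nat N (edge_code y m G out kk aa bb) psi [::].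
  move=> em le; rewrite /models (@holds_natE _ _ _ _ _ (edge_code y m G out kk aa bb)) //.
  by move=> u v ltu ltv; apply: edge_codeE => //; apply: leq_trans le.
split.
  case/and5P=> /eqP E wf em le /andP [le2 h]; split=> //.
  - split=> //; exists m./2 => //; rewrite -[LHS]odd_double_half /=.
    by rewrite (negPf em).
  - by rewrite sz.
  - exact/M.
case=> E [wf [n en le]] les mo.
have em : m = n.*2 by [].
have om : ~~ odd m by rewrite em odd_double.
have le' : N <= 2 ^ m./2 by rewrite em doubleK.
apply/and5P; split=> //; first exact/eqP.
by rewrite -sz les; apply/M.
Qed.

Definition gate_kind (g : gate) :=
  match g with GConst _ => 0 | GNot _ => 1 | GAnd _ _ => 2 | GOr _ _ => 3 end.
Definition gate_arg1 (g : gate) : nat :=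
  match g with GConst c => c | GNot i | GAnd i _ | GOr i _ => i end.
Definition gate_arg2 (g : gate) : nat :=
  match g with GAnd _ j | GOr _ j => j | _ => 0 end.

Lemma gate_of_parts g : gate_of (gate_kind g) (gate_arg1 g) (gate_arg2 g) = g.
Proof. by case: g => // -[]. Qed.

Lemma size_enc_list T (enc : T -> seq bool) l : size l < size (enc_list enc l).
Proof.
rewrite /enc_list size_cat addn1 ltnS; elim: l => //= u l IH.
by rewrite ltnS size_cat (leq_trans IH) // leq_addl.
Qed.

Lemma enc_binary_bound v : v < 2 ^ (size (enc_binary v)).-1.
Proof.
apply: leq_trans (up_logP v.+1 (isT : 1 < 2)) _.
rewrite leq_exp2l // -ltnS prednK; last by apply: leq_ltn_trans (size_enc_list _ _).
by apply: leq_trans (size_enc_list _ _); rewrite size_mkseq.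
Qed.

Lemma decideP y : decide y <-> Succinct b psi y.
Proof.
split.
  case/bexP=> N _ /bexP [m _ /bexP [G _ /bexP [out _ /bexP [kk _ /bexP [aa _ /bexP [bb
    _]]]]]].
  by move/code_okP => H; exists N, (circuit_of y m G out kk aa bb).
case=> N [[m gs out] [E V S M]].
set G := size gs.
have szE : size y = size (enc_binary N) + (m.+1 + (size (enc_list enc_gate gs) + size
  (enc_binary out))).
  by rewrite E /enc_sgr !size_cat size_rcons size_nseq.
have h1 := size_enc_list (fun c => [:: c]) (digits (up_log 2 N.+1) N).
have h2 := size_enc_list (fun c => [:: c]) (digits (up_log 2 out.+1) out).
rewrite -/(enc_binary _) in h1 h2; have h3 := size_enc_list enc_gate gs.
have ltN : N < 2 ^ size y.
  apply: leq_trans (enc_binary_bound N) _; rewrite leq_exp2l //; lia.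
case: (V) => /andP [/forallP wf ltout] _; rewrite /= -/G in ltout.
have ltG : m + G + 3 <= size y by rewrite -/G in h3; lia.
have big : m + G + 3 < 2 ^ size y by apply: leq_ltn_trans ltG (ltn_expl _ _).
have wfj j : j < G -> all (fun i => i < 2 ^ size y) (gate_args (nth (GConst false) gs j)).
  move=> lt; have := wf (Ordinal (lt : j < size (gates (Circuit m gs out)))).
  by apply: sub_all => i /= lti; apply: ltn_trans big; lia.
have F1 : forall j, j < G -> gate_kind (nth (GConst false) gs j) < 2 ^ size y.
  by move=> j lt; apply: leq_ltn_trans big; case: (nth _ _ _) => /=; lia.
have F2 : forall j, j < G -> gate_arg1 (nth (GConst false) gs j) < 2 ^ size y.
  move=> j lt; have := wfj j lt; case: (nth _ _ _) => [[]|i|i i'|i i'] /=.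
  - by move=> _; lia.
  - by move=> _; lia.
  - by case/andP.
  - by case/andP.
  - by case/andP.
have F3 : forall j, j < G -> gate_arg2 (nth (GConst false) gs j) < 2 ^ size y.
  move=> j lt; have := wfj j lt; case: (nth _ _ _) => [c|i|i i'|i i'] /=.
  - by move=> _; lia.
  - by move=> _; lia.
  - by case/and3P.
  - by case/and3P.
have [kk ltk Ek] := fields_exist F1.
have [aa lta Ea] := fields_exist F2.
have [bb ltb Eb] := fields_exist F3.
have le2 : 2 ^ (size y * G) <= 2 ^ (size y * size y).
  by rewrite leq_exp2l // leq_mul2l; apply/orP; right; lia.
apply/bexP; exists N => //.
apply/bexP; exists m; first lia.
apply/bexP; exists G; first lia.
apply/bexP; exists out; first lia.
apply/bexP; exists kk; first exact: leq_trans ltk le2.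
apply/bexP; exists aa; first exact: leq_trans lta le2.
apply/bexP; exists bb; first exact: leq_trans ltb le2.
have CE : circuit_of y m G out kk aa bb = Circuit m gs out.
  rewrite /circuit_of; congr Circuit; apply: (@eq_from_nth _ (GConst false));
    rewrite size_mkseq //.
  by move=> j lt; rewrite nth_mkseq // /gate_at Ek // Ea // Eb // gate_of_parts.
by apply/code_okP; rewrite CE.
Qed.

End Decide.

(** * The search as a program *)

Lemma minn_mul z a b : minn z (minn z a * minn z b) = minn z (a * b).
Proof.
case: a b => [|a] [|b]; rewrite ?mul0n ?muln0 ?minn0 ?muln0 //.
have h c d : z <= c -> 0 < d -> minn z (c * d) = z by move=> *; apply/minn_idPl; nia.
have [->|z0] := posnP z; first by rewrite !min0n.
case: (leqP a.+1 z) => ha; case: (leqP b.+1 z) => hb //.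
- by rewrite !(mulnC a.+1) !h // ltnW.
- by rewrite !h // ltnW.
- by rewrite !h // ltnW.
Qed.

Lemma satc_mul (C : ctx) (g h : C -> nat) : satc g -> satc h ->
  satc (fun a => g a * h a).
Proof. by move=> cg ch; apply: (comp_eq (comp_smul cg ch)) => a _; rewrite minn_mul. Qed.

Lemma minn_pow2 z e : minn z (2 ^ minn z e) = minn z (2 ^ e).
Proof.
case: (leqP e z) => h; first by rewrite ?(minn_idPr h).
have h1 := ltn_expl z (isT : 1 < 2); have h2 := ltn_expl e (isT : 1 < 2).
by lia.
Qed.

Lemma satc_pow2 (C : ctx) (g : C -> nat) : satc g -> satc (fun a => 2 ^ g a).
Proof. by move=> cg; apply: (comp_eq (comp_spow2 cg)) => a _; rewrite minn_pow2. Qed.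

Lemma satc_const (C : ctx) c : @satc C (fun=> c).
Proof. exact: comp_sconst. Qed.

Lemma satc_horner (C : ctx) (p : {poly nat}) (g : C -> nat) : satc g ->
  satc (fun a => p.[g a]%R).
Proof.
move=> cg; rewrite /horner; elim: (polyseq p) => [|c cs IH]; first exact: satc_const.
exact: (satc_add (satc_mul IH cg) (satc_const C c)).
Qed.

Lemma satc_exact (C : ctx) (g : C -> nat) : satc g ->
  (forall a, dom a -> g a <= len a) -> comput g.
Proof. by move=> cg H; apply: (comp_eq cg) => a /H le; apply/esym/minn_idPr. Qed.

Lemma satc_ltn (C : ctx) (g : C -> nat) : satc g -> compb (fun a => g a < len a).
Proof.
move=> cg; apply: (comp_eq (comp_ltn cg (comp_len C))) => a _.
by congr nat_of_bool; lia.
Qed.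

Lemma satc_leq (C : ctx) (g h : C -> nat) : comput g -> satc h ->
  compb (fun a => g a <= h a).
Proof.
move=> cg ch; apply: (comp_know cg).
have cg' : comput (C := refine (fun a : C => g a <= len a)) g by comp_auto.
have ch' : @satc (refine (fun a : C => g a <= len a)) h by rewrite /satc in ch *;
  comp_auto.
apply: (comp_eq (comp_leq cg' ch')) => a [_ le]; congr nat_of_bool.
by rewrite leq_min le.
Qed.

Lemma satc_size (C : ctx) : satc (fun a : C => size (inp a).2).
Proof.
apply: (comp_eq (comp_bcount (C := C) (n := @len C)
  (B := fun a i => onth (inp a).2 i != None) _ _)).
- exact: comp_len.
- move=> r ler; apply: (@comp_sym _ (fun _ t => t != None)); first by comp_auto.
  by move=> [a i] /= [_ /andP []].
move=> a _; rewrite /bcount.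
rewrite (eq_count (a2 := fun i => i < size (inp a).2)); last first.
  move=> i; rewrite onthE; case: ltnP => h; first by rewrite (nth_map false).
  by rewrite nth_default ?size_map.
have : forall n k, count (fun i => i < k) (iota 0 n) = minn n k; last by move=> ->.
elim=> [|n IH] k; first by rewrite min0n.
by rewrite -addn1 iotaD count_cat IH /= add0n; lia.
Qed.

(** With s = |y|, packed lists need the exponent s^2 and packed wires at most 2s + 2; the square of
    s + 2 dominates both. *)
Definition scale (C : ctx) (a : C) := (size (inp a).2).+2 * (size (inp a).2).+2.

Lemma comp_tiny (C : ctx) : compb (fun a : C => 2 ^ scale a < len a).
Proof.
by apply: satc_ltn; apply: satc_pow2; apply: satc_mul; apply: satc_succ;
  apply: satc_succ; apply: satc_size.
Qed.

Definition tiny (C : ctx) := forall a : C, dom a -> 2 ^ scale a < len a.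

Lemma tiny_ext (C : ctx) r Q : tiny C -> tiny (@ext C r Q).
Proof. by move=> bC a [/bC]. Qed.

Lemma tiny_refine (C : ctx) D : tiny C -> tiny (@refine C D).
Proof. by move=> bC a [/bC]. Qed.

Ltac tiny_auto := repeat first [assumption | apply: tiny_ext | apply: tiny_refine].

Lemma tiny_size (C : ctx) (a : C) : tiny C -> dom a ->
  [/\ (size (inp a).2).+2 < len a, size (inp a).2 * size (inp a).2 < len a,
     2 ^ size (inp a).2 < len a & 2 ^ (size (inp a).2 * size (inp a).2) < len a].
Proof.
move=> tC /tC; rewrite /scale; move: (size _) => s lt.
have P e : e <= s.+2 * s.+2 -> 2 ^ e < len a.
  by move=> le; apply: leq_ltn_trans lt; rewrite leq_exp2l.
have P' e : e <= s.+2 * s.+2 -> e < len a.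
  by move=> /P; apply: ltn_trans; apply: ltn_expl.
by split; [apply: P'|apply: P'|apply: P|apply: P]; nia.
Qed.

Lemma tiny_double (C : ctx) (a : C) : tiny C -> dom a ->
  (size (inp a).2).*2 < len a.
Proof.
move=> tC /tC; apply: leq_trans; apply: leqW;
  apply: leq_trans (ltnW (ltn_expl _ (isT : 1 < 2))).
by rewrite /scale; nia.
Qed.

Lemma comp_size2 (C : ctx) : tiny C -> comput (fun a : C => size (inp a).2).
Proof.
move=> tC; apply: satc_exact; first exact: satc_size.
by move=> a da; have [h _ _ _] := tiny_size tC da; lia.
Qed.

Lemma comp_y (C : ctx) (f : option bool -> bool) (g : C -> nat) : tiny C -> ~~ f None ->
  comput g -> compb (fun a => f (onth (inp a).2 (g a))).
Proof.
move=> tC f0 cg.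
apply: (comp_eq (comp_and (b := fun a : C => g a < size (inp a).2)
    (c := fun a => f (onth (inp a).2 (g a))) _ _)).
- by apply: comp_ltn => //; apply: comp_size2.
- set C' := refine _; apply: (@comp_sym C' (fun _ t => f t)); first by comp_auto.
  by move=> a [da lt]; have [h _ _ _] := tiny_size tC da; rewrite /len /= in h *; lia.
- move=> a _; case: ltnP => h //=.
  by rewrite onthE nth_default ?(negPf f0) // size_map.
Qed.

Lemma comp_match1 (C : ctx) (p : C -> nat) (b : C -> bool) : tiny C -> comput p ->
  compb b -> comput (fun a => match1 (inp a).2 (p a) (b a)).
Proof.
move=> tC cp cb; rewrite /match1; apply: comp_if.
- apply: (comp_eq (comp_if (b := b) (g :=
  fun a => (onth (inp a).2 (p a) == Some true) : nat)
    (h := fun a => (onth (inp a).2 (p a) == Some false) : nat) _ _ _)) => //.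
  + by apply: (@comp_y _ (fun t => t == Some true)); [tiny_auto| |comp_auto].
  + by apply: (@comp_y _ (fun t => t == Some false)); [tiny_auto| |comp_auto].
  + by move=> a _; case: (b a).
- apply: comp_succ; first by comp_auto.
  move=> a [da /eqP E]; have [h _ _ _] := tiny_size tC da.
  have : p a < size (inp a).2; last by rewrite /len /= in h *; lia.
  by rewrite ltnNge; apply/negP => le; rewrite onth_size in E.
- apply: comp_succ; first by apply: comp_size2; tiny_auto.
  by move=> a [da _]; have [h _ _ _] := tiny_size tC da; rewrite /len /= in h *; lia.
Qed.

Lemma comp_nbits (C : ctx) (v : C -> nat) : comput v -> comput (fun a => nbits (v a)).
Proof.
move=> cv; apply: comp_bcount => // r ler.
by apply: comp_neg; apply: comp_eq0; apply: comp_div2; comp_auto.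
Qed.

Lemma comp_match_binary (C : ctx) (p v : C -> nat) : tiny C -> comput p -> comput v ->
  comput (fun a => match_binary (inp a).2 (p a) (v a)).
Proof.
move=> tC cp cv; apply: comp_match1 => //; last exact: comp_false.
apply: (@comp_iteri C (fun a => nbits (v a)) p
  (fun a i q => match1 (inp a).2 (match1 (inp a).2 q true) (bit (v a) i))) => //.
  exact: comp_nbits.
move=> r ler; apply: comp_match1; [by tiny_auto| |by apply: comp_bit; comp_auto].
by apply: comp_match1; [tiny_auto|comp_auto|apply: comp_true].
Qed.

Lemma comp_match_unary (C : ctx) (p m : C -> nat) : tiny C -> comput p -> comput m ->
  comput (fun a => match_unary (inp a).2 (p a) (m a)).
Proof.
move=> tC cp cm; apply: comp_match1 => //; last exact: comp_false.
apply: (@comp_iteri C m p (fun a i q => match1 (inp a).2 q true)) => //.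
by move=> r ler; apply: comp_match1; [tiny_auto|comp_auto|apply: comp_true].
Qed.

Lemma tiny_big (C : ctx) : tiny C -> big C.
Proof.
move=> tC a /tC; apply: leq_trans; rewrite /scale.
by apply: (@leq_trans (2 ^ 4)) => //; apply: leqW; rewrite leq_exp2l //; nia.
Qed.

Lemma comp_match_gate (C : ctx) (p k u v : C -> nat) : tiny C -> comput p -> comput k ->
  comput u -> comput v -> comput (fun a => match_gate (inp a).2 (p a) (k a) (u a) (v a)).
Proof.
move=> tC cp ck cu cv.
have M (C' : ctx) (q : C' -> nat) b : tiny C' -> comput q ->
    comput (fun a => match1 (inp a).2 (q a) b).
  by move=> tC' cq; apply: comp_match1 => //; case: b;
    [apply: comp_true|apply: comp_false].
apply: comp_if.
- by apply: comp_eqc => //; apply: tiny_big.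
- apply: comp_match1; [by tiny_auto| |by apply: comp_neg; apply: comp_eq0; comp_auto].
  by apply: (M); [tiny_auto|apply: (M); [tiny_auto|comp_auto]].
apply: comp_if.
- by apply: comp_eqc; [apply: tiny_big; tiny_auto| |comp_auto].
- apply: comp_match_binary; [by tiny_auto| |by comp_auto].
  by apply: (M); [tiny_auto|apply: (M); [tiny_auto|comp_auto]].
apply: comp_if.
- by apply: comp_eqc; [apply: tiny_big; tiny_auto| |comp_auto].
all: apply: comp_match_binary; [by tiny_auto| |by comp_auto].
all: apply: comp_match_binary; [by tiny_auto| |by comp_auto].
all: by apply: (M); [tiny_auto|apply: (M); [tiny_auto|comp_auto]].
Qed.

Lemma comp_field (C : ctx) (c j : C -> nat) : tiny C -> comput c -> comput j ->
  comput (fun a => field (inp a).2 (c a) (j a)).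
Proof.
move=> tC cc cj; apply: comp_mod2; last exact: comp_size2.
apply: (comp_know cc); set C' := refine _.
have cc' : @comput C' c by comp_auto.
have cj' : @comput C' j by comp_auto.
have cs : @comput C' (fun a => size (inp a).2) by apply: comp_size2; tiny_auto.
apply: (comp_eq (comp_div2 cc' (satc_mul (satc_of cs) (satc_of cj')))) => a [_ le].
(* The offset of the field may overflow the ruler. Then both the true and the truncated shift give
   0, since the shifted number is at most [len a]. *)
case: (leqP (size (inp a).2 * j a) (len a)) => h //.
have lt := ltn_expl (len a) (isT : 1 < 2).
rewrite !divn_small //; first exact: leq_ltn_trans le lt.
by apply: leq_ltn_trans le _; apply: ltn_trans lt _; rewrite ltn_exp2l.
Qed.

Lemma comp_match_gates (C : ctx) (p G kk aa bb : C -> nat) : tiny C -> comput p ->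
  comput G -> comput kk -> comput aa -> comput bb ->
  comput (fun a => match_gates (inp a).2 (p a) (G a) (kk a) (aa a) (bb a)).
Proof.
move=> tC cp cG ck ca cb; apply: comp_match1 => //; last exact: comp_false.
apply: (@comp_iteri C G p (fun a j q => match_gate (inp a).2 (match1 (inp a).2 q true)
  (field (inp a).2 (kk a) j) (field (inp a).2 (aa a) j) (field (inp a).2 (bb a) j))) =>
    //.
move=> r ler; apply: comp_match_gate; first by tiny_auto.
- by apply: comp_match1; [tiny_auto|comp_auto|apply: comp_true].
all: by apply: comp_field; [tiny_auto|comp_auto|comp_auto].
Qed.

Lemma comp_match_sgr (C : ctx) (N m G out kk aa bb : C -> nat) : tiny C ->
  comput N -> comput m -> comput G -> comput out -> comput kk -> comput aa -> comput bb ->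
  compb (fun a => match_sgr (inp a).2 (N a) (m a) (G a) (out a) (kk a) (aa a) (bb a)).
Proof.
move=> tC cN cm cG co ck ca cb; apply: comp_eqn; last exact: comp_size2.
apply: comp_match_binary => //; apply: comp_match_gates => //.
by apply: comp_match_unary => //; apply: comp_match_binary => //; apply: comp_zero.
Qed.

Lemma comp_args_below (C : ctx) (k u v B : C -> nat) : tiny C -> comput k -> comput u ->
  comput v -> comput B -> compb (fun a => args_below (k a) (u a) (v a) (B a)).
Proof.
move=> tC ck cu cv cB.
apply: (comp_eq (h := fun a => if k a == 0 then 1 else if k a == 1 then (u a < B a : nat)
   else ((u a < B a) && (v a < B a) : nat))); last first.
  by move=> a _; rewrite /args_below; case: (k a) => [|[|]].
apply: comp_if; [by apply: comp_eqc => //; apply: tiny_big|exact: comp_one|].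
apply: comp_if; [by apply: comp_eqc; [apply: tiny_big;
  tiny_auto| |comp_auto]|by comp_auto|].
by comp_auto.
Qed.

Lemma comp_gate_value (C : ctx) (w k u v : C -> nat) : tiny C -> comput w -> comput k ->
  comput u -> comput v -> compb (fun a => gate_value (w a) (k a) (u a) (v a)).
Proof.
move=> tC cw ck cu cv.
apply: (comp_eq (h := fun a => if k a == 0 then (u a != 0 : nat)
  else if k a == 1 then (~~ bit (w a) (u a) : nat)
  else if k a == 2 then (bit (w a) (u a) && bit (w a) (v a) : nat)
  else (bit (w a) (u a) || bit (w a) (v a) : nat))); last first.
  by move=> a _; rewrite /gate_value; case: (k a) => [|[|[|]]].
apply: comp_if; [by apply: comp_eqc => //; apply: tiny_big| |].
  by apply: comp_neg; apply: comp_eq0; comp_auto.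
apply: comp_if; [by apply: comp_eqc; [apply: tiny_big;
  tiny_auto| |comp_auto]|by comp_auto|].
by apply: comp_if; [by apply: comp_eqc; [apply: tiny_big;
  tiny_auto| |comp_auto]|comp_auto..].
Qed.

Lemma comp_wf_code (C : ctx) (m G out kk aa bb : C -> nat) : tiny C ->
  comput m -> comput G -> comput out -> comput kk -> comput aa -> comput bb ->
  (forall a, dom a -> m a <= size (inp a).2 /\ G a <= size (inp a).2) ->
  compb (fun a => wf_code (inp a).2 (m a) (G a) (out a) (kk a) (aa a) (bb a)).
Proof.
move=> tC cm cG co ck ca cb H; apply: comp_and.
  apply: comp_ball => // r ler; apply: comp_args_below; first by tiny_auto.
  1-3: by apply: comp_field; [tiny_auto|comp_auto|comp_auto].
  apply: comp_add; [by comp_auto|by comp_auto|].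
  move=> [a j] [/= da /andP [lt _]]; have [h1 h2] := H a da.
  by have := tiny_double tC da; rewrite /len /=; lia.
apply: comp_ltn; first by comp_auto.
apply: comp_add; [by comp_auto|by comp_auto|].
move=> a [/= da _]; have [h1 h2] := H a da.
by have := tiny_double tC da; rewrite /len /=; lia.
Qed.

Lemma wires_scale s m u v i : m <= s -> i <= s -> u < 2 ^ s -> v < 2 ^ s ->
  u + v * 2 ^ m./2 + 2 ^ (m + i) + 2 ^ (m + i) <= 2 ^ (s.+2 * s.+2).
Proof.
move=> lm li lu lv.
have h1 : 2 ^ (m + i) <= 2 ^ (s + s) by rewrite leq_exp2l //; lia.
have h2 : 2 ^ m./2 <= 2 ^ s by rewrite leq_exp2l //; lia.
have h3 : v * 2 ^ m./2 <= 2 ^ (s + s) by rewrite expnD leq_mul // ltnW.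
have h4 : u <= 2 ^ (s + s) by apply: leq_trans (ltnW lu) _; rewrite leq_exp2l //; lia.
apply: (@leq_trans (2 ^ (s + s).+2)); first by rewrite !expnS; lia.
by rewrite leq_exp2l //; nia.
Qed.

Lemma comp_edge_code (C : ctx) (m G out kk aa bb u v : C -> nat) : tiny C ->
  comput m -> comput G -> comput out -> comput kk -> comput aa -> comput bb ->
  comput u -> comput v ->
  (forall a, dom a -> [/\ m a <= size (inp a).2, G a <= size (inp a).2,
     u a < 2 ^ size (inp a).2 & v a < 2 ^ size (inp a).2]) ->
  compb (fun a => edge_code (inp a).2 (m a) (G a) (out a) (kk a) (aa a) (bb a) (u a) (v
    a)).
Proof.
move=> tC cm cG co ck ca cb cu cv H; apply: comp_bit => //.
have S a : dom a -> u a + v a * 2 ^ (m a)./2 <= len a /\ forall i, i < G a ->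
    u a + v a * 2 ^ (m a)./2 + 2 ^ (m a + i) + 2 ^ (m a + i) <= len a.
  move=> da; have [h1 h2 h3 h4] := H a da; have h := tC a da; rewrite /scale in h.
  have W i : i <= size (inp a).2 ->
      u a + v a * 2 ^ (m a)./2 + 2 ^ (m a + i) + 2 ^ (m a + i) <= len a.
    by move=> li; apply: leq_trans (wires_scale h1 li h3 h4) (ltnW h).
  split; first by have := W 0 isT; lia.
  by move=> i li; apply: W; lia.
apply: (@comp_iteri C G (fun a => u a + v a * 2 ^ (m a)./2)
  (fun a i w => w + gate_value w (field (inp a).2 (kk a) i) (field (inp a).2 (aa a) i)
     (field (inp a).2 (bb a) i) * 2 ^ (m a + i))) => //.
  apply: comp_add => //; last by move=> a /S [].
  apply: comp_mul2 => //; first exact: comp_half.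
  by move=> a /S [h _]; lia.
move=> r ler; apply: comp_add; first by comp_auto.
  apply: comp_mul2.
  - apply: comp_gate_value; [by tiny_auto|by comp_auto|..];
      by apply: comp_field; [tiny_auto|comp_auto|comp_auto].
  - apply: comp_add; [by comp_auto|by comp_auto|].
    move=> [[a i] w] [[/= da /andP [li _]] _]; have [_ h] := S a da; have {}h := h i li.
    have := ltn_expl (m a + i) (isT : 1 < 2); rewrite /len /= in h *; lia.
  - move=> [[a i] w] [[/= da /andP [li _]] _]; have [_ h] := S a da; have {}h := h i li.
    rewrite /len /= in h *; case: (gate_value _ _ _ _); lia.
move=> [[a i] w] [[/= da /andP [li _]] [-> _]]; have [_ h] := S a da; have {}h := h i li.
have := wires_bound (inp a).2 (m a) (u a) (v a) (kk a) (aa a) (bb a) i.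
rewrite /wires /len /= in h *; case: (gate_value _ _ _ _); lia.
Qed.

(** The induction ranges over all contexts, since a quantifier adds a variable to the context. The
    environment is never stored: it is enough that each of its entries is computable. As the
    sentence is fixed, the nesting of loops is too, and the time stays polynomial. *)
Lemma comp_holds n (f : formula n) : forall (C : ctx) (N m G out kk aa bb : C -> nat)
    (e : C -> seq nat), tiny C ->
  comput N -> comput m -> comput G -> comput out -> comput kk -> comput aa -> comput bb ->
  (forall a, dom a -> [/\ m a <= size (inp a).2, G a <= size (inp a).2 &
     N a <= 2 ^ size (inp a).2]) ->
  (forall i, i < n -> comput (fun a => nth 0 (e a) i)) ->
  (forall a i, dom a -> i < n -> nth 0 (e a) i < 2 ^ size (inp a).2) ->
  compb (fun a => holds_nat (N a)
    (edge_code (inp a).2 (m a) (G a) (out a) (kk a) (aa a) (bb a)) f (e a)).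
Proof.
elim: f => {n} [n i j|n i j|n f IH|n f IHf g IHg|n f IH] C N m G out kk aa bb e tC
  cN cm cG co ck ca cb H He Be /=.
- apply: comp_edge_code => //; try exact: He.
  by move=> a da; have [h1 h2 _] := H a da; split=> //; apply: Be.
- by apply: comp_eqn; apply: He.
- by apply: comp_neg; apply: IH.
- apply: comp_and; first exact: IHf.
  apply: IHg; [by tiny_auto|by comp_auto..| | |].
  + by move=> a [da _]; apply: H.
  + by move=> i lt; have {}He := He i lt; comp_auto.
  + by move=> a i [da _]; apply: Be.
- apply: comp_bex => // r ler.
  set C' := ext _ _.
  apply: (IH C' (fun a => N a.1) (fun a => m a.1) (fun a => G a.1) (fun a => out a.1)
    (fun a => kk a.1) (fun a => aa a.1) (fun a => bb a.1) (fun a => a.2 :: e a.1));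
    [by tiny_auto|by comp_auto..| | |].
  + by move=> a [da _]; apply: H.
  + by case=> [|i] lt /=; [|have {}He := He i lt]; comp_auto.
  + move=> [a x] [|i] [/= da /andP [lt _]] li; last exact: Be.
    by have [_ _ h] := H a da; apply: leq_trans h.
Qed.

Lemma comp_code_ok (b : {poly nat}) (psi : sentence) (C : ctx) (N m G out kk aa bb : C
  -> nat) :
  tiny C ->
  comput N -> comput m -> comput G -> comput out -> comput kk -> comput aa -> comput bb ->
  (forall a, dom a -> [/\ m a <= size (inp a).2, G a <= size (inp a).2 &
     N a <= 2 ^ size (inp a).2]) ->
  compb (fun a => code_ok b psi (inp a).2 (N a) (m a) (G a) (out a) (kk a) (aa a) (bb a)).
Proof.
move=> tC cN cm cG co ck ca cb H.
apply: comp_and; first exact: comp_match_sgr.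
apply: comp_and.
  apply: comp_wf_code; [by tiny_auto|by comp_auto..|].
  by move=> a [da _]; have [] := H a da.
apply: comp_and; first by apply: comp_neg; apply: comp_odd; comp_auto.
apply: comp_and.
  apply: satc_leq; first by comp_auto.
  by apply: satc_pow2; apply: satc_of; apply: comp_half; comp_auto.
apply: comp_and.
  apply: satc_leq.
    apply: comp_add; [by comp_auto|by comp_auto|].
    move=> a [[[[da _] _] _] _]; have [h1 h2 _] := H a da.
    by have := tiny_double tC da; rewrite /len /=; lia.
  apply: satc_horner; set C' := refine _.
  have cN' : @comput C' N by comp_auto.
  by apply: (comp_eq (satc_mul (satc_of cN') (satc_of cN'))) => a _; rewrite mulnn.
apply: (@comp_holds _ psi _ _ _ _ _ _ _ _ (fun=> [::]));
  [by tiny_auto|by comp_auto..| | |] => //.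
by move=> a [[[[[da _] _] _] _] _]; apply: H.
Qed.

Lemma comp_decide (b : {poly nat}) (psi : sentence) (C : ctx) : tiny C ->
  compb (fun a : C => decide b psi (inp a).2).
Proof.
move=> tC.
have P2 (C' : ctx) : tiny C' -> comput (fun a : C' => 2 ^ size (inp a).2).
  move=> tC'; apply: comp_pow2; first exact: comp_size2.
  by move=> a da; have [_ _ h _] := tiny_size tC' da; apply: ltnW.
have P3 (C' : ctx) : tiny C' -> comput (fun a : C' => 2 ^ (size (inp a).2 * size (inp
  a).2)).
  move=> tC'; apply: comp_pow2.
    apply: comp_mul; [exact: comp_size2|exact: comp_size2|].
    by move=> a da; have [_ h _ _] := tiny_size tC' da; apply: ltnW.
  by move=> a da; have [_ _ _ h] := tiny_size tC' da; apply: ltnW.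
(* The seven nested searches are treated from the inside out, each in an arbitrary context that
   carries the bounds established by the outer ones. *)
have D6 (C' : ctx) (N m G out kk aa : C' -> nat) : tiny C' -> comput N -> comput m ->
  comput G -> comput out -> comput kk -> comput aa ->
    (forall a, dom a -> N a <= 2 ^ size (inp a).2 /\ m a <= size (inp a).2 /\ G a <=
      size (inp a).2) ->
    compb (fun a => bex (2 ^ (size (inp a).2 * size (inp a).2)) (fun bb => code_ok b
      psi (inp a).2 (N a) (m a) (G a) (out a) (kk a) (aa a) bb)).
  move=> tC' cN cm cG cout ckk caa H; apply: comp_bex => [|r ler]; first by apply: (P3).
  apply: comp_code_ok; [by tiny_auto|by comp_auto..|].
  by move=> a [da _]; have [? [? ?]] := H _ da.
have D5 (C' : ctx) (N m G out kk : C' -> nat) : tiny C' -> comput N -> comput m ->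
  comput G -> comput out -> comput kk ->
    (forall a, dom a -> N a <= 2 ^ size (inp a).2 /\ m a <= size (inp a).2 /\ G a <=
      size (inp a).2) ->
    compb (fun a => bex (2 ^ (size (inp a).2 * size (inp a).2)) (fun aa => bex (2 ^
      (size (inp a).2 * size (inp a).2)) (fun bb => code_ok b psi (inp a).2 (N a) (m a)
      (G a) (out a) (kk a) aa bb))).
  move=> tC' cN cm cG cout ckk H; apply: comp_bex => [|r ler]; first by apply: (P3).
  apply: (D6); [by tiny_auto|by comp_auto..|].
  by move=> a [da _]; apply: H.
have D4 (C' : ctx) (N m G out : C' -> nat) : tiny C' -> comput N -> comput m ->
  comput G -> comput out ->
    (forall a, dom a -> N a <= 2 ^ size (inp a).2 /\ m a <= size (inp a).2 /\ G a <=
      size (inp a).2) ->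
    compb (fun a => bex (2 ^ (size (inp a).2 * size (inp a).2)) (fun kk => bex (2 ^
      (size (inp a).2 * size (inp a).2)) (fun aa => bex (2 ^ (size (inp a).2 * size
      (inp a).2)) (fun bb => code_ok b psi (inp a).2 (N a) (m a) (G a) (out a) kk aa
      bb)))).
  move=> tC' cN cm cG cout H; apply: comp_bex => [|r ler]; first by apply: (P3).
  apply: (D5); [by tiny_auto|by comp_auto..|].
  by move=> a [da _]; apply: H.
have D3 (C' : ctx) (N m G : C' -> nat) : tiny C' -> comput N -> comput m -> comput G ->
    (forall a, dom a -> N a <= 2 ^ size (inp a).2 /\ m a <= size (inp a).2 /\ G a <=
      size (inp a).2) ->
    compb (fun a => bex (size (inp a).2) (fun out => bex (2 ^ (size (inp a).2 * size
      (inp a).2)) (fun kk => bex (2 ^ (size (inp a).2 * size (inp a).2)) (fun aa => bex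
      (2 ^ (size (inp a).2 * size (inp a).2)) (fun bb => code_ok b psi (inp a).2 (N a)
      (m a) (G a) out kk aa bb))))).
  move=> tC' cN cm cG H; apply: comp_bex => [|r ler]; first by apply: (comp_size2).
  apply: (D4); [by tiny_auto|by comp_auto..|].
  by move=> a [da _]; apply: H.
have D2 (C' : ctx) (N m : C' -> nat) : tiny C' -> comput N -> comput m ->
    (forall a, dom a -> N a <= 2 ^ size (inp a).2 /\ m a <= size (inp a).2) ->
    compb (fun a => bex (size (inp a).2) (fun G => bex (size (inp a).2) (fun out => bex
      (2 ^ (size (inp a).2 * size (inp a).2)) (fun kk => bex (2 ^ (size (inp a).2 *
      size (inp a).2)) (fun aa => bex (2 ^ (size (inp a).2 * size (inp a).2)) (fun bb
      => code_ok b psi (inp a).2 (N a) (m a) G out kk aa bb)))))).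
  move=> tC' cN cm H; apply: comp_bex => [|r ler]; first by apply: (comp_size2).
  apply: (D3); [by tiny_auto|by comp_auto..|].
  by move=> a [da /andP [lt _]]; have [? ?] := H _ da; split=> //; split=> //;
    apply: ltnW.
have D1 (C' : ctx) (N : C' -> nat) : tiny C' -> comput N ->
    (forall a, dom a -> N a <= 2 ^ size (inp a).2) ->
    compb (fun a => bex (size (inp a).2) (fun m => bex (size (inp a).2) (fun G => bex
      (size (inp a).2) (fun out => bex (2 ^ (size (inp a).2 * size (inp a).2)) (fun kk
      => bex (2 ^ (size (inp a).2 * size (inp a).2)) (fun aa => bex (2 ^ (size (inp
      a).2 * size (inp a).2)) (fun bb => code_ok b psi (inp a).2 (N a) m G out kk aa
      bb))))))).
  move=> tC' cN H; apply: comp_bex => [|r ler]; first by apply: (comp_size2).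
  apply: (D2); [by tiny_auto|by comp_auto..|].
  by move=> a [da /andP [lt _]]; split; [apply: H|apply: ltnW].
apply: comp_bex => [|r ler]; first exact: P2.
apply: (D1); [by tiny_auto|by comp_auto|].
by move=> a [_ /andP [lt _]]; apply: ltnW.
Qed.

(** * The reduction argument *)

Definition poly_bounded (g : nat -> nat) := exists k, forall n, g n <= n.+2 ^ k.

Lemma poly_bounded_const c : poly_bounded (fun=> c).
Proof.
exists c => n; apply: ltnW; apply: leq_trans (ltn_expl c (isT : 1 < 2)) _.
by case: c => // c; rewrite leq_exp2r.
Qed.

Lemma poly_bounded_id : poly_bounded id.
Proof. by exists 1 => n; rewrite expn1 ltnW. Qed.

Lemma poly_bounded_add g h : poly_bounded g -> poly_bounded h ->
  poly_bounded (fun n => g n + h n).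
Proof.
move=> [k Hk] [l Hl]; exists (k + l).+1 => n.
exact: leq_trans (leq_add (Hk n) (Hl n)) (exp_le2 n k l).
Qed.

Lemma poly_bounded_mul g h : poly_bounded g -> poly_bounded h ->
  poly_bounded (fun n => g n * h n).
Proof. by move=> [k Hk] [l Hl]; exists (k + l) => n; rewrite expnD leq_mul. Qed.

Lemma poly_bounded_horner (p : {poly nat}) g : poly_bounded g ->
  poly_bounded (fun n => p.[g n]%R).
Proof.
move=> bg; rewrite /horner; elim: (polyseq p) => [|c cs IH];
  first exact: poly_bounded_const.
exact: (poly_bounded_add (poly_bounded_mul IH bg) (poly_bounded_const c)).
Qed.

(** For exponent k + 1, let M be the quotient of N by k + 1. Once M is large, N + 2 is at most
    quadratic in M, hence at most 2^M, and raising to the power k + 1 stays below 2^N. *)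
Lemma poly_lt_exp k : exists N0, forall N, N0 <= N -> N.+2 ^ k <= 2 ^ N.
Proof.
case: k => [|k]; first by exists 0 => N _; rewrite expn0 expn_gt0.
have sq M : 6 <= M -> M.+1 * M.+1 + 2 <= 2 ^ M.
  elim: M => // M IH; rewrite leq_eqVlt => /orP [/eqP <- //|le].
  by rewrite expnS; have := IH le; nia.
exists (k.+1 * (k + 6)) => N le; pose M := N %/ k.+1.
have leM : k + 6 <= M by rewrite leq_divRL // mulnC.
have h : N.+2 <= 2 ^ M.
  have lt : N < M.+1 * k.+1 by rewrite ltn_ceil.
  by have := sq M (leq_trans (leq_addl _ _) leM); nia.
apply: (@leq_trans ((2 ^ M) ^ k.+1)); first by rewrite leq_exp2r.
by rewrite -expnM leq_exp2l // leq_divM.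
Qed.

(** * Injectivity and length of the codes *)

Section Encodings.

Definition prefix_free T (enc : T -> seq bool) :=
  forall u v r r', enc u ++ r = enc v ++ r' -> u = v /\ r = r'.

Lemma prefix_free_list T (enc : T -> seq bool) : prefix_free enc ->
  prefix_free (enc_list enc).
Proof.
move=> H; elim=> [|a u IH] [|c v] r r' //=; first by case.
rewrite /enc_list /= -!catA => -[/H [-> E]].
have [|-> ->] := IH v r r'; last by [].
by rewrite /enc_list -!catA.
Qed.

Lemma prefix_free_binary : prefix_free enc_binary.
Proof.
have P : prefix_free (fun c : bool => [:: c]) by move=> a c s s' /= [-> ->].
move=> u v r r' /(prefix_free_list P) [E ->]; split=> //; apply: bit_inj => i.
have sz : up_log 2 u.+1 = up_log 2 v.+1.
  by have := congr1 size E; rewrite !size_mkseq.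
case: (ltnP i (up_log 2 u.+1)) => lt.
  have := congr1 (fun s => nth false s i) E; rewrite nth_mkseq // nth_mkseq //.
  by rewrite -sz.
rewrite !bit_small //; [rewrite sz in lt|];
  exact: leq_trans (up_logP _ (isT : 1 < 2)) (leq_pexp2l _ lt).
Qed.

(** Needed to pass from words to formulas: membership of a code in SAT or UNSAT then depends on the
    one formula it encodes. *)
Lemma enc_cnf_inj : injective enc_cnf.
Proof.
move=> F F' E.
have PL : prefix_free enc_literal.
  by move=> [s u] [t v] r r'; rewrite /enc_literal /= => -[-> /prefix_free_binary [->
    ->]].
have P := prefix_free_list (prefix_free_list PL).
by have [|-> _] := P F F' [::] [::]; rewrite ?cats0.
Qed.

Lemma size_enc_list_le T (enc : T -> seq bool) (l : seq T) c :
  (forall i x0, i < size l -> size (enc (nth x0 l i)) <= c) ->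
  size (enc_list enc l) <= size l * c.+1 + 1.
Proof.
rewrite /enc_list size_cat leq_add2r; elim: l => // a l IH H /=.
rewrite size_cat mulSn -addSn leq_add //; first by rewrite ltnS (H 0 a).
by apply: IH => i x0 lt; apply: (H i.+1).
Qed.

Lemma size_enc_binary v : size (enc_binary v) <= 2 * v + 1.
Proof.
have h := @size_enc_list_le _ (fun b => [:: b]) (digits (up_log 2 v.+1) v) 1.
apply: leq_trans (h _) _ => //; rewrite size_mkseq leq_add2r mulnC leq_mul2l /=.
by apply: up_log_min => //; apply: ltn_expl.
Qed.

(** A crude bound, with binary codes estimated linearly in the number coded; all that matters is
    that it is polynomial in the number N of vertices and the circuit size t. *)
Definition sgr_bound (N t : nat) := 2 * N + 4 * (t * t) + 8 * t + 4.

Lemma size_enc_sgr N C : sgr_valid N C ->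
  size (enc_sgr N C) <= sgr_bound N (circuit_size C).
Proof.
case: C => m gs out [/andP [/forallP wf /= ltout] _].
have -> : size (enc_sgr N (Circuit m gs out)) = size (enc_binary N) +
    (m.+1 + (size (enc_list enc_gate gs) + size (enc_binary out))).
  by rewrite /enc_sgr !size_cat size_rcons size_nseq.
rewrite /circuit_size /=.
set t := m + size gs in ltout *.
have hg : size (enc_list enc_gate gs) <= size gs * (4 * t + 4).+1 + 1.
  apply: size_enc_list_le => i x0 lt.
  have := wf (Ordinal (lt : i < size (gates (Circuit m gs out)))).
  rewrite /= (set_nth_default x0) //.
  have A a : a < m + i -> size (enc_binary a) <= 2 * t.
    by move=> la; apply: leq_trans (size_enc_binary a) _; rewrite /t; lia.
  case: (nth _ _ _) => [c|a|a c|a c] /=; rewrite ?andbT.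
  - by lia.
  - by move/A; lia.
  - by case/andP=> /A h /A h'; rewrite size_cat; lia.
  - by case/andP=> /A h /A h'; rewrite size_cat; lia.
have h1 := size_enc_binary N; have h2 := size_enc_binary out.
have h3 : size gs * (4 * t + 4).+1 <= t * (4 * t + 4).+1 by rewrite leq_mul2r leq_addl
  orbT.
have h4 : m <= t by rewrite leq_addr.
have h5 : t * (4 * t + 4).+1 = 4 * (t * t) + 5 * t by rewrite mulnS mulnDr mulnCA; lia.
rewrite /sgr_bound; move: (size (enc_list _ _)) (size gs * _) (t * (4 * t + 4).+1) hg
  h3 h5 => A B D.
by clearbody t; lia.
Qed.
End Encodings.

(** With the next lemma this bounds the output of a machine: a step lengthens the listed part to the
    right by at most 2, one cell for writing past its end and one for a move to the left. *)
Lemma leading_bits_size A (s : seq (option (bool + A))) : size (leading_bits s) <= size s.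
Proof. by elim: s => // [[[b|]|]] s IH. Qed.

Lemma output_size (M : TM) k x :
  size (output (iter k (@step M) (init M x))) <= size x + 2 * k.
Proof.
apply: leq_trans (leading_bits_size _) _.
elim: k => [|k IH]; first by rewrite /= ffunE /= size_map addn0.
rewrite iterS mulnS; set c := iter k _ _ in IH *.
apply: (@leq_trans (size (c.2 ord0).2 + 2)); last by rewrite addnCA addnC leq_add2l.
rewrite /step; case: ifP => _; first exact: leq_addr.
case: (delta _ _) => [[q w] d] /=; rewrite ffunE.
case: (c.2 ord0) => l r /=; rewrite /tape_move /tape_write /=.
by case: (d ord0); rewrite /= ?size_behead; case: r => //= *; lia.
Qed.

(** * The algorithm and its correctness *)

Section Algorithm.
Variables (b : {poly nat}) (neg : bool).

(** The order of the tests provides the room each computation needs: a ruler long enough for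
    [satbf], then one exponential in |y|^2 for [decide]. The last branch takes y for a negative
    instance; [neg] tells a reduction from UNSAT. *)
Definition solver (x y : seq bool) : bool :=
  if (size x).+1 <= 5 then false else
  if satbf x then true else
  if 2 ^ nv x < (size x).+1 then false else
  if 2 ^ ((size y).+2 * (size y).+2) < (size x).+1 then decide b psi0 y (+) neg
  else neg.

Lemma comp_solver : compb (fun w : base_ctx => solver w.1 w.2).
Proof.
have comp_bool (C : ctx) (c : bool) : compb (fun _ : C => c).
  by case: c; [apply: comp_true|apply: comp_false].
have comp_ifb (C : ctx) (c g h : C -> bool) : compb c ->
    compb (fun a : refine (fun a : C => c a) => g a) ->
    compb (fun a : refine (fun a : C => ~~ c a) => h a) ->
    compb (fun a => if c a then g a else h a).
  move=> cc cg ch; apply: (comp_eq (comp_if cc cg ch)) => a _.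
  by case: (c a).
apply: (@comp_ifb base_ctx (fun w => (size w.1).+1 <= 5)).
- apply: (comp_eq (comp_neg (satc_ltn (satc_const base_ctx 5)))) => w _.
  by rewrite -leqNgt.
- exact: comp_bool.
set C1 := refine _; have b1 : big C1 by move=> w [_]; rewrite -ltnNge.
apply: (@comp_ifb C1 (fun w => satbf w.1)).
- exact: (comp_satbf b1).
- exact: comp_bool.
set C2 := refine _; have b2 : big C2 by move=> w [[_ h] _]; rewrite /= -ltnNge in h.
apply: (@comp_ifb C2 (fun w => 2 ^ nv w.1 < (size w.1).+1)).
- exact: (satc_ltn (satc_pow2 (satc_of (comp_nv b2)))).
- exact: comp_bool.
set C3 := refine _.
apply: (@comp_ifb C3 (fun w => 2 ^ ((size w.2).+2 * (size w.2).+2) < (size w.1).+1)).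
- exact: comp_tiny.
- set C4 := refine _; have t4 : tiny C4 by move=> w [].
  case: neg; first apply: (comp_eq (comp_neg (comp_decide b psi0 t4))) => w _.
    by rewrite addbT.
  by apply: (comp_eq (comp_decide b psi0 t4)) => w _; rewrite addbF.
- exact: comp_bool.
Qed.

End Algorithm.

Section Correct.
Variables (b : {poly nat}) (kq kt : nat).
Hypothesis bt : forall N, (sgr_bound N b.[(N ^ 2)%N]%R).+2 * (sgr_bound N b.[(N ^
  2)%N]%R).+2 <= N.+2 ^ kt.

(** Each model size is either too large to be coded by y, whose length is at most [(2 ^ n).+2 ^ kq]
    when |x| < 2^n, or so small that the exhaustive search on its codes is bounded by n, hence by
    |x|. *)
Definition gap (n : nat) : Prop := forall i,
  2 ^ ((2 ^ n).+2 ^ kq) <= level i \/ 2 ^ ((level i).+2 ^ kt) <= n.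

Lemma sgr_bound_mono N t t' : t <= t' -> sgr_bound N t <= sgr_bound N t'.
Proof. by rewrite /sgr_bound => le; have := leq_mul le le; lia. Qed.

Lemma succinct_small n (x y : seq bool) : gap n -> n <= size x -> (size x).+1 <= 2 ^ n ->
  size y <= (size x).+2 ^ kq -> Succinct b psi0 y ->
  2 ^ ((size y).+2 * (size y).+2) < (size x).+1.
Proof.
move=> gn len ltx ley [N [C [E V S M]]].
have [i Ei] := card_hierarchy ((psi0P _).1 M).
rewrite card_ord in Ei.
have [big|small] := gn i; last first.
  rewrite ltnS; apply: leq_trans len; apply: leq_trans small.
  rewrite leq_exp2l // -Ei; apply: leq_trans (bt N).
  have h : size y <= sgr_bound N b.[(N ^ 2)%N]%R.
    by rewrite E; apply: leq_trans (size_enc_sgr V) (sgr_bound_mono _ S).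
  by apply: leq_mul; rewrite ltnS ltnS.
have : N < 2 ^ size y.
  apply: leq_trans (enc_binary_bound N) _; rewrite leq_exp2l // E /enc_sgr size_cat.
  exact: leq_trans (leq_pred _) (leq_addr _ _).
rewrite Ei ltnNge; case/negP; apply: leq_trans big.
rewrite leq_exp2l //; apply: leq_trans ley _.
by case: (kq) => // k; rewrite leq_exp2r // ltnS ltnS ltnW.
Qed.

(** Taking i = 0 leaves only the second alternative, as [level 0] is 0. The first branch of
    [solver], which gives up on very short inputs, is thereby excluded. *)
Lemma gap_large n : gap n -> 5 <= n.
Proof.
move=> /(_ 0) [|]; first by rewrite leqn0 expn_eq0.
apply: leq_trans; apply: (@leq_trans (2 ^ 4)) => //; rewrite leq_exp2l //.
apply: leq_trans (bt 0); rewrite /sgr_bound; nia.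
Qed.

Lemma solver_correct (neg : bool) (f : seq bool -> seq bool) F :
  (forall x, size (f x) <= (size x).+2 ^ kq) ->
  (forall G, (if neg then ~ satisfiable G else satisfiable G) <->
     Succinct b psi0 (f (enc_cnf G))) ->
  gap (nvars F) -> solver b neg (enc_cnf F) (f (enc_cnf F)) <-> satisfiable F.
Proof.
move=> sf red gF; have h1 := nvars_size F; have h2 := gap_large gF.
set x := enc_cnf F in h1 *.
rewrite /solver ifF; last lia.
case: ifP => [sat|unsat]; first by split=> // _; apply: satbf_sound sat.
case: ifP => [lt|nlt].
  split=> // /(satbf_complete (ltnW lt)); by rewrite unsat.
have le : (size x).+1 <= 2 ^ nvars F.
  rewrite leqNgt; apply: contraFN nlt; apply: leq_ltn_trans.
  by rewrite leq_exp2l // nv_nvars.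
have red' := red F; rewrite -/x in red'.
case: ifP => [ti|nti].
  have D := decideP b psi0 (f x).
  case E: (decide b psi0 (f x)) => /=.
    have /red' := D.1 E; case: neg {red red'} => /=; rewrite ?addTb /=; by split.
  have ns : ~ Succinct b psi0 (f x) by move=> /D; rewrite E.
  case: neg red' {red} => red'; split=> // h; last by case: ns; apply/red'.
  (* For a reduction from UNSAT, a negative instance only refutes unsatisfiability; classical logic
     turns this into satisfiability. *)
  apply: NNPP => /red'; exact: ns.
have ns : ~ Succinct b psi0 (f x).
  move=> su; move/negP: nti; apply.
  exact: succinct_small gF h1 le (sf x) su.
case: neg red' {red} => red'; split=> // h; last by case: ns; apply/red'.
by apply: NNPP => /red'; exact: ns.
Qed.

(** Six exponentials are spent between I and the next level: two on l, a third on l^k, a fourth on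
    2^n, a fifth on the bound for |y|, a sixth on the number of vertices. Each polynomial is
    absorbed by an exponential because I is large. *)
Lemma gap_robust : robust gap.
Proof.
move=> k.
have [a Ha] := poly_lt_exp kt; have [c Hc] := poly_lt_exp k.
have [d Hd] := poly_lt_exp kq.
(* Since i is at most [level i], this places I beyond all three thresholds. *)
pose i := a + c + d; set I := level i.
have leI : i <= I by apply: leq_idx_level.
pose E j := tower j I.
have IE j : I <= E j by apply: leq_trans (tower_ltn j I); apply: leq_addr.
exists (2 ^ (I.+2 ^ kt)).
  by rewrite -[X in X <= _](expn1 2) leq_exp2l // expn_gt0.
move=> n /andP [lo hi] j; case: (leqP j i) => ji.
  right; apply: leq_trans lo; rewrite leq_exp2l //.
  by case: (kt) => // t; rewrite leq_exp2r // ltnS ltnS leq_level.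
left; apply: leq_trans (leq_level ji).
have s1 : 2 ^ (I.+2 ^ kt) <= E 2.
  by rewrite /E /tower !iterS /= leq_exp2l //; apply: Ha; rewrite /i in leI; lia.
have s2 : n <= E 3.
  apply: leq_trans hi _; apply: (@leq_trans ((E 2).+2 ^ k)).
    by case: (k) => // k'; rewrite leq_exp2r //; lia.
  by apply: Hc; have := IE 2; rewrite /i in leI; lia.
have s3 : 2 ^ n <= E 4 by rewrite [E 4]/(2 ^ E 3) leq_exp2l.
have s4 : (2 ^ n).+2 ^ kq <= E 5.
  apply: (@leq_trans ((E 4).+2 ^ kq)); first by case: (kq) => // q;
    rewrite leq_exp2r // ltnS ltnS.
  by apply: Hd; have := IE 4; rewrite /i in leI; lia.
apply: (@leq_trans (E 6)); first by rewrite [E 6]/(2 ^ E 5) leq_exp2l.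
exact: tower_le.
Qed.

End Correct.

Theorem theorem5 :
  exists psi : sentence,
    infinitely_many (fun G => models G psi) /\
    infinitely_many (fun G => ~ models G psi) /\
    forall b : {poly nat},
      reduces SAT (Succinct b psi) \/ reduces UNSAT (Succinct b psi) ->
      exists S : nat -> Prop, robust S /\ sat_solvable_on S.
Proof.
exists psi0; split; first exact: psi0_models.
split=> [|b H]; first exact: psi0_countermodels.
(* Both kinds of reduction become one statement about formulas, with [neg] recording which of the
   two it was. *)
have [neg [f pf red]] : exists neg : bool, exists2 f, polytime f & forall G,
    (if neg then ~ satisfiable G else satisfiable G) <-> Succinct b psi0 (f (enc_cnf G)).
  case: H => -[f pf red]; [exists false|exists true]; exists f => // G.
    by rewrite -red; split=> [s|[G' /enc_cnf_inj ->] //]; exists G.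
  by rewrite -red; split=> [s|[G' /enc_cnf_inj ->] //]; exists G.
(* The exponent [kt] depends on the circuit bound b and bounds the cost of the search in terms of N;
   [kq], below, depends on the reduction and bounds |y| in terms of |x|. *)
have [kt Ht] : poly_bounded (fun N => (sgr_bound N b.[(N ^ 2)%N]%R).+2 * (sgr_bound N
  b.[(N ^ 2)%N]%R).+2).
  have B : poly_bounded (fun N => b.[(N ^ 2)%N]%R).
    by apply: poly_bounded_horner; apply: poly_bounded_mul; apply: poly_bounded_id.
  have A : poly_bounded (fun N => (sgr_bound N b.[(N ^ 2)%N]%R).+2).
    have C c : poly_bounded (fun=> c) := poly_bounded_const c.
    have [k Hk] := poly_bounded_add (poly_bounded_add (poly_bounded_add (poly_bounded_add
      (poly_bounded_mul (C 2) poly_bounded_id) (poly_bounded_mul (C 4)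
        (poly_bounded_mul B B)))
      (poly_bounded_mul (C 8) B)) (C 4)) (C 2).
    by exists k => N; apply: leq_trans (Hk N); rewrite addn2.
  exact: poly_bounded_mul.
have [kq Hq] : exists kq, forall x, size (f x) <= (size x).+2 ^ kq.
  have [M [p HM]] := pf.
  have [k Hk] := poly_bounded_add poly_bounded_id (poly_bounded_mul (poly_bounded_const 2)
    (poly_bounded_horner p poly_bounded_id)).
  exists k => x; have [_ <-] := HM x; apply: leq_trans (output_size _ _ _) (Hk _).
exists (gap kq kt); split; first exact: gap_robust.
exists (fun x => solver b neg x (f x)); first exact: polytime_post pf (comp_solver b neg).
by move=> F gF; apply: (solver_correct Ht Hq red gF).
Qed.
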